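(* Let $0\le\Delta\le 1$ and let $\Lambda$ be a set of positive integers. The following two properties are equivalent: (a) Every power series $f(z)=\sum_{m=0}^\infty a_m z^m$ with real coefficients and radius of convergence $1$ which satisfies $$\lim_{m\in P,\ m\to\infty}|a_m|^{1/m}=1,\qquad P=\{m\ge 0: a_m\neq 0\},$$ and is such that the changes of sign of the sequence $\{a_m\}$ occur only at places $m\in\Lambda$, has a singularity on the arc $I_\Delta=\{e^{i\theta}:|\theta|\le\pi\Delta\}$. (b) All measurable subsets $\Lambda'\subset\Lambda$ have densities at most $\Delta$.
   Context: For a set $\Lambda$ of non-negative integers let $n(x,\Lambda)=\#(\Lambda\cap[0,x])$. The set $\Lambda$ is called measurable if the limit $\lim_{x\to+\infty}n(x,\Lambda)/x$ exists; this limit is then called the density of $\Lambda$. Let $\{a_m\}_{m\ge0}$ be a sequence of real numbers. A sign change occurs at the place $m$ if there exists $k<m$ such that $a_m a_k<0$ while $a_j=0$ for $k<j<m$. A power series $f$ of radius of convergence $1$ has a singularity on a closed arc $I$ of the unit circle if there is a point $\zeta\in I$ to which $f$ has no immediate analytic continuation from the unit disc, i.e. there is no neighborhood $V$ of $\zeta$ and analytic function on $\{|z|<1\}\cup V$ that coincides with $f$ on $\{|z|<1\}$. *)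

(* Defs.v *)
(* Stdlib reals with Coquelicot. *)
From Stdlib Require Import Reals List ClassicalEpsilon.
From Coquelicot Require Import Coquelicot.
Open Scope R_scope.

(* n(x, E) = #(E /\ [0, x]) for real x; every natural number k <= x is
   listed in the range of [seq], since x < up x. *)
Definition count_upto (E : nat -> Prop) (x : R) : nat :=
  length (filter
    (fun k => if excluded_middle_informative (E k /\ INR k <= x)
              then true else false)
    (seq 0 (S (Z.to_nat (up x))))).

(* E is measurable when such a d exists. *)
Definition has_density (E : nat -> Prop) (d : R) : Prop :=
  is_lim (fun x => INR (count_upto E x) / x) p_infty (Finite d).

Definition sign_change_at (a : nat -> R) (m : nat) : Prop :=
  exists k : nat, (k < m)%nat /\ a m * a k < 0 /\
    forall j : nat, (k < j < m)%nat -> a j = 0.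

Definition is_complex_pseries (c : nat -> C) (z w : C) : Prop :=
  @is_pseries C_AbsRing C_NormedModule c z w.

Definition analytic_at (g : C -> C) (z0 : C) : Prop :=
  exists (c : nat -> C) (r : R), 0 < r /\
    forall z : C, Cmod (z - z0)%C < r -> is_complex_pseries c (z - z0)%C (g z).

(* g is a total function, but only its values on the union of the unit disc
   and V matter. *)
Definition immediate_continuation (a : nat -> R) (zeta : C) : Prop :=
  exists (V : C -> Prop) (g : C -> C),
    open V /\ V zeta /\
    (forall z : C, Cmod z < 1 \/ V z -> analytic_at g z) /\
    (forall z : C, Cmod z < 1 ->
       is_complex_pseries (fun m => RtoC (a m)) z (g z)).

Definition on_arc (Delta : R) (zeta : C) : Prop :=
  exists theta : R, Rabs theta <= PI * Delta /\ zeta = (cos theta, sin theta).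

Definition singular_on (a : nat -> R) (I : C -> Prop) : Prop :=
  exists zeta : C, I zeta /\ ~ immediate_continuation a zeta.

(* lim |a_m|^(1/m) = 1 as m tends to infinity along {m : a_m <> 0}. The values
   of [Rpower] at base 0 and of the exponent [/ INR 0] play no role. *)
Definition root_limit_one_on_support (a : nat -> R) : Prop :=
  filterlim (fun m => Rpower (Rabs (a m)) (/ INR m))
    (within (fun m => a m <> 0) eventually) (locally 1).

(* Main.v *)
Require Import Defs.
From Stdlib Require Import Reals Lra Lia ZArith List Classical ClassicalEpsilon.
From Coquelicot Require Import Coquelicot.
Open Scope R_scope.

(** The two implications are proved by real-variable and power-series estimates;
    no contour integration enters.  Throughout, [q = 1 - p] and
    [cis t = e^(i t)].

    _Few measurable sign changes force a singularity_ (density_implies_singular).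
    Suppose that every point of the arc is regular.  By compactness there are
    [p < 1], close to 1, and a slightly larger arc on which the [k]-th Taylor
    coefficient of [f] at [p e^(i t)] is [O((2 q)^(-k))], better by the factor
    [2^(-k)] than the singularity-free disc about [p e^(i t)] of radius [q]
    guarantees (taylor_bounded_arc).  That coefficient is
    [sum_m a_m bin(m,k) (p e^(i t))^(m-k)], so averaging it over the arc shows that
    [sum_m a_m Psi(m) bin(m,k) p^(m-k) q^k] is exponentially small for every
    function [Psi] whose frequencies lie in the arc.  The weights
    [bin(m,k) p^(m-k) q^k] concentrate at [m = k / q] (concentration).  If
    [a_m Psi(m)] keeps one sign for [m] near a place [m0] with [a_(m0) <> 0], nothing
    cancels and the single term [m0] is exponentially small as well; since
    [|a_(m0)|] is not, [Psi(m0)] is (no_coherent_multiplier).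

    Now take for [Psi] a product of sines [sin(pi (t - j + 1/2) / L)] over the places
    [j] of sign change in a window of length [L].  It changes sign exactly where [a]
    does, its frequencies are bounded by [pi] times the proportion of sign changes in
    the window, and it cannot be very small everywhere (sprod_large).  If the window
    contained too few sign changes, [Psi] would qualify as above, and regularity also
    provides a support point [m0] near the maximum of [Psi], because [f] has no
    Hadamard-type gaps (no_gap); this is a contradiction.  Hence every short
    window contains a proportion of sign changes larger than some [Delta' > Delta]
    (many_sign_changes), and a greedy selection extracts a set of density exactly
    [Delta'] (greedy_density), against the hypothesis on measurable subsets.
    For [Delta = 1] the window is replaced by a product vanishing at all places but
    one residue class (no_regular_circle).

    _A dense measurable subset gives a regular arc_ (singular_implies_density).  Let
    [F] be a measurable subset of density [d > Delta].  The function built is a sum of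
    polynomial blocks.  The [c]-th block has coefficients
    [bump(c,m) (-1)^m psi_c(m)], where [bump] is a binomial weight centred at [c] and
    [psi_c] is the product of sines that changes sign, within a window about [c],
    exactly at the places outside [F]; multiplied by [(-1)^m] it changes sign
    exactly at the places of [F].  The frequencies of [psi_c] are at most about
    [pi (1 - d)], so the block is a combination of terms [(1 + U z) / 2] to the power
    [c], roughly, with [U = - e^(i phi)], [|phi| <= pi (1 - d)]; on [|theta| <= pi Delta] the
    base has modulus [|sin((phi + theta) / 2)| <= sin(pi (1 - d + Delta) / 2) < 1].
    The blocks are therefore exponentially small near the arc (block_expands_arc) and
    their sum continues across it.  Because [F] is measurable, [psi_c] has nearly
    the same size at all integers (window_sines_uniform), so the blocks can be normalised
    at their centres while the tails outside the windows stay negligible, and the sum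
    has the prescribed signs and no vanishing coefficient (extremal_sign). *)

(** * Finite sums and convergent complex series *)

Fixpoint Rsum (u : nat -> R) (n : nat) : R :=
  match n with O => 0 | S n => Rsum u n + u n end.

Fixpoint Csum (u : nat -> C) (n : nat) : C :=
  match n with O => RtoC 0 | S n => (Csum u n + u n)%C end.

Definition Cser (u : nat -> C) (l : C) : Prop :=
  forall eps, 0 < eps ->
  exists N, forall n, (N <= n)%nat -> Cmod (Csum u n - l)%C < eps.

Lemma Rsum_ext u v n : (forall i, (i < n)%nat -> u i = v i) -> Rsum u n = Rsum v n.
Proof.
induction n; intros H; simpl; [reflexivity|].
rewrite IHn, (H n) by (intros; try apply H; lia); reflexivity.
Qed.

Lemma Rsum_le u v n : (forall i, (i < n)%nat -> u i <= v i) -> Rsum u n <= Rsum v n.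
Proof.
induction n; intros H; simpl; [lra|].
assert (Rsum u n <= Rsum v n) by (apply IHn; intros; apply H; lia).
assert (u n <= v n) by (apply H; lia). lra.
Qed.

Lemma Rsum_pos u n : (forall i, (i < n)%nat -> 0 <= u i) -> 0 <= Rsum u n.
Proof.
induction n; intros H; simpl; [lra|].
assert (0 <= Rsum u n) by (apply IHn; intros; apply H; lia).
assert (0 <= u n) by (apply H; lia). lra.
Qed.

Lemma Rsum_plus u v n : Rsum (fun i => u i + v i) n = Rsum u n + Rsum v n.
Proof. induction n; simpl; [|rewrite IHn]; lra. Qed.

Lemma Rsum_scal c u n : Rsum (fun i => c * u i) n = c * Rsum u n.
Proof. induction n; simpl; [|rewrite IHn]; lra. Qed.

Lemma Rsum_const c n : Rsum (fun _ => c) n = INR n * c.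
Proof. induction n; [simpl; lra|]. rewrite S_INR. simpl Rsum. rewrite IHn. lra. Qed.

Lemma Rsum_mono u n m : (forall i, 0 <= u i) -> (n <= m)%nat -> Rsum u n <= Rsum u m.
Proof.
intros Hu; induction 1; [lra|]. simpl. specialize (Hu m); lra.
Qed.

Lemma Rsum_head u n : Rsum u (S n) = u 0%nat + Rsum (fun i => u (S i)) n.
Proof. induction n; [simpl; lra|]. simpl in *. rewrite IHn. lra. Qed.

Lemma Rsum_term_le u n i : (forall j, 0 <= u j) -> (i < n)%nat -> u i <= Rsum u n.
Proof.
intros Hu Hi. apply Rle_trans with (Rsum u (S i)).
- simpl. assert (0 <= Rsum u i) by (apply Rsum_pos; auto). lra.
- apply Rsum_mono; auto.
Qed.

Lemma Rsum_split u n m : Rsum u (n + m) = Rsum u n + Rsum (fun i => u (n + i)%nat) m.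
Proof.
induction m; [rewrite Nat.add_0_r; simpl; lra|].
rewrite Nat.add_succ_r. simpl. rewrite IHm. lra.
Qed.

Lemma Csum_ext u v n : (forall i, (i < n)%nat -> u i = v i) -> Csum u n = Csum v n.
Proof.
induction n; intros H; simpl; [reflexivity|].
rewrite IHn, (H n) by (intros; try apply H; lia); reflexivity.
Qed.

Lemma Csum_plus u v n : Csum (fun i => u i + v i)%C n = (Csum u n + Csum v n)%C.
Proof. induction n; simpl; [|rewrite IHn]; ring. Qed.

Lemma Csum_scal c u n : Csum (fun i => c * u i)%C n = (c * Csum u n)%C.
Proof. induction n; simpl; [|rewrite IHn]; ring. Qed.

Lemma Csum_zero u n : (forall i, (i < n)%nat -> u i = RtoC 0) -> Csum u n = RtoC 0.
Proof.
induction n; intros H; simpl; [reflexivity|].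
rewrite IHn, (H n) by (intros; try apply H; lia); apply Cplus_0_l.
Qed.

Lemma Csum_single u n i : (i < n)%nat ->
  (forall j, (j < n)%nat -> j <> i -> u j = RtoC 0) -> Csum u n = u i.
Proof.
induction n; intros Hi H; [lia|]; simpl.
destruct (Nat.eq_dec i n) as [->|Hn].
- rewrite Csum_zero; [ring|]. intros; apply H; lia.
- rewrite IHn by (intros; try apply H; lia). rewrite (H n) by lia. ring.
Qed.

Lemma Csum_head u n : Csum u (S n) = (u 0%nat + Csum (fun i => u (S i)) n)%C.
Proof. induction n; [simpl; ring|]. simpl in *. rewrite IHn. ring. Qed.

Lemma Csum_swap (u : nat -> nat -> C) n m :
  Csum (fun i => Csum (u i) m) n = Csum (fun j => Csum (fun i => u i j) n) m.
Proof.
induction n; simpl.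
- induction m; simpl; [|rewrite <- IHm]; ring.
- rewrite IHn. rewrite <- Csum_plus. reflexivity.
Qed.

Lemma Csum_RtoC u n : Csum (fun i => RtoC (u i)) n = RtoC (Rsum u n).
Proof. induction n; simpl; [|rewrite IHn, RtoC_plus]; reflexivity. Qed.

Lemma Csum_Cmod u n : Cmod (Csum u n) <= Rsum (fun i => Cmod (u i)) n.
Proof.
induction n; simpl; [rewrite Cmod_0; lra|].
eapply Rle_trans; [apply Cmod_triangle|]. lra.
Qed.

Lemma Cmod_dist x y z : Cmod (x - z)%C <= Cmod (x - y)%C + Cmod (y - z)%C.
Proof.
replace (x - z)%C with ((x - y) + (y - z))%C by ring. apply Cmod_triangle.
Qed.

Lemma Cmod_minus_sym x y : Cmod (x - y)%C = Cmod (y - x)%C.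
Proof. rewrite <- Cmod_opp. f_equal. ring. Qed.

Lemma Cmod_small_eq x y : (forall eps, 0 < eps -> Cmod (x - y)%C <= eps) -> x = y.
Proof.
intros H. apply Ceq_minus, Cmod_eq_0.
destruct (Rle_lt_or_eq_dec 0 _ (Cmod_ge_0 (x - y)%C)) as [h|h]; [|auto].
specialize (H (Cmod (x - y) / 2)). lra.
Qed.

Lemma Csum_fst u n : fst (Csum u n) = Rsum (fun i => fst (u i)) n.
Proof. induction n; simpl; [reflexivity|]. rewrite IHn; reflexivity. Qed.

Lemma Csum_snd u n : snd (Csum u n) = Rsum (fun i => snd (u i)) n.
Proof. induction n; simpl; [reflexivity|]. rewrite IHn; reflexivity. Qed.

Lemma Cser_unique u l l' : Cser u l -> Cser u l' -> l = l'.
Proof.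
intros H H'. apply Cmod_small_eq. intros e He.
destruct (H (e/2)) as [N HN]; [lra|]. destruct (H' (e/2)) as [N' HN']; [lra|].
specialize (HN (N + N')%nat). specialize (HN' (N + N')%nat).
assert (A := Cmod_dist l (Csum u (N+N')) l'). rewrite (Cmod_minus_sym l (Csum _ _)) in A.
specialize (HN ltac:(lia)). specialize (HN' ltac:(lia)). lra.
Qed.

Lemma Cser_ext u v l : (forall n, u n = v n) -> Cser u l -> Cser v l.
Proof.
intros E H e He. destruct (H e He) as [N HN]. exists N; intros n Hn.
rewrite <- (Csum_ext u); auto.
Qed.

Lemma Cser_plus u v l m : Cser u l -> Cser v m -> Cser (fun n => u n + v n)%C (l + m)%C.
Proof.
intros H H' e He.
destruct (H (e/2)) as [N HN]; [lra|]. destruct (H' (e/2)) as [N' HN']; [lra|].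
exists (N + N')%nat; intros n Hn. rewrite Csum_plus.
replace (Csum u n + Csum v n - (l + m))%C with ((Csum u n - l) + (Csum v n - m))%C by ring.
eapply Rle_lt_trans; [apply Cmod_triangle|].
specialize (HN n ltac:(lia)). specialize (HN' n ltac:(lia)). lra.
Qed.

Lemma Cser_scal c u l : Cser u l -> Cser (fun n => c * u n)%C (c * l)%C.
Proof.
intros H e He.
destruct (H (e / (Cmod c + 1))) as [N HN].
{ assert (A := Cmod_ge_0 c). apply Rdiv_lt_0_compat; lra. }
exists N; intros n Hn. rewrite Csum_scal.
replace (c * Csum u n - c * l)%C with (c * (Csum u n - l))%C by ring.
rewrite Cmod_mult. specialize (HN n Hn). assert (A := Cmod_ge_0 c).
apply Rle_lt_trans with ((Cmod c) * (e / (Cmod c + 1))).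
- apply Rmult_le_compat_l; lra.
- apply Rmult_lt_reg_r with (Cmod c + 1); [lra|]. field_simplify; [nra|lra].
Qed.

Lemma Cser_finite u N : (forall n, (N <= n)%nat -> u n = RtoC 0) -> Cser u (Csum u N).
Proof.
intros H e He. exists N. intros n Hn.
replace (Csum u n) with (Csum u N).
- replace (Csum u N - Csum u N)%C with (RtoC 0) by ring. rewrite Cmod_0; auto.
- induction Hn; [reflexivity|]. simpl. rewrite <- IHHn, H by lia. ring.
Qed.

Lemma Cser_bound u l B N : Cser u l -> (forall n, (N <= n)%nat -> Cmod (Csum u n) <= B) -> Cmod l <= B.
Proof.
intros H HB. apply Rnot_lt_le. intros Hlt.
destruct (H (Cmod l - B)) as [N' HN']; [lra|].
specialize (HN' (N + N')%nat ltac:(lia)). specialize (HB (N + N')%nat ltac:(lia)).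
assert (A := Cmod_triangle (l - Csum u (N + N')) (Csum u (N + N'))).
replace (l - Csum u (N + N') + Csum u (N + N'))%C with l in A by ring.
rewrite Cmod_minus_sym in A. lra.
Qed.

Lemma Cser_abs_bound u l B : Cser u l -> (forall n, Rsum (fun i => Cmod (u i)) n <= B) -> Cmod l <= B.
Proof.
intros H HB. apply (Cser_bound u l B 0 H). intros n _.
eapply Rle_trans; [apply Csum_Cmod|auto].
Qed.

Lemma Rsum_tail u T : (forall i, 0 <= u i) -> (forall n, Rsum u n <= T) ->
  forall eps, 0 < eps -> exists N, forall n, (N <= n)%nat -> Rsum u n - Rsum u N < eps.
Proof.
intros Hu HT e He.
destruct (completeness (fun x => exists n, x = Rsum u n)) as [l [Hl1 Hl2]].
{ exists T. intros x [n ->]; auto. }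
{ exists 0, 0%nat; reflexivity. }
destruct (classic (exists N, l - e < Rsum u N)) as [[N HN]|Hno].
- exists N. intros n Hn. assert (Rsum u n <= l) by (apply Hl1; eauto). lra.
- assert (l <= l - e); [|lra]. apply Hl2. intros x [n ->].
  apply Rnot_lt_le; intros h; apply Hno; eauto.
Qed.

Lemma Cser_abs_ex u T : (forall n, Rsum (fun i => Cmod (u i)) n <= T) -> exists l, Cser u l.
Proof.
intros HT.
assert (Hc : forall (p : C -> R), (forall x, Rabs (p x) <= Cmod x) ->
  exists l, Un_cv (fun n => Rsum (fun i => p (u i)) n) l).
{ intros p Hp. destruct (Rcomplete.R_complete (fun n => Rsum (fun i => p (u i)) n)) as [l Hl]; [|eauto].
  intros e He.
  destruct (Rsum_tail (fun i => Cmod (u i)) T (fun i => Cmod_ge_0 _) HT (e/2)) as [N HN]; [lra|].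
  assert (HH : forall n, (N <= n)%nat ->
     Rabs (Rsum (fun i => p (u i)) n - Rsum (fun i => p (u i)) N) < e/2).
  { intros n Hn. apply Rle_lt_trans with (2:=HN n Hn). clear -Hp Hn.
    induction Hn; simpl.
    - rewrite Rminus_diag, Rabs_R0; lra.
    - match goal with |- Rabs (?a + ?b - ?c) <= _ =>
        replace (a + b - c) with ((a - c) + b) by ring end.
      eapply Rle_trans; [apply Rabs_triang|]. specialize (Hp (u m)). lra. }
  exists N. intros n m Hn Hm. unfold Rdist.
  assert (A := HH n Hn). assert (A' := HH m Hm).
  unfold Rabs in *. repeat destruct Rcase_abs; lra. }
destruct (Hc fst) as [l1 H1].
{ intros x. eapply Rle_trans; [|apply Rmax_Cmod]. apply Rmax_l. }
destruct (Hc snd) as [l2 H2].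
{ intros x. eapply Rle_trans; [|apply Rmax_Cmod]. apply Rmax_r. }
exists (l1, l2). intros e He.
destruct (H1 (e/2)) as [N1 HN1]; [lra|]. destruct (H2 (e/2)) as [N2 HN2]; [lra|].
exists (N1 + N2)%nat. intros n Hn.
assert (A := Cmod_2Rmax (Csum u n - (l1, l2))%C).
specialize (HN1 n ltac:(lia)). specialize (HN2 n ltac:(lia)). unfold Rdist in *.
simpl fst in A. simpl snd in A. rewrite Csum_fst, Csum_snd in A.
assert (Hs : sqrt 2 < 2). { apply Rsqr_incrst_0; try lra. rewrite Rsqr_sqrt by lra. unfold Rsqr; lra. apply sqrt_pos. }
unfold Rminus in *.
assert (Rmax (Rabs (Rsum (fun i => fst (u i)) n + - l1)) (Rabs (Rsum (fun i => snd (u i)) n + - l2)) < e/2)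
  by (apply Rmax_lub_lt; auto).
assert (0 <= Rmax (Rabs (Rsum (fun i => fst (u i)) n + - l1)) (Rabs (Rsum (fun i => snd (u i)) n + - l2))).
{ eapply Rle_trans; [apply Rabs_pos|apply Rmax_l]. }
assert (0 <= sqrt 2) by apply sqrt_pos. nra.
Qed.

(** The rows beyond [I] contribute at most [2 * sum_(i >= I) B i], uniformly in the
    number of columns kept, while the first [I] rows converge one by one. *)
Lemma Cser_fubini (u : nat -> nat -> C) (B : nat -> R) T r c s :
  (forall i n, Rsum (fun j => Cmod (u i j)) n <= B i) ->
  (forall n, Rsum B n <= T) ->
  (forall i, Cser (u i) (r i)) ->
  (forall j, Cser (fun i => u i j) (c j)) ->
  Cser r s -> Cser c s.
Proof.
intros HB HT Hr Hc Hs e He.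
assert (HB0 : forall i, 0 <= B i) by (intros i; apply (HB i 0%nat)).
destruct (Rsum_tail B T HB0 HT (e/6)) as [I HI]; [lra|].
assert (HJ : forall I, exists J0, forall J, (J0 <= J)%nat ->
   Cmod (Csum (fun i => Csum (u i) J - r i)%C I) < e/6).
{ clear I HI. intros I. revert e He. induction I; intros e He; simpl.
  - exists 0%nat; intros. rewrite Cmod_0; lra.
  - destruct (IHI (e/2)) as [J1 H1]; [lra|]. destruct (Hr I (e/12)) as [J2 H2]; [lra|].
    exists (J1 + J2)%nat. intros J HJ. eapply Rle_lt_trans; [apply Cmod_triangle|].
    specialize (H1 J ltac:(lia)). specialize (H2 J ltac:(lia)). lra. }
destruct (HJ I) as [J0 HJ0]. exists J0. intros J HJJ. specialize (HJ0 J HJJ).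
assert (Hcol : Cser (fun i => Csum (u i) J) (Csum c J)).
{ clear -Hc. induction J; simpl.
  - apply (Cser_finite (fun _ => RtoC 0) 0); auto.
  - apply Cser_plus; auto. }
assert (Hd : Cser (fun i => Csum (u i) J - r i)%C (Csum c J - s)%C).
{ replace (Csum c J - s)%C with (Csum c J + (-(1)) * s)%C by ring.
  eapply Cser_ext; [|apply Cser_plus; [apply Hcol|apply Cser_scal, Hs]].
  intros n; simpl. ring. }
apply Rle_lt_trans with (e/2); [|lra].
apply (Cser_bound _ _ _ I Hd). intros n Hn.
assert (Hrow : forall i, Cmod (Csum (u i) J - r i)%C <= 2 * B i).
{ intros i. eapply Rle_trans; [apply Cmod_triangle|]. rewrite Cmod_opp.
  assert (Cmod (r i) <= B i) by (apply (Cser_abs_bound (u i)); auto).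
  assert (Cmod (Csum (u i) J) <= B i) by (eapply Rle_trans; [apply Csum_Cmod|auto]). lra. }
assert (Cmod (Csum (fun i => Csum (u i) J - r i)%C n) <= e/6 + 2 * (Rsum B n - Rsum B I)).
{ clear -Hn Hrow HJ0. induction Hn; [lra|]. simpl.
  eapply Rle_trans; [apply Cmod_triangle|]. specialize (Hrow m). lra. }
specialize (HI n Hn). lra.
Qed.

Lemma sum_n_Csum (u : nat -> C) n : @sum_n C_NormedModule u n = Csum u (S n).
Proof.
induction n; [rewrite sum_O; simpl; symmetry; apply Cplus_0_l|].
rewrite sum_Sn, IHn. reflexivity.
Qed.

Lemma pow_n_C (z : C) n : @pow_n C_Ring z n = Cpow z n.
Proof. induction n; simpl; [reflexivity|rewrite IHn; reflexivity]. Qed.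

Lemma pseries_Cser c z w :
  is_complex_pseries c z w <-> Cser (fun k => c k * z ^ k)%C w.
Proof.
unfold is_complex_pseries, is_pseries, is_series.
assert (E : forall n, @sum_n C_NormedModule (fun k => scal (@pow_n C_Ring z k) (c k)) n
   = Csum (fun k => c k * z ^ k)%C (S n)).
{ intros n. rewrite sum_n_Csum. apply Csum_ext. intros i _. rewrite pow_n_C. apply Cmult_comm. }
split; intros H.
- intros e He.
  apply filterlim_locally_ball_norm with (eps := mkposreal e He) in H.
  destruct H as [N HN]. exists (S N). intros [|n] Hn; [lia|].
  specialize (HN n ltac:(lia)). unfold ball_norm in HN.
  rewrite <- E. exact HN.
- apply filterlim_locally_ball_norm. intros [e He].
  destruct (H e He) as [N HN]. exists N. intros n Hn. unfold ball_norm.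
  change (Cmod (@sum_n C_NormedModule (fun k => scal (@pow_n C_Ring z k) (c k)) n - w)%C < e).
  rewrite E. apply HN. lia.
Qed.

(** * Power series with a summable majorant *)

(** A power series at 0 together with a bound on the sum of the moduli of its terms on
    the circle of radius [delta].  Carrying the bound makes sums of infinitely many such
    series, and changes of centre, consequences of absolute convergence alone. *)
Definition expands (f : C -> C) (c : nat -> C) (delta B : R) : Prop :=
  (forall n, Rsum (fun k => Cmod (c k) * delta ^ k) n <= B) /\
  (forall w, Cmod w <= delta -> Cser (fun k => c k * w ^ k)%C (f w)).

Lemma Rsum_swap (u : nat -> nat -> R) n m :
  Rsum (fun i => Rsum (u i) m) n = Rsum (fun j => Rsum (fun i => u i j) n) m.
Proof.
induction n; simpl.
- induction m; simpl; [|rewrite <- IHm]; ring.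
- rewrite IHn. rewrite <- Rsum_plus. reflexivity.
Qed.

Lemma Rsum_geom q n : 0 <= q < 1 -> Rsum (fun k => q ^ k) n <= / (1 - q).
Proof.
intros Hq.
assert (E : Rsum (fun k => q ^ k) n * (1 - q) = 1 - q ^ n).
{ induction n; simpl; [lra|]. rewrite Rmult_plus_distr_r, IHn. ring. }
assert (0 <= q ^ n) by (apply pow_le; lra).
apply Rmult_le_reg_r with (1 - q); [lra|]. rewrite E. field_simplify; lra.
Qed.

Lemma expands_terms f c delta B w n : expands f c delta B -> Cmod w <= delta ->
  Rsum (fun k => Cmod (c k * w ^ k)%C) n <= B.
Proof.
intros [HB _] Hw. eapply Rle_trans; [|apply (HB n)]. apply Rsum_le. intros i _.
rewrite Cmod_mult, Cmod_pow. apply Rmult_le_compat_l; [apply Cmod_ge_0|].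
apply pow_incr. split; [apply Cmod_ge_0|auto].
Qed.

Lemma expands_bound f c delta B w : expands f c delta B -> Cmod w <= delta -> Cmod (f w) <= B.
Proof.
intros H Hw. apply (Cser_abs_bound (fun k => c k * w ^ k)%C).
- apply H; auto.
- intros n. eapply expands_terms; eauto.
Qed.

Lemma expands_coef f c delta B k : 0 <= delta -> expands f c delta B -> Cmod (c k) * delta ^ k <= B.
Proof.
intros Hd [HB _]. eapply Rle_trans; [|apply (HB (S k))].
apply (Rsum_term_le (fun k => Cmod (c k) * delta ^ k)); [|lia].
intros j; apply Rmult_le_pos; [apply Cmod_ge_0|apply pow_le; auto].
Qed.

Lemma expands_ext f g c d delta B : (forall w, Cmod w <= delta -> f w = g w) ->
  (forall k, c k = d k) -> expands f c delta B -> expands g d delta B.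
Proof.
intros Hf Hc [H1 H2]. split.
- intros n. erewrite Rsum_ext; [apply (H1 n)|]. intros i _; simpl. rewrite Hc; auto.
- intros w Hw. rewrite <- Hf by auto. eapply Cser_ext; [|apply H2; auto].
  intros n; simpl. rewrite Hc; auto.
Qed.

Lemma expands_le f c delta delta' B B' : 0 <= delta' <= delta -> B <= B' ->
  expands f c delta B -> expands f c delta' B'.
Proof.
intros Hd HB [H1 H2]. split.
- intros n. apply Rle_trans with (2 := HB), Rle_trans with (2 := H1 n).
  apply Rsum_le. intros i _. apply Rmult_le_compat_l; [apply Cmod_ge_0|].
  apply pow_incr; lra.
- intros w Hw. apply H2; lra.
Qed.

Lemma expands_const a delta : expands (fun _ => a) (fun k => match k with O => a | _ => RtoC 0 end) delta (Cmod a).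
Proof.
split.
- intros n. destruct n; [simpl; apply Cmod_ge_0|]. rewrite Rsum_head. simpl.
  rewrite (Rsum_ext _ (fun _ => 0)).
  + rewrite Rsum_const. lra.
  + intros; rewrite Cmod_0; ring.
- intros w _.
  assert (A := Cser_finite (fun k => match k with O => a | _ => RtoC 0 end * w ^ k)%C 1).
  simpl in A. replace (0 + a * 1)%C with a in A by ring. apply A.
  intros [|n] Hn; [lia|]. ring.
Qed.

Lemma expands_scal f c delta B a : expands f c delta B ->
  expands (fun w => a * f w)%C (fun k => a * c k)%C delta (Cmod a * B).
Proof.
intros [H1 H2]. split.
- intros n. rewrite (Rsum_ext _ (fun k => Cmod a * (Cmod (c k) * delta ^ k))).
  + rewrite Rsum_scal. apply Rmult_le_compat_l; [apply Cmod_ge_0|auto].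
  + intros i _. rewrite Cmod_mult. ring.
- intros w Hw. eapply Cser_ext; [|apply Cser_scal, H2; auto]. intros; simpl; ring.
Qed.

Lemma expands_plus f c g d delta B B' : expands f c delta B -> expands g d delta B' -> 0 <= delta ->
  expands (fun w => f w + g w)%C (fun k => c k + d k)%C delta (B + B').
Proof.
intros [H1 H2] [H1' H2'] Hd. split.
- intros n. specialize (H1 n). specialize (H1' n).
  assert (A : Rsum (fun k => Cmod (c k + d k)%C * delta ^ k) n <=
     Rsum (fun k => Cmod (c k) * delta ^ k + Cmod (d k) * delta ^ k) n).
  { apply Rsum_le. intros i _. rewrite <- Rmult_plus_distr_r.
    apply Rmult_le_compat_r; [apply pow_le; auto|apply Cmod_triangle]. }
  rewrite Rsum_plus in A. lra.
- intros w Hw. eapply Cser_ext; [|apply Cser_plus; [apply H2|apply H2']; auto]. intros; simpl; ring.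
Qed.

Lemma Cser_shift u l : Cser u l -> Cser (fun n => match n with O => RtoC 0 | S n => u n end) l.
Proof.
intros H e He. destruct (H e He) as [N HN]. exists (S N). intros [|n] Hn; [lia|].
rewrite Csum_head. rewrite Cplus_0_l. apply HN. lia.
Qed.

Lemma expands_linear f c delta B a b : expands f c delta B -> 0 <= delta ->
  expands (fun w => (a + b * w) * f w)%C
    (fun k => a * c k + b * match k with O => RtoC 0 | S k => c k end)%C delta ((Cmod a + Cmod b * delta) * B).
Proof.
intros H Hd.
assert (Hs : expands (fun w => w * f w)%C (fun k => match k with O => RtoC 0 | S k => c k end) delta (delta * B)).
{ destruct H as [H1 H2]. split.
  - intros [|n].
    { simpl. specialize (H1 0%nat). simpl in H1. nra. }
    rewrite Rsum_head, Cmod_0, Rmult_0_l, Rplus_0_l.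
    rewrite (Rsum_ext _ (fun k => delta * (Cmod (c k) * delta ^ k))).
    + rewrite Rsum_scal. apply Rmult_le_compat_l; auto.
    + intros i _. simpl. ring.
  - intros w Hw.
    assert (A := Cser_shift _ _ (Cser_scal w _ _ (H2 w Hw))).
    eapply Cser_ext; [|apply A]. intros [|n]; simpl; ring. }
assert (A := expands_plus _ _ _ _ _ _ _ (expands_scal _ _ _ _ a H) (expands_scal _ _ _ _ b Hs) Hd).
apply (expands_le _ _ _ delta _ ((Cmod a + Cmod b * delta) * B)) in A; [|lra|lra].
eapply expands_ext; [| |apply A]; intros; simpl; ring.
Qed.

(** The Weierstrass double series theorem. *)
Lemma expands_sum (f : nat -> C -> C) (c : nat -> nat -> C) (delta : R) (B : nat -> R) (T : R) g d :
  0 < delta ->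
  (forall i, expands (f i) (c i) delta (B i)) -> (forall n, Rsum B n <= T) ->
  (forall w, Cmod w <= delta -> Cser (fun i => f i w) (g w)) ->
  (forall k, Cser (fun i => c i k) (d k)) -> expands g d delta T.
Proof.
intros Hd Hf HT Hg Hc. split.
- intros n.
  assert (Hlim : forall eta, 0 < eta -> exists I0, forall I, (I0 <= I)%nat ->
     Rsum (fun k => Cmod (d k) * delta ^ k) n <=
     Rsum (fun k => Cmod (Csum (fun i => c i k) I) * delta ^ k) n + eta).
  { induction n; intros eta He; simpl.
    - exists 0%nat; intros; lra.
    - destruct (IHn (eta/2)) as [I1 H1]; [lra|].
      assert (Hp : 0 < delta ^ n) by (apply pow_lt; auto).
      destruct (Hc n (eta / 2 / delta ^ n)) as [I2 H2].
      { apply Rdiv_lt_0_compat; lra. }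
      exists (I1 + I2)%nat. intros I HI. specialize (H1 I ltac:(lia)). specialize (H2 I ltac:(lia)).
      assert (A := Cmod_triangle (d n - Csum (fun i => c i n) I) (Csum (fun i => c i n) I)).
      replace (d n - Csum (fun i => c i n) I + Csum (fun i => c i n) I)%C with (d n) in A by ring.
      rewrite Cmod_minus_sym in A.
      assert (Cmod (d n) * delta ^ n <= (Cmod (Csum (fun i => c i n) I) + eta / 2 / delta ^ n) * delta ^ n)
        by (apply Rmult_le_compat_r; lra).
      rewrite Rmult_plus_distr_r in H.
      replace (eta / 2 / delta ^ n * delta ^ n) with (eta / 2) in H by (field; lra).
      lra. }
  apply Rnot_lt_le. intros Hlt.
  destruct (Hlim ((Rsum (fun k => Cmod (d k) * delta ^ k) n - T) / 2)) as [I HI]; [lra|].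
  specialize (HI I (le_n _)).
  assert (Rsum (fun k => Cmod (Csum (fun i => c i k) I) * delta ^ k) n <= Rsum B I).
  { apply Rle_trans with (Rsum (fun i => Rsum (fun k => Cmod (c i k) * delta ^ k) n) I).
    - rewrite Rsum_swap. apply Rsum_le. intros k _.
      rewrite (Rsum_ext _ (fun i => delta ^ k * Cmod (c i k))) by (intros; ring).
      rewrite Rsum_scal, Rmult_comm. apply Rmult_le_compat_l; [apply pow_le; lra|apply Csum_Cmod].
    - apply Rsum_le. intros i _. apply Hf. }
  specialize (HT I). lra.
- intros w Hw.
  apply (Cser_fubini (fun i k => c i k * w ^ k)%C B T (fun i => f i w) _ (g w)); auto.
  + intros i n. eapply expands_terms; eauto.
  + intros i. apply Hf; auto.
  + intros k. rewrite Cmult_comm.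
    eapply Cser_ext; [|apply (Cser_scal (w ^ k)%C), Hc]. intros; simpl; ring.
Qed.

Lemma expands_sum_ex (f : nat -> C -> C) (c : nat -> nat -> C) (delta : R) (B : nat -> R) (T : R) :
  0 < delta ->
  (forall i, expands (f i) (c i) delta (B i)) -> (forall n, Rsum B n <= T) ->
  (forall w, Cmod w <= delta -> exists l, Cser (fun i => f i w) l) /\
  (forall k, exists l, Cser (fun i => c i k) l).
Proof.
intros Hd Hf HT. split.
- intros w Hw. apply (Cser_abs_ex _ T). intros n. apply Rle_trans with (2 := HT n).
  apply Rsum_le. intros i _. eapply expands_bound; eauto.
- intros k. apply (Cser_abs_ex _ (T / delta ^ k)). intros n.
  assert (Hp : 0 < delta ^ k) by (apply pow_lt; auto).
  apply Rle_trans with (Rsum B n / delta ^ k).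
  + unfold Rdiv. rewrite Rmult_comm, <- Rsum_scal. apply Rsum_le. intros i _.
    rewrite Rmult_comm. apply Rmult_le_reg_r with (delta ^ k); auto.
    rewrite Rmult_assoc, Rinv_l, Rmult_1_r by lra. eapply expands_coef; eauto; lra.
  + apply Rmult_le_compat_r; [|auto]. left; apply Rinv_0_lt_compat; auto.
Qed.

(** Real-valued Pascal triangle; unlike a quotient of factorials it vanishes for
    [k > m] by its very definition, so that sums over [m] need no restriction. *)
Fixpoint bin (m k : nat) : R :=
  match m, k with
  | _, O => 1
  | O, S _ => 0
  | S m, S k => bin m k + bin m (S k)
  end.

Lemma bin_pos m k : 0 <= bin m k.
Proof. revert k; induction m; intros [|k]; simpl; try lra. specialize (IHm k) as A; specialize (IHm (S k)); lra. Qed.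

Lemma bin_gt m k : (m < k)%nat -> bin m k = 0.
Proof.
revert k; induction m; intros [|k] H; simpl; try lia; try lra.
rewrite !IHm by lia. lra.
Qed.

Lemma bin_0 m : bin m 0 = 1.
Proof. destruct m; reflexivity. Qed.

Lemma expands_pow d delta m : 0 <= delta ->
  expands (fun w => (d + w) ^ m)%C (fun k => bin m k * d ^ (m - k))%C delta ((Cmod d + delta) ^ m).
Proof.
intros Hd. induction m.
- simpl. assert (A := expands_const 1 delta). rewrite Cmod_1 in A.
  eapply expands_ext; [| |apply A]; intros; simpl; auto. destruct k; simpl; ring.
- assert (A := expands_linear _ _ _ _ d 1 IHm Hd). rewrite Cmod_1, Rmult_1_l in A.
  simpl pow. eapply expands_ext; [| |apply A]; intros; simpl; [ring|].
  destruct k as [|k].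
  + rewrite bin_0, Nat.sub_0_r. simpl. ring.
  + rewrite RtoC_plus. rewrite Cmult_plus_distr_r, Cmult_1_l.
    rewrite Cplus_comm. f_equal.
    destruct (le_lt_dec (S k) m) as [h|h].
    * replace (m - k)%nat with (S (m - S k)) by lia. simpl. ring.
    * rewrite (bin_gt m (S k)) by lia. ring.
Qed.

(** The majorant is inherited because [|d| + delta <= rho] and the binomial expansion of
    [(|d| + delta)^m] has nonnegative terms. *)
Lemma expands_recentre f c rho B d delta : expands f c rho B -> 0 < delta -> Cmod d + delta <= rho ->
  exists c', (forall k, Cser (fun m => c m * (bin m k * d ^ (m - k)))%C (c' k)) /\
    expands (fun v => f (d + v))%C c' delta B.
Proof.
intros [HB Hf] Hd Hr.
assert (Hd0 := Cmod_ge_0 d).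
set (F := fun (i : nat) (w : C) => (c i * (d + w) ^ i)%C).
set (K := fun (i k : nat) => (c i * (bin i k * d ^ (i - k)))%C).
assert (HF : forall i, expands (F i) (K i) delta (Cmod (c i) * (Cmod d + delta) ^ i)).
{ intros i. apply expands_scal, expands_pow. lra. }
assert (HT : forall n, Rsum (fun i => Cmod (c i) * (Cmod d + delta) ^ i) n <= B).
{ intros n. eapply Rle_trans; [|apply (HB n)]. apply Rsum_le. intros i _.
  apply Rmult_le_compat_l; [apply Cmod_ge_0|]. apply pow_incr; lra. }
destruct (expands_sum_ex F K delta _ B Hd HF HT) as [_ Hc].
exists (fun k => proj1_sig (constructive_indefinite_description _ (Hc k))).
assert (Hc' : forall k, Cser (fun i => K i k) (proj1_sig (constructive_indefinite_description _ (Hc k)))).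
{ intros k. apply proj2_sig. }
split; [exact Hc'|].
apply (expands_sum F K delta (fun i => Cmod (c i) * (Cmod d + delta) ^ i) B); auto.
intros w Hw. apply Hf. eapply Rle_trans; [apply Cmod_triangle|lra].
Qed.

(** The first nonzero coefficient would dominate at [w = s * delta] as [s] tends to 0. *)
Lemma expands_zero_coef c delta B : 0 < delta -> expands (fun _ => RtoC 0) c delta B -> forall k, c k = RtoC 0.
Proof.
intros Hd [HB H] k. induction k as [k IH] using lt_wf_ind.
assert (HB0 : 0 <= B) by (apply (HB 0%nat)).
assert (Key : forall s, 0 < s < 1 -> Cmod (c k) * delta ^ k <= s * B).
{ intros s Hs.
  assert (Hw : Cmod (RtoC (s * delta)) <= delta).
  { rewrite Cmod_R, Rabs_pos_eq by nra. nra. }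
  specialize (H _ Hw).
  assert (Hpart : forall n, (k < n)%nat ->
    Cmod (c k) * (s * delta) ^ k <= Cmod (Csum (fun j => c j * RtoC (s * delta) ^ j)%C n)
       + s ^ (S k) * Rsum (fun j => Cmod (c j) * delta ^ j) n).
  { intros n Hn.
    assert (E : Cmod (Csum (fun j => c j * RtoC (s * delta) ^ j)%C n - c k * RtoC (s * delta) ^ k)%C
       <= s ^ (S k) * Rsum (fun j => Cmod (c j) * delta ^ j) n).
    { induction Hn.
      - simpl Csum. rewrite Csum_zero.
        + replace (0 + c k * (s * delta)%R ^ k - c k * (s * delta)%R ^ k)%C with (RtoC 0) by ring.
          rewrite Cmod_0. apply Rmult_le_pos; [apply pow_le; lra|].
          apply Rsum_pos. intros; apply Rmult_le_pos; [apply Cmod_ge_0|apply pow_le; lra].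
        + intros i Hi. rewrite IH by auto. ring.
      - simpl Csum.
        replace (Csum (fun j => c j * (s * delta)%R ^ j) m + c m * (s * delta)%R ^ m - c k * (s * delta)%R ^ k)%C
          with ((Csum (fun j => c j * (s * delta)%R ^ j) m - c k * (s * delta)%R ^ k) + c m * (s * delta)%R ^ m)%C by ring.
        eapply Rle_trans; [apply Cmod_triangle|].
        change (Rsum (fun j => Cmod (c j) * delta ^ j) (S m)) with
          (Rsum (fun j => Cmod (c j) * delta ^ j) m + Cmod (c m) * delta ^ m).
        rewrite Rmult_plus_distr_l. apply Rplus_le_compat; [apply IHHn|].
        rewrite Cmod_mult, Cmod_pow, Cmod_R, Rabs_pos_eq by nra.
        rewrite Rpow_mult_distr.
        replace (s ^ S k * (Cmod (c m) * delta ^ m)) with (Cmod (c m) * (s ^ S k * delta ^ m)) by ring.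
        apply Rmult_le_compat_l; [apply Cmod_ge_0|].
        apply Rmult_le_compat_r; [apply pow_le; lra|].
        replace m with (S k + (m - S k))%nat by lia. rewrite pow_add.
        assert (0 <= s ^ S k) by (apply pow_le; lra).
        assert (s ^ (m - S k) <= 1) by (apply pow_le_1_compat || (rewrite <- (pow1 (m - S k)); apply pow_incr; lra)).
        nra. }
    assert (A := Cmod_triangle (c k * RtoC (s * delta) ^ k - Csum (fun j => c j * RtoC (s * delta) ^ j)%C n)
       (Csum (fun j => c j * RtoC (s * delta) ^ j)%C n)).
    rewrite Cmod_minus_sym in A.
    match type of A with Cmod ?x <= _ => replace x with (c k * RtoC (s * delta) ^ k)%C in A by ring end.
    rewrite Cmod_mult, Cmod_pow, Cmod_R, Rabs_pos_eq in A by nra. lra. }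
  assert (Hk : Cmod (c k) * (s * delta) ^ k <= s ^ S k * B).
  { apply Rnot_lt_le. intros Hlt.
    destruct (H (Cmod (c k) * (s * delta) ^ k - s ^ S k * B)) as [N HN]; [lra|].
    specialize (HN (N + S k)%nat ltac:(lia)). specialize (Hpart (N + S k)%nat ltac:(lia)).
    specialize (HB (N + S k)%nat).
    assert (0 <= s ^ S k) by (apply pow_le; lra).
    assert (s ^ S k * Rsum (fun j => Cmod (c j) * delta ^ j) (N + S k) <= s ^ S k * B)
      by (apply Rmult_le_compat_l; auto).
    match type of HN with Cmod (?x - _)%C < _ => replace (x - 0)%C with x in HN by ring end. lra. }
  rewrite Rpow_mult_distr in Hk. simpl in Hk.
  assert (0 < s ^ k) by (apply pow_lt; lra).
  apply Rmult_le_reg_l with (s ^ k); auto. nra. }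
assert (Hp : 0 < delta ^ k) by (apply pow_lt; auto).
apply Cmod_eq_0. apply Rle_antisym; [|apply Cmod_ge_0].
apply Rnot_lt_le. intros Hlt.
assert (Hx : 0 < Cmod (c k) * delta ^ k) by (apply Rmult_lt_0_compat; auto).
set (x := Cmod (c k) * delta ^ k) in *.
specialize (Key (Rmin (1/2) (x / (2 * (B + 1))))).
assert (0 < x / (2 * (B + 1))) by (apply Rdiv_lt_0_compat; lra).
assert (0 < Rmin (1 / 2) (x / (2 * (B + 1))) < 1).
{ split; [apply Rmin_glb_lt; lra|]. eapply Rle_lt_trans; [apply Rmin_l|]; lra. }
specialize (Key H1).
assert (A : Rmin (1 / 2) (x / (2 * (B + 1))) * B <= x / (2 * (B + 1)) * B)
  by (apply Rmult_le_compat_r; [auto|apply Rmin_r]).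
assert (x / (2 * (B + 1)) * B <= x / 2).
{ apply Rmult_le_reg_r with (2 * (B + 1)); [lra|]. field_simplify; nra. }
lra.
Qed.

Lemma expands_unique f g c d delta B B' : 0 < delta -> (forall w, Cmod w <= delta -> f w = g w) ->
  expands f c delta B -> expands g d delta B' -> forall k, c k = d k.
Proof.
intros Hd Hfg Hf Hg k.
assert (A := expands_plus _ _ _ _ _ _ _ Hf (expands_scal _ _ _ _ (-(1))%C Hg) (Rlt_le _ _ Hd)).
apply (expands_ext _ (fun _ => RtoC 0) _ (fun k => c k - d k)%C) in A.
- apply Ceq_minus. exact (expands_zero_coef _ _ _ Hd A k).
- intros w Hw. rewrite Hfg by auto. ring.
- intros j. ring.
Qed.

(** Convergence at a point of modulus [s] between [rho] and [r] bounds
    [c_k s^k], and the geometric factor [(rho / s)^k] makes the terms summable. *)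
Lemma expands_of_Cser f c r rho : 0 < rho < r ->
  (forall w, Cmod w < r -> Cser (fun k => c k * w ^ k)%C (f w)) ->
  exists B, expands f c rho B.
Proof.
intros Hr H.
set (s := (rho + r) / 2).
assert (Hs : rho < s < r) by (unfold s; lra).
assert (Hw : Cmod (RtoC s) < r) by (rewrite Cmod_R, Rabs_pos_eq; lra).
assert (HK : exists K, forall k, Cmod (c k) * s ^ k <= K).
{ destruct (H _ Hw 1) as [N HN]; [lra|].
  assert (HN' : forall k, (N <= k)%nat -> Cmod (c k) * s ^ k <= 2).
  { intros k Hk. assert (A := HN k Hk). assert (A' := HN (S k) ltac:(lia)). simpl Csum in A'.
    replace (Cmod (c k) * s ^ k) with (Cmod (c k * RtoC s ^ k)%C)
      by (rewrite Cmod_mult, Cmod_pow, Cmod_R, Rabs_pos_eq; lra).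
    set (S0 := Csum (fun k0 => c k0 * RtoC s ^ k0)%C k) in *.
    replace (c k * RtoC s ^ k)%C with ((S0 + c k * RtoC s ^ k - f (RtoC s)) + (f (RtoC s) - S0))%C by ring.
    eapply Rle_trans; [apply Cmod_triangle|]. rewrite (Cmod_minus_sym (f (RtoC s)) S0). lra. }
  exists (2 + Rsum (fun k => Cmod (c k) * s ^ k) N).
  assert (Hpos : forall j, 0 <= Cmod (c j) * s ^ j)
    by (intros; apply Rmult_le_pos; [apply Cmod_ge_0|apply pow_le; lra]).
  intros k. destruct (le_lt_dec N k) as [h|h].
  - specialize (HN' k h). assert (0 <= Rsum (fun k => Cmod (c k) * s ^ k) N) by (apply Rsum_pos; auto). lra.
  - assert (A := Rsum_term_le _ N k Hpos h). simpl in A. lra. }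
destruct HK as [K HK].
assert (Hq : 0 <= rho / s < 1).
{ split; [apply Rle_div_r; lra|]. apply Rlt_div_l; lra. }
exists (K * / (1 - rho / s)). split.
- intros n. apply Rle_trans with (Rsum (fun k => K * (rho / s) ^ k) n).
  + apply Rsum_le. intros k _.
    replace (rho ^ k) with (s ^ k * (rho / s) ^ k).
    2: { rewrite <- Rpow_mult_distr. f_equal. field; lra. }
    rewrite <- Rmult_assoc. apply Rmult_le_compat_r; [apply pow_le; lra|auto].
  + rewrite Rsum_scal. apply Rmult_le_compat_l; [|apply Rsum_geom; auto].
    eapply Rle_trans; [|apply (HK 0%nat)]. apply Rmult_le_pos; [apply Cmod_ge_0|simpl; lra].
- intros w Hw'. apply H. lra.
Qed.

Lemma expands_of_analytic g z0 : analytic_at g z0 ->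
  exists c r, 0 < r /\ forall rho, 0 < rho < r -> exists B, expands (fun w => g (z0 + w))%C c rho B.
Proof.
intros (c & r & Hr & H). exists c, r. split; auto. intros rho Hrho.
apply expands_of_Cser with r; auto. intros w Hw.
specialize (H (z0 + w)%C). replace (z0 + w - z0)%C with w in H by ring.
apply pseries_Cser, H; auto.
Qed.

Lemma analytic_of_expands g z0 d c rho B : expands (fun w => g (z0 + w))%C c rho B ->
  Cmod d < rho -> analytic_at g (z0 + d)%C.
Proof.
intros H Hd.
destruct (expands_recentre _ _ _ _ d ((rho - Cmod d) / 2) H) as (c' & _ & H'); [lra|lra|].
exists c', ((rho - Cmod d) / 2). split; [lra|]. intros z Hz.
apply pseries_Cser. destruct H' as [_ H']. specialize (H' (z - (z0 + d))%C (Rlt_le _ _ Hz)).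
replace (z0 + (d + (z - (z0 + d))))%C with z in H' by ring. exact H'.
Qed.

(** * Exponential polynomials and products of sines *)

Definition cis (t : R) : C := (cos t, sin t).

Lemma cis_plus a b : cis (a + b) = (cis a * cis b)%C.
Proof. unfold cis, Cmult; simpl. rewrite cos_plus, sin_plus. f_equal; ring. Qed.

Lemma cis_0 : cis 0 = RtoC 1.
Proof. unfold cis. rewrite cos_0, sin_0. reflexivity. Qed.

Lemma Cmod_cis a : Cmod (cis a) = 1.
Proof.
unfold cis, Cmod; simpl. rewrite !Rmult_1_r. rewrite Rplus_comm.
assert (A := sin2_cos2 a). unfold Rsqr in A. rewrite A. apply sqrt_1.
Qed.

Lemma cis_pow a n : (cis a ^ n)%C = cis (INR n * a).
Proof.
induction n.
- simpl. rewrite Rmult_0_l, cis_0. reflexivity.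
- rewrite Cpow_S, IHn, <- cis_plus. f_equal. rewrite S_INR. ring.
Qed.

Lemma cis_neg a : (cis a * cis (- a))%C = RtoC 1.
Proof. rewrite <- cis_plus, Rplus_opp_r. apply cis_0. Qed.

Lemma cis_2PI n : cis (2 * PI * INR n) = RtoC 1.
Proof.
replace (2 * PI * INR n) with (0 + 2 * INR n * PI) by ring.
unfold cis. rewrite cos_period, sin_period, cos_0, sin_0. reflexivity.
Qed.

Lemma sin_cis x : RtoC (sin x) = (cis (- x) * ((cis (2 * x) - 1) * (/ 2 * - Ci)))%C.
Proof.
replace (cis (2 * x)) with (cis x * cis x)%C by (rewrite <- cis_plus; f_equal; ring).
replace (cis (- x) * ((cis x * cis x - 1) * (/2 * - Ci)))%C
  with (((cis x * cis (- x)) * cis x - cis (- x)) * (/2 * - Ci))%C by ring.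
rewrite cis_neg.
rewrite <- RtoC_inv by lra.
unfold cis, Ci, Cmult, Cminus, Cplus, Copp, RtoC; simpl. rewrite cos_neg, sin_neg. f_equal; field.
Qed.

Lemma cis_neq_1 N j : (0 < j < N)%nat -> cis (2 * PI * INR j / INR N) <> RtoC 1.
Proof.
intros Hj E. injection E as E _.
assert (HN : 0 < INR N) by (apply lt_0_INR; lia).
assert (Hj0 : 0 < INR j) by (apply lt_0_INR; lia).
assert (HjN : INR j < INR N) by (apply lt_INR; lia).
assert (HP := PI_RGT_0).
replace (2 * PI * INR j / INR N) with (2 * (PI * (INR j / INR N))) in E by (field; lra).
rewrite cos_2a_sin in E.
assert (Hf : 0 < INR j / INR N < 1).
{ split; [apply Rdiv_lt_0_compat; auto|]. apply Rlt_div_l; lra. }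
assert (0 < sin (PI * (INR j / INR N))) by (apply sin_gt_0; nra).
nra.
Qed.

Lemma geom_root_unity x N : x <> RtoC 1 -> (x ^ N)%C = RtoC 1 -> Csum (fun t => x ^ t)%C N = RtoC 0.
Proof.
intros Hx HN.
assert (E : ((x - 1) * Csum (fun t => x ^ t) N)%C = (x ^ N - 1)%C).
{ clear HN. induction N; simpl; [ring|]. rewrite Cmult_plus_distr_l, IHN. ring. }
rewrite HN in E. replace (1 - 1)%C with (RtoC 0) in E by ring.
assert (Hx' : (x - 1)%C <> RtoC 0) by (apply Cminus_eq_contra; auto).
replace (Csum (fun t => x ^ t)%C N) with (/ (x - 1) * ((x - 1) * Csum (fun t => x ^ t) N))%C by (field; auto).
rewrite E. ring.
Qed.

Lemma root_unity_sum N j : (0 < j < N)%nat ->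
  Csum (fun t => cis (2 * PI * INR j * INR t / INR N)) N = RtoC 0.
Proof.
intros Hj. assert (HN : 0 < INR N) by (apply lt_0_INR; lia).
rewrite <- (geom_root_unity (cis (2 * PI * INR j / INR N)) N).
- apply Csum_ext. intros t _. rewrite cis_pow. f_equal. field; lra.
- apply cis_neq_1; auto.
- rewrite cis_pow. replace (INR N * (2 * PI * INR j / INR N)) with (2 * PI * INR j) by (field; lra).
  apply cis_2PI.
Qed.

(** Polynomials of formal degree [n] are described by values, with leading coefficient
    [lc] and a bound [B] on the sum of the moduli of the coefficients. *)
Definition ispoly (P : C -> C) (n : nat) (lc : C) (B : R) : Prop :=
  exists c : nat -> C, (forall z, P z = Csum (fun i => c i * z ^ i)%C (S n)) /\
    c n = lc /\ Rsum (fun i => Cmod (c i)) (S n) <= B.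

Lemma ispoly_ext P Q n lc B : (forall z, P z = Q z) -> ispoly P n lc B -> ispoly Q n lc B.
Proof. intros E (c & H1 & H2 & H3). exists c. repeat split; auto. intros z; rewrite <- E; auto. Qed.

Lemma ispoly_const a : ispoly (fun _ => a) 0 a (Cmod a).
Proof. exists (fun _ => a). repeat split; intros; simpl; try ring; lra. Qed.

Lemma ispoly_linear a b : ispoly (fun z => a + b * z)%C 1 b (Cmod a + Cmod b).
Proof.
exists (fun i => match i with O => a | _ => b end). repeat split; intros; simpl; try ring; lra.
Qed.

Lemma ispoly_scal a P n lc B : ispoly P n lc B -> ispoly (fun z => a * P z)%C n (a * lc)%C (Cmod a * B).
Proof.
intros (c & H1 & H2 & H3). exists (fun i => a * c i)%C. repeat split.
- intros z. rewrite H1, <- Csum_scal. apply Csum_ext. intros; ring.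
- rewrite H2; auto.
- rewrite (Rsum_ext _ (fun i => Cmod a * Cmod (c i))) by (intros; apply Cmod_mult).
  rewrite Rsum_scal. apply Rmult_le_compat_l; [apply Cmod_ge_0|auto].
Qed.

Lemma ispoly_shift P n lc B : ispoly P n lc B -> ispoly (fun z => z * P z)%C (S n) lc B.
Proof.
intros (c & H1 & H2 & H3). exists (fun i => match i with O => RtoC 0 | S i => c i end). repeat split.
- intros z. rewrite Csum_head, H1, <- Csum_scal, Cmult_0_l, Cplus_0_l. apply Csum_ext.
  intros; rewrite Cpow_S; ring.
- auto.
- rewrite Rsum_head, Cmod_0, Rplus_0_l. auto.
Qed.

Lemma ispoly_add_lower P n a B Q m b B' : ispoly P n a B -> ispoly Q m b B' -> (n < m)%nat ->
  ispoly (fun z => P z + Q z)%C m b (B + B').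
Proof.
intros (c & H1 & H2 & H3) (d & H1' & H2' & H3') Hnm.
set (c0 := fun i => if le_dec i n then c i else RtoC 0).
assert (E : forall z k, Csum (fun i => c0 i * z ^ i)%C (S n + k) = Csum (fun i => c i * z ^ i)%C (S n)).
{ intros z k. induction k.
  - rewrite Nat.add_0_r. apply Csum_ext. intros i Hi. unfold c0. destruct (le_dec i n); [auto|lia].
  - rewrite Nat.add_succ_r.
    change (Csum (fun i => c0 i * z ^ i)%C (S n + k) + c0 (S n + k)%nat * z ^ (S n + k)
      = Csum (fun i => c i * z ^ i) (S n))%C.
    rewrite IHk. unfold c0. destruct (le_dec (S n + k) n); [lia|]. ring. }
assert (E' : forall k, Rsum (fun i => Cmod (c0 i)) (S n + k) = Rsum (fun i => Cmod (c i)) (S n)).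
{ intros k. induction k.
  - rewrite Nat.add_0_r. apply Rsum_ext. intros i Hi. unfold c0. destruct (le_dec i n); [auto|lia].
  - rewrite Nat.add_succ_r.
    change (Rsum (fun i => Cmod (c0 i)) (S n + k) + Cmod (c0 (S n + k)%nat)
      = Rsum (fun i => Cmod (c i)) (S n)).
    rewrite IHk. unfold c0. destruct (le_dec (S n + k) n); [lia|]. rewrite Cmod_0. ring. }
exists (fun i => c0 i + d i)%C. repeat split.
- intros z. rewrite H1, H1', <- (E z (m - n)%nat).
  replace (S n + (m - n))%nat with (S m) by lia. rewrite <- Csum_plus.
  apply Csum_ext. intros; ring.
- unfold c0. destruct (le_dec m n); [lia|]. rewrite H2'. ring.
- eapply Rle_trans. { apply Rsum_le. intros i _. apply Cmod_triangle. }
  rewrite (Rsum_plus (fun i => Cmod (c0 i)) (fun i => Cmod (d i))).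
  specialize (E' (m - n)%nat). replace (S n + (m - n))%nat with (S m) in E' by lia. lra.
Qed.

Lemma ispoly_le P n a B B' : B <= B' -> ispoly P n a B -> ispoly P n a B'.
Proof. intros HB (c & H1 & H2 & H3). exists c; repeat split; auto; lra. Qed.

Lemma ispoly_mult P n a B Q m b B' : ispoly P n a B -> ispoly Q m b B' ->
  ispoly (fun z => P z * Q z)%C (n + m) (a * b)%C (B * B').
Proof.
intros HP HQ. assert (HB : 0 <= B).
{ destruct HP as (c & _ & _ & H3). eapply Rle_trans; [|apply H3]. apply Rsum_pos. intros; apply Cmod_ge_0. }
revert Q b B' HQ. induction m; intros Q b B' (d & H1 & H2 & H3).
- rewrite Nat.add_0_r. apply (ispoly_le _ _ _ (Cmod b * B)).
  { simpl in H3. rewrite <- H2. nra. }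
  rewrite Cmult_comm.
  apply (ispoly_ext (fun z => b * P z)%C); [|apply ispoly_scal; auto].
  intros z. rewrite H1. simpl. rewrite H2. ring.
- assert (HQ' : ispoly (fun z => Csum (fun i => d (S i) * z ^ i)%C (S m)) m b
      (Rsum (fun i => Cmod (d (S i))) (S m))).
  { exists (fun i => d (S i)). repeat split; auto. lra. }
  rewrite Nat.add_succ_r.
  apply (ispoly_le _ _ _ (Cmod (d 0%nat) * B + B * Rsum (fun i => Cmod (d (S i))) (S m))).
  { rewrite Rsum_head in H3. nra. }
  apply (ispoly_ext (fun z => d 0%nat * P z + z * (P z * Csum (fun i => d (S i) * z ^ i)%C (S m)))%C).
  { intros z. rewrite H1, (Csum_head _ (S m)).
    assert (E : Csum (fun i => d (S i) * z ^ S i)%C (S m) = (z * Csum (fun i => d (S i) * z ^ i) (S m))%C).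
    { rewrite <- Csum_scal. apply Csum_ext. intros i _. rewrite Cpow_S. ring. }
    transitivity (d 0%nat * P z + P z * (z * Csum (fun i => d (S i) * z ^ i) (S m)))%C; [ring|].
    rewrite <- E. change (z ^ 0)%C with (RtoC 1). ring. }
  eapply ispoly_add_lower; [apply ispoly_scal, HP| |].
  + apply ispoly_shift. apply IHm. exact HQ'.
  + lia.
Qed.

(** The discrete Fourier transform on [N > n] equally spaced points isolates
    [lc * rho^n] as a mean of the values of [P] times unimodular numbers. *)
Lemma ispoly_grid P n lc B N rho K : ispoly P n lc B -> (n < N)%nat -> 0 <= rho ->
  (forall t, (t < N)%nat -> Cmod (P (rho * cis (2 * PI * INR t / INR N)))%C <= K) ->
  Cmod lc * rho ^ n <= K.
Proof.
intros (c & H1 & H2 & _) HN Hrho HK.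
assert (HNp : 0 < INR N) by (apply lt_0_INR; lia).
assert (E : (Csum (fun t => P (rho * cis (2 * PI * INR t / INR N)) * cis (- (2 * PI * INR n * INR t / INR N)))%C N)
  = (INR N * (lc * rho ^ n))%C).
{ rewrite (Csum_ext _ (fun t => Csum (fun i => (c i * rho ^ i) * cis (- (2 * PI * INR (n - i) * INR t / INR N)))%C (S n))).
  - rewrite Csum_swap. rewrite (Csum_single _ _ n).
    + rewrite (Csum_ext _ (fun t => RtoC 1 * (lc * rho ^ n))%C).
      * rewrite (Csum_ext _ (fun t => (lc * rho ^ n) * RtoC 1)%C) by (intros; ring).
        rewrite Csum_scal, (Csum_RtoC (fun _ => 1)), Rsum_const, Rmult_1_r. ring.
      * intros t _. rewrite Nat.sub_diag, H2. simpl INR.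
        replace (- (2 * PI * 0 * INR t / INR N)) with 0 by (field; lra). rewrite cis_0. ring.
    + lia.
    + intros i Hi Hin. rewrite Csum_scal.
      replace (Csum (fun t => cis (- (2 * PI * INR (n - i) * INR t / INR N))) N) with (RtoC 0); [ring|].
      symmetry.
      rewrite (Csum_ext _ (fun t => cis (2 * PI * INR (N - (n - i)) * INR t / INR N))).
      * apply root_unity_sum. lia.
      * intros t _. rewrite (minus_INR N) by lia.
        replace (2 * PI * (INR N - INR (n - i)) * INR t / INR N) with
          (- (2 * PI * INR (n - i) * INR t / INR N) + 2 * PI * INR t) by (field; lra).
        rewrite cis_plus, cis_2PI. ring.
  - intros t _. rewrite H1, Cmult_comm, <- Csum_scal. apply Csum_ext. intros i Hi.
    rewrite Cpow_mult_l, cis_pow.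
    replace (- (2 * PI * INR (n - i) * INR t / INR N)) with
      (- (2 * PI * INR n * INR t / INR N) + INR i * (2 * PI * INR t / INR N)).
    + rewrite cis_plus. ring.
    + rewrite minus_INR by lia. field; lra. }
apply (f_equal Cmod) in E. rewrite !Cmod_mult, Cmod_pow, !Cmod_R in E.
rewrite (Rabs_pos_eq rho) in E by auto. rewrite (Rabs_pos_eq (INR N)) in E by lra.
apply Rmult_le_reg_l with (INR N); auto. rewrite <- E.
eapply Rle_trans; [apply Csum_Cmod|]. rewrite <- Rsum_const. apply Rsum_le.
intros t Ht. rewrite Cmod_mult, Cmod_cis, Rmult_1_r. apply HK; auto.
Qed.

(** The factors are functions of period [2 L]; up to sign the product has period [L], and
    as a function of [t] it is an exponential polynomial with frequencies in
    [[- pi |l| / L, pi |l| / L]]. *)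
Fixpoint sprod (L : R) (l : list R) (t : R) : R :=
  match l with nil => 1 | a :: l => sin (PI * (t - a) / L) * sprod L l t end.

(** Writing each sine as [e^(-ix) (e^(2ix) - 1) / (2i)] turns the product into a
    polynomial in [e^(2 pi i t / L)] with leading coefficient of modulus [2^(-|l|)] and
    coefficient norm at most 1. *)
Lemma sprod_poly L l : 0 < L -> exists P lc, Cmod lc = (/ 2) ^ length l /\ ispoly P (length l) lc 1 /\
  forall t, RtoC (sprod L l t) = (cis (- (PI * INR (length l) * t / L)) * P (cis (2 * PI * t / L)))%C.
Proof.
intros HL. induction l as [|a l (P & lc & H1 & H2 & H3)].
- exists (fun _ => RtoC 1), (RtoC 1). repeat split.
  + rewrite Cmod_1; reflexivity.
  + assert (A := ispoly_const 1). rewrite Cmod_1 in A. exact A.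
  + intros t. simpl. replace (- (PI * 0 * t / L)) with 0 by (field; lra). rewrite cis_0. ring.
- set (g := (cis (PI * a / L) * (/ 2 * - Ci))%C).
  set (u := cis (- (2 * PI * a / L))).
  assert (Hg : Cmod g = / 2).
  { unfold g. rewrite !Cmod_mult, Cmod_cis, Cmod_opp, Cmod_Ci.
    rewrite <- RtoC_inv by lra. rewrite Cmod_R, Rabs_pos_eq by lra. ring. }
  assert (Hu : Cmod u = 1) by apply Cmod_cis.
  exists (fun z => P z * ((- g) + (g * u) * z))%C, (lc * (g * u))%C. repeat split.
  + rewrite !Cmod_mult, H1, Hg, Hu. simpl. ring.
  + simpl length. rewrite <- Nat.add_1_r.
    apply (ispoly_le _ _ _ (1 * (Cmod (- g)%C + Cmod (g * u)%C))).
    { rewrite Cmod_opp, Cmod_mult, Hg, Hu. lra. }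
    apply ispoly_mult; auto. apply ispoly_linear.
  + intros t. simpl sprod. rewrite RtoC_mult, H3, sin_cis.
    replace (cis (2 * (PI * (t - a) / L))) with (cis (2 * PI * t / L) * u)%C
      by (unfold u; rewrite <- cis_plus; f_equal; field; lra).
    replace (cis (- (PI * (t - a) / L))) with (cis (- (PI * t / L)) * cis (PI * a / L))%C
      by (rewrite <- cis_plus; f_equal; field; lra).
    replace (cis (- (PI * INR (length (a :: l)) * t / L))) with
      (cis (- (PI * t / L)) * cis (- (PI * INR (length l) * t / L)))%C
      by (rewrite <- cis_plus; f_equal; simpl length; rewrite S_INR; field; lra).
    unfold g. ring.
Qed.

Lemma sprod_spectrum L l : 0 < L -> exists c : nat -> C,
  Rsum (fun i => Cmod (c i)) (S (length l)) <= 1 /\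
  forall t, RtoC (sprod L l t) =
    Csum (fun i => c i * cis ((2 * INR i - INR (length l)) * PI * t / L))%C (S (length l)).
Proof.
intros HL. destruct (sprod_poly L l HL) as (P & lc & _ & (c & Hc & _ & HB) & H).
exists c. split; auto. intros t. rewrite H, Hc, <- Csum_scal.
apply Csum_ext. intros i _. rewrite cis_pow.
replace ((2 * INR i - INR (length l)) * PI * t / L) with
  (- (PI * INR (length l) * t / L) + INR i * (2 * PI * t / L)) by (field; lra).
rewrite cis_plus. ring.
Qed.

(** A lower bound for the maximum over integers: the leading coefficient is a mean of the
    values on the grid of [L]-th roots of unity, by ispoly_grid. *)
Lemma sprod_large (L : nat) l : (length l < L)%nat ->
  exists t, (t < L)%nat /\ (/ 2) ^ length l <= Rabs (sprod (INR L) l (INR t)).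
Proof.
intros HL. assert (HLp : 0 < INR L) by (apply lt_0_INR; lia).
destruct (sprod_poly (INR L) l HLp) as (P & lc & H1 & H2 & H3).
apply NNPP. intros Hno.
assert (Hbd : forall t, (t < L)%nat -> Rabs (sprod (INR L) l (INR t)) < (/2) ^ length l).
{ intros t Ht. apply Rnot_le_lt. intros h. apply Hno. exists t; auto. }
assert (HK : exists K, K < (/2) ^ length l /\ forall t, (t < L)%nat -> Rabs (sprod (INR L) l (INR t)) <= K).
{ clear -Hbd. revert Hbd. generalize (INR L) at 1 2. intros M Hbd. induction L.
  - exists ((/2) ^ length l - 1). split; [lra|]. intros; lia.
  - destruct IHL as (K & HK1 & HK2); [intros; apply Hbd; lia|].
    exists (Rmax K (Rabs (sprod M l (INR L)))). split; [apply Rmax_lub_lt; auto|].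
    intros t Ht. destruct (Nat.eq_dec t L) as [->|h]; [apply Rmax_r|].
    eapply Rle_trans; [|apply Rmax_l]. apply HK2; lia. }
destruct HK as (K & HK1 & HK2).
assert (A := ispoly_grid P (length l) lc 1 L 1 K H2 HL Rle_0_1).
rewrite H1, pow1, Rmult_1_r in A. apply Rlt_not_le in HK1. apply HK1, A.
intros t Ht. specialize (HK2 t Ht). rewrite <- Cmod_R, H3, Cmod_mult, Cmod_cis, Rmult_1_l in HK2.
rewrite Cmult_1_l. exact HK2.
Qed.

Lemma sprod_period L l t : 0 < L -> Rabs (sprod L l (t + L)) = Rabs (sprod L l t).
Proof.
intros HL. induction l; simpl; [reflexivity|]. rewrite !Rabs_mult, IHl. f_equal.
replace (PI * (t + L - a) / L) with (PI * (t - a) / L + PI) by (field; lra).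
rewrite neg_sin. apply Rabs_Ropp.
Qed.

Lemma sprod_le_1 L l t : Rabs (sprod L l t) <= 1.
Proof.
induction l; simpl; [rewrite Rabs_R1; lra|]. rewrite Rabs_mult.
assert (Rabs (sin (PI * (t - a) / L)) <= 1) by (apply Rabs_le; apply SIN_bound).
assert (A := Rabs_pos (sprod L l t)). assert (A' := Rabs_pos (sin (PI * (t - a) / L))). nra.
Qed.

Lemma sprod_app L l l' t : sprod L (l ++ l') t = sprod L l t * sprod L l' t.
Proof. induction l; simpl; [lra|]. rewrite IHl. ring. Qed.

(** * Regularity on an arc improves the Cauchy estimates *)

Lemma Cmod_chord a b : Cmod (cis a - cis b)%C = 2 * Rabs (sin ((a - b) / 2)).
Proof.
replace (2 * Rabs (sin ((a - b) / 2))) with (Rabs (2 * sin ((a - b) / 2)))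
  by (rewrite Rabs_mult, (Rabs_pos_eq 2); lra).
rewrite <- sqrt_Rsqr_abs. unfold Cmod, cis, Cminus, Cplus, Copp; simpl. f_equal.
assert (E : cos (a - b) = 1 - 2 * sin ((a - b) / 2) * sin ((a - b) / 2)).
{ rewrite <- cos_2a_sin. f_equal. field. }
assert (E' := cos_minus a b). assert (A := sin2_cos2 a). assert (A' := sin2_cos2 b).
unfold Rsqr in *. nra.
Qed.

Lemma Rabs_sin_le x : Rabs (sin x) <= Rabs x.
Proof.
assert (H : forall y, 0 <= y -> Rabs (sin y) <= y).
{ intros y Hy. destruct (Rle_lt_dec 1 y) as [h|h].
  - apply Rle_trans with 1; [apply Rabs_le, SIN_bound|auto].
  - destruct Hy as [Hy| <-]; [|rewrite sin_0, Rabs_R0; lra].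
    assert (0 < sin y) by (apply sin_gt_0; [auto|assert (A := PI2_1); lra]).
    rewrite Rabs_pos_eq by lra. left. apply sin_lt_x; auto. }
destruct (Rle_lt_dec 0 x) as [h|h].
- rewrite (Rabs_pos_eq x); auto.
- rewrite <- (Rabs_Ropp x), <- Rabs_Ropp, <- sin_neg, (Rabs_pos_eq (- x)) by lra. apply H; lra.
Qed.

Lemma cis_lipschitz a b : Cmod (cis a - cis b)%C <= Rabs (a - b).
Proof.
rewrite Cmod_chord. eapply Rle_trans.
- apply Rmult_le_compat_l; [lra|apply Rabs_sin_le].
- unfold Rdiv. rewrite Rabs_mult, (Rabs_pos_eq (/2)) by lra. lra.
Qed.

(** The [k]-th Taylor coefficient of [sum a_m z^m] at [p e^(i theta)] gains a factor
    [2^(-k)] on the growth rate [(1 - p)^(-k)] that the unit disc allows: the Taylor series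
    behaves as if its radius of convergence were [2 (1 - p)]. *)
Definition taylor_bounded (a : nat -> R) (p M theta : R) : Prop :=
  forall k, exists s,
    Cser (fun m => RtoC (a m) * (bin m k * (p * cis theta) ^ (m - k)))%C s /\
    Cmod s * (2 * (1 - p)) ^ k <= M.

(** Near a regular point the continuation has one expansion in a disc of fixed radius, so
    for [p] close to 1 the Taylor series at [p e^(i theta')] converges in a disc of radius
    far larger than [2 (1 - p)]. *)
Lemma taylor_bounded_local a th : immediate_continuation a (cis th) ->
  exists delta : posreal, forall th' p, Rabs (th' - th) <= 2 * delta -> 1 - delta <= p < 1 -> 0 < p ->
    taylor_bounded a p (/ delta) th'.
Proof.
intros (V & g & _ & HV & Hg & Ha).
destruct (expands_of_analytic g (cis th)) as (c & r & Hr & Hc); [apply Hg; auto|].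
destruct (Hc (r / 2)) as [B HB]; [lra|]. set (rho := r / 2) in *.
assert (Hrho : 0 < rho) by (unfold rho; lra).
assert (HB0 : 0 <= B) by (destruct HB as [HB _]; apply (HB 0%nat)).
assert (Hdpos : 0 < Rmin (rho / 16) (/ (1 + B))).
{ apply Rmin_glb_lt; [lra|apply Rinv_0_lt_compat; lra]. }
exists (mkposreal _ Hdpos). simpl. set (delta := Rmin (rho / 16) (/ (1 + B))) in *.
assert (Hd1 : delta <= rho / 16) by apply Rmin_l.
assert (Hd2 : delta <= / (1 + B)) by apply Rmin_r.
assert (HBd : B <= / delta).
{ apply Rle_trans with (1 + B); [lra|]. rewrite <- (Rinv_inv (1 + B)). apply Rinv_le_contravar; auto. }
intros th' p Hth Hp Hp0 k.
set (z1 := (p * cis th')%C).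
assert (Hz1 : Cmod z1 = p). { unfold z1. rewrite Cmod_mult, Cmod_cis, Cmod_R, Rabs_pos_eq; lra. }
set (d := (z1 - cis th)%C).
assert (Hdd : Cmod d <= rho / 4).
{ unfold d. eapply Rle_trans; [apply (Cmod_dist _ (cis th'))|].
  assert (A := cis_lipschitz th' th).
  replace (z1 - cis th')%C with (RtoC (p - 1) * cis th')%C
    by (unfold z1; rewrite RtoC_minus; ring).
  rewrite Cmod_mult, Cmod_cis, Cmod_R, Rabs_left by lra. lra. }
destruct (expands_recentre _ _ _ _ d (rho / 2) HB) as (c' & _ & Hc'); [lra|lra|].
set (r0 := (1 + p) / 2).
destruct (expands_of_Cser g (fun m => RtoC (a m)) 1 r0) as [B0 HB0'].
{ unfold r0; lra. }
{ intros w Hw. apply pseries_Cser, Ha; auto. }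
set (e := Rmin (rho / 2) (r0 - p)).
assert (He : 0 < e) by (apply Rmin_glb_lt; unfold r0; lra).
destruct (expands_recentre _ _ _ _ z1 e HB0') as (c'' & Hser & Hc''); [auto|rewrite Hz1; assert (e <= r0 - p) by apply Rmin_r; lra|].
assert (E : forall k, c' k = c'' k).
{ intros j. refine (expands_unique _ _ c' c'' e B B0 He _ (expands_le _ _ (rho/2) e B B _ (Rle_refl _) Hc') Hc'' j).
  - intros w _. f_equal. unfold d. ring.
  - split; [lra|apply Rmin_l]. }
exists (c'' k). split; [apply Hser|].
rewrite <- E. apply Rle_trans with (2 := HBd).
apply Rle_trans with (Cmod (c' k) * (rho / 2) ^ k).
- apply Rmult_le_compat_l; [apply Cmod_ge_0|]. apply pow_incr. lra.
- apply (expands_coef (fun v => g (cis th + (d + v)))%C c' (rho / 2) B k); [lra|exact Hc'].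
Qed.

(** Compactness of the arc makes [p] and the bound uniform, and the arc can be widened by
    [d] because taylor_bounded_local covers a neighbourhood of each angle. *)
Lemma taylor_bounded_arc a S : 0 <= S ->
  (forall th, Rabs th <= S -> immediate_continuation a (cis th)) ->
  exists d p M, 0 < d /\ 0 < p < 1 /\ 0 < M /\ forall th, Rabs th <= S + d -> taylor_bounded a p M th.
Proof.
intros HS H.
assert (Hl : forall th, exists delta : posreal, Rabs th <= S ->
   forall th' p, Rabs (th' - th) <= 2 * delta -> 1 - delta <= p < 1 -> 0 < p ->
    taylor_bounded a p (/ delta) th').
{ intros th. destruct (classic (Rabs th <= S)) as [h|h].
  - destruct (taylor_bounded_local a th (H th h)) as [delta Hd]. exists delta; auto.
  - exists (mkposreal 1 Rlt_0_1). intros h'; contradiction. }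
set (delta := fun th => proj1_sig (constructive_indefinite_description _ (Hl th))).
assert (Hdelta : forall th, Rabs th <= S ->
   forall th' p, Rabs (th' - th) <= 2 * delta th -> 1 - delta th <= p < 1 -> 0 < p ->
    taylor_bounded a p (/ delta th) th').
{ intros th. unfold delta. apply (proj2_sig (constructive_indefinite_description _ (Hl th))). }
destruct (compactness_value_1d (- S) S delta) as [d Hd].
assert (Hdp := cond_pos d).
exists d, (1 - Rmin d (1/2)), (/ d).
assert (Hm : 0 < Rmin d (1/2) <= 1/2) by (split; [apply Rmin_glb_lt; lra|apply Rmin_r]).
assert (Hm' : Rmin d (1/2) <= d) by apply Rmin_l.
split; [auto|]. split; [lra|]. split; [apply Rinv_0_lt_compat; auto|].
intros th Hth k.
assert (Hx : exists x, - S <= x <= S /\ Rabs (th - x) <= d).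
{ apply Rabs_le_between in Hth.
  destruct (Rle_lt_dec th S) as [h|h]; [destruct (Rle_lt_dec (- S) th) as [h'|h']|].
  - exists th. rewrite Rminus_diag, Rabs_R0. lra.
  - exists (- S). split; [lra|]. apply Rabs_le. lra.
  - exists S. split; [lra|]. apply Rabs_le. lra. }
destruct Hx as (x & Hx & Hxd).
destruct (NNPP _ (Hd x Hx)) as (t & Ht & Hxt & Hdt).
assert (Htb : taylor_bounded a (1 - Rmin d (1/2)) (/ delta t) th).
{ apply Hdelta.
  - apply Rabs_le; lra.
  - replace (th - t) with ((th - x) + (x - t)) by ring.
    eapply Rle_trans; [apply Rabs_triang|]. lra.
  - lra.
  - lra. }
destruct (Htb k) as (s & Hs & Hb). exists s. split; auto.
eapply Rle_trans; [apply Hb|]. apply Rinv_le_contravar; auto.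
Qed.

(** * Concentration of the negative binomial weights *)

Lemma exp_dominates C eps : 0 < eps -> exists N, forall n, (N <= n)%nat -> C * (INR n + 1) <= exp (eps * INR n).
Proof.
intros He.
destruct (INR_unbounded (8 * Rabs C / (eps * eps) + 1)) as [N HN].
exists N. intros n Hn. apply le_INR in Hn.
assert (Hn1 : 8 * Rabs C / (eps * eps) <= INR n - 1) by lra.
assert (H0 : 0 <= Rabs C) by apply Rabs_pos.
assert (Hee : 0 < eps * eps) by nra.
assert (Hq : 0 <= 8 * Rabs C / (eps * eps)) by (apply Rle_div_r; lra).
assert (H8 : 8 * Rabs C <= (INR n - 1) * (eps * eps)).
{ apply Rle_div_l in Hn1; auto. }
assert (E : exp (eps * INR n) = exp (eps * INR n / 2) * exp (eps * INR n / 2)).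
{ rewrite <- exp_plus. f_equal. field. }
assert (A := exp_ineq1_le (eps * INR n / 2)).
assert (B : (eps * INR n / 2) * (eps * INR n / 2) <= exp (eps * INR n)) by (rewrite E; apply Rmult_le_compat; nra).
apply Rle_trans with (Rabs C * (INR n + 1)); [apply Rmult_le_compat_r; [lra|apply Rle_abs]|].
apply Rle_trans with (2 := B). nra.
Qed.

Lemma exp_INR x n : exp (x * INR n) = exp x ^ n.
Proof.
induction n; [rewrite Rmult_0_r; apply exp_0|].
rewrite S_INR, Rmult_plus_distr_l, exp_plus, IHn, Rmult_1_r. simpl. ring.
Qed.

Lemma exp_ge_1 x : 0 <= x -> 1 <= exp x.
Proof. intros Hx. assert (A := exp_ineq1_le x). lra. Qed.

Lemma exp_le x y : x <= y -> exp x <= exp y.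
Proof. intros [H| ->]; [left; apply exp_increasing; auto|lra]. Qed.

Definition growth_upper (a : nat -> R) : Prop :=
  forall eps, 0 < eps -> exists C, 0 <= C /\ forall m, Rabs (a m) <= C * exp (eps * INR m).
Definition growth_lower (a : nat -> R) : Prop :=
  forall eps, 0 < eps -> exists N, forall m, (N <= m)%nat -> a m <> 0 -> exp (- eps * INR m) <= Rabs (a m).

Lemma binomial_C x y m : ((x + y) ^ m)%C = Csum (fun k => bin m k * x ^ (m - k) * y ^ k)%C (S m).
Proof.
induction m.
- simpl. ring.
- rewrite Csum_head.
  rewrite (Csum_ext _ (fun k => y * (bin m k * x ^ (m - k) * y ^ k) + bin m (S k) * x ^ (m - k) * y ^ S k)%C).
  2: { intros k _. simpl bin. replace (S m - S k)%nat with (m - k)%nat by lia. rewrite RtoC_plus, (Cpow_S y). ring. }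
  rewrite Csum_plus, Csum_scal, <- IHm.
  assert (E : Csum (fun k => bin m (S k) * x ^ (m - k) * y ^ S k)%C (S m) = (x * ((x + y) ^ m - x ^ m))%C).
  { change (Csum (fun k => bin m (S k) * x ^ (m - k) * y ^ S k)%C m + bin m (S m) * x ^ (m - m) * y ^ S m = (x * ((x + y) ^ m - x ^ m)))%C.
    rewrite (bin_gt m (S m)) by lia. rewrite IHm, Csum_head, bin_0, Nat.sub_0_r.
    change (y ^ 0)%C with (RtoC 1).
    rewrite (Csum_ext _ (fun k => x * (bin m (S k) * x ^ (m - S k) * y ^ S k))%C).
    - rewrite Csum_scal. ring.
    - intros k Hk. replace (m - k)%nat with (S (m - S k)) by lia. rewrite (Cpow_S x). ring. }
  rewrite E, !bin_0. change (y ^ 0)%C with (RtoC 1). rewrite Nat.sub_0_r, !Cpow_S. ring.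
Qed.

Lemma binomial_R x y m : (x + y) ^ m = Rsum (fun k => bin m k * x ^ (m - k) * y ^ k) (S m).
Proof.
apply RtoC_inj. rewrite RtoC_pow, RtoC_plus, binomial_C, <- Csum_RtoC.
apply Csum_ext. intros k _. rewrite !RtoC_mult, !RtoC_pow. reflexivity.
Qed.

(** The generating function [sum_m bin(m,k) x^(m-k) = (1 - x)^(-k-1)], as a bound for
    partial sums. *)
Lemma bin_gf x k n : 0 <= x < 1 -> Rsum (fun m => bin m k * x ^ (m - k)) n <= (/ (1 - x)) ^ (S k).
Proof.
intros Hx. revert n. induction k; intros n.
- simpl. rewrite Rmult_1_r. eapply Rle_trans; [|apply (Rsum_geom x n Hx)]. apply Rsum_le.
  intros i _. rewrite bin_0, Nat.sub_0_r. lra.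
- assert (Hpos : forall i, 0 <= bin i (S k) * x ^ (i - S k)).
  { intros i. apply Rmult_le_pos; [apply bin_pos|apply pow_le; lra]. }
  assert (E : Rsum (fun m => bin m (S k) * x ^ (m - S k)) (S n) =
     Rsum (fun m => bin m k * x ^ (m - k)) n + x * Rsum (fun m => bin m (S k) * x ^ (m - S k)) n).
  { rewrite Rsum_head. simpl bin at 1. rewrite Rmult_0_l, Rplus_0_l.
    rewrite <- Rsum_scal, <- Rsum_plus. apply Rsum_ext. intros m _.
    simpl. destruct (le_lt_dec (S k) m) as [h|h].
    - replace (m - k)%nat with (S (m - S k)) by lia. simpl. ring.
    - rewrite (bin_gt m (S k)) by lia. ring. }
  assert (Hm := Rsum_mono _ n (S n) Hpos ltac:(lia)).
  specialize (IHk n).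
  apply Rmult_le_reg_r with (1 - x); [lra|].
  change ((/ (1 - x)) ^ S (S k)) with (/ (1 - x) * (/ (1 - x)) ^ S k).
  replace (/ (1 - x) * (/ (1 - x)) ^ S k * (1 - x)) with ((/ (1 - x)) ^ S k) by (field_simplify_eq; [ring|lra] || (field; lra)).
  simpl in *. nra.
Qed.

(** The derivative at [t = 0] of [1 - p e^(al t) - q e^((al - be) t)] is
    [q be - al > 0], and the function vanishes there. *)
Lemma tilt p q al be : p + q = 1 -> 0 < p -> 0 < q -> al < q * be ->
  exists t, 0 < t /\ p * exp (al * t) < 1 /\ q * exp ((al - be) * t) < 1 - p * exp (al * t).
Proof.
intros Hpq Hp Hq Hab.
set (f := fun t => 1 - p * exp (al * t) - q * exp ((al - be) * t)).
assert (Hf : is_derive f 0 (q * be - al)).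
{ unfold f. auto_derive; auto. rewrite !Rmult_0_r, exp_0.
  replace q with (1 - p) by lra. ring. }
apply is_derive_Reals in Hf.
destruct (Hf ((q * be - al) / 2)) as [[d Hd] Hlim]; [lra|].
specialize (Hlim (d / 2)). simpl in Hlim.
assert (Hf0 : f 0 = 0). { unfold f. rewrite !Rmult_0_r, exp_0. lra. }
rewrite Hf0, Rplus_0_l, Rminus_0_r in Hlim.
assert (A : Rabs (f (d / 2) / (d / 2) - (q * be - al)) < (q * be - al) / 2).
{ apply Hlim; [lra|]. rewrite Rabs_pos_eq; lra. }
assert (Hpos : 0 < f (d / 2)).
{ apply Rabs_lt_between in A.
  assert (0 < f (d/2) / (d/2)) by lra.
  replace (f (d/2)) with (f (d/2) / (d/2) * (d/2)) by (field; lra). apply Rmult_lt_0_compat; lra. }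
exists (d / 2). unfold f in Hpos. assert (B := exp_pos ((al - be) * (d / 2))). repeat split; nra.
Qed.

Definition far (q r : R) (k m : nat) : R :=
  if Rle_dec (r * INR k) (Rabs (INR m - INR k / q)) then 1 else 0.

(** Chernoff's method: the indicator of the tail is at most
    [exp(t (sg m - be k))], which turns the weighted sum into a generating function at the
    tilted argument [p exp(al t)]; tilt provides a [t] for which the result decays. *)
Lemma tail_side a p r sg : 0 < p < 1 -> 0 < r -> growth_upper a -> (sg = 1 \/ sg = -1) ->
  exists lam K, 0 < lam < 1 /\ 0 <= K /\ forall k n,
    Rsum (fun m => (if Rle_dec (r * INR k) (sg * (INR m - INR k / (1 - p))) then 1 else 0)
       * (bin m k * p ^ (m - k) * Rabs (a m))) n * (1 - p) ^ k <= K * lam ^ k.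
Proof.
intros Hp Hr Ha Hsg. set (q := 1 - p). assert (Hq : 0 < q < 1) by (unfold q; lra).
set (eta := q * r / 2). assert (He : 0 < eta) by (unfold eta; apply Rdiv_lt_0_compat; nra).
set (be := sg / q + r). set (al := sg + eta).
assert (Hab : al < q * be).
{ unfold al, be, eta. rewrite Rmult_plus_distr_l. replace (q * (sg / q)) with sg by (field; lra). nra. }
destruct (tilt p q al be) as (t & Ht & Hx & Hlam); [unfold q; ring|lra|lra|auto|].
destruct (Ha (eta * t)) as (C & HC & Hgrow); [apply Rmult_lt_0_compat; auto|].
set (x := p * exp (al * t)) in *.
assert (Hx0 : 0 < x) by (apply Rmult_lt_0_compat; [lra|apply exp_pos]).
set (lam := q * exp ((al - be) * t) / (1 - x)).
exists lam, (C / (1 - x)).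
assert (Hl : 0 < lam < 1).
{ unfold lam. split; [apply Rdiv_lt_0_compat; [apply Rmult_lt_0_compat; [lra|apply exp_pos]|lra]|].
  apply Rlt_div_l; lra. }
assert (HCx : 0 <= C / (1 - x)) by (apply Rle_div_r; lra).
split; [auto|]. split; [auto|]. intros k n.
assert (Hterm : forall m,
   (if Rle_dec (r * INR k) (sg * (INR m - INR k / q)) then 1 else 0) * (bin m k * p ^ (m - k) * Rabs (a m))
   <= C * exp ((al - be) * t * INR k) * (bin m k * x ^ (m - k))).
{ intros m. destruct (le_lt_dec k m) as [hkm|hkm].
  2:{ rewrite (bin_gt m k) by auto. lra. }
  assert (H0 : 0 <= bin m k * p ^ (m - k)) by (apply Rmult_le_pos; [apply bin_pos|apply pow_le; lra]).
  assert (E : C * exp ((al - be) * t * INR k) * (bin m k * x ^ (m - k)) =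
     exp (t * (sg * INR m - be * INR k)) * (bin m k * p ^ (m - k) * (C * exp (eta * t * INR m)))).
  { unfold x. rewrite Rpow_mult_distr, <- exp_INR.
    replace (exp (t * (sg * INR m - be * INR k)) * (bin m k * p ^ (m - k) * (C * exp (eta * t * INR m))))
      with (C * (bin m k * p ^ (m - k)) * (exp (t * (sg * INR m - be * INR k)) * exp (eta * t * INR m))) by ring.
    replace (C * exp ((al - be) * t * INR k) * (bin m k * (p ^ (m - k) * exp (al * t * INR (m - k)))))
      with (C * (bin m k * p ^ (m - k)) * (exp ((al - be) * t * INR k) * exp (al * t * INR (m - k)))) by ring.
    f_equal. rewrite <- !exp_plus. f_equal. rewrite minus_INR by auto. unfold al. ring. }
  rewrite E. destruct (Rle_dec _ _) as [h|h].
  - apply Rmult_le_compat; [lra|apply Rmult_le_pos; [auto|apply Rabs_pos]| |apply Rmult_le_compat_l; auto].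
    apply exp_ge_1. apply Rmult_le_pos; [lra|]. unfold be.
    replace (sg * INR m - (sg / q + r) * INR k) with (sg * (INR m - INR k / q) - r * INR k) by (field; lra). lra.
  - rewrite Rmult_0_l. apply Rmult_le_pos; [left; apply exp_pos|].
    apply Rmult_le_pos; [auto|]. apply Rmult_le_pos; [auto|left; apply exp_pos]. }
apply Rle_trans with (C * exp ((al - be) * t * INR k) * (/ (1 - x)) ^ (S k) * q ^ k).
- apply Rmult_le_compat_r; [apply pow_le; lra|].
  eapply Rle_trans; [apply Rsum_le; intros i _; apply Hterm|].
  rewrite Rsum_scal. apply Rmult_le_compat_l.
  + apply Rmult_le_pos; [auto|left; apply exp_pos].
  + apply bin_gf; lra.
- right. unfold lam. unfold Rdiv. rewrite !Rpow_mult_distr, exp_INR. simpl. ring.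
Qed.

(** With the weights [bin(m,k) p^(m-k) (1-p)^k] a subexponential sequence has all but an
    exponentially small part of its mass at [m] within [r k] of [k / (1 - p)]. *)
Lemma concentration a p r : 0 < p < 1 -> 0 < r -> growth_upper a ->
  exists lam K, 0 < lam < 1 /\ 0 <= K /\ forall k n,
    Rsum (fun m => far (1 - p) r k m * (bin m k * p ^ (m - k) * Rabs (a m))) n * (1 - p) ^ k <= K * lam ^ k.
Proof.
intros Hp Hr Ha.
destruct (tail_side a p r 1 Hp Hr Ha ltac:(auto)) as (l1 & K1 & Hl1 & HK1 & H1).
destruct (tail_side a p r (-1) Hp Hr Ha ltac:(auto)) as (l2 & K2 & Hl2 & HK2 & H2).
exists (Rmax l1 l2), (K1 + K2).
assert (Rmax l1 l2 < 1) by (apply Rmax_lub_lt; lra).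
assert (l1 <= Rmax l1 l2) by apply Rmax_l. assert (l2 <= Rmax l1 l2) by apply Rmax_r.
split; [lra|]. split; [lra|]. intros k n. specialize (H1 k n). specialize (H2 k n).
assert (A1 : l1 ^ k <= Rmax l1 l2 ^ k) by (apply pow_incr; lra).
assert (A2 : l2 ^ k <= Rmax l1 l2 ^ k) by (apply pow_incr; lra).
assert (A1' : K1 * l1 ^ k <= K1 * Rmax l1 l2 ^ k) by (apply Rmult_le_compat_l; auto).
assert (A2' : K2 * l2 ^ k <= K2 * Rmax l1 l2 ^ k) by (apply Rmult_le_compat_l; auto).
rewrite Rmult_plus_distr_r. eapply Rle_trans; [|apply Rplus_le_compat; [eapply Rle_trans; [apply H1|apply A1']|eapply Rle_trans; [apply H2|apply A2']]].
rewrite <- Rmult_plus_distr_r. apply Rmult_le_compat_r; [apply pow_le; lra|].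
rewrite <- Rsum_plus. apply Rsum_le. intros m _. rewrite <- Rmult_plus_distr_r.
apply Rmult_le_compat_r.
- apply Rmult_le_pos; [|apply Rabs_pos]. apply Rmult_le_pos; [apply bin_pos|apply pow_le; lra].
- unfold far. destruct (Rle_dec (r * INR k) (Rabs _)) as [h|h];
  destruct (Rle_dec (r * INR k) (1 * _)) as [h1|h1]; destruct (Rle_dec (r * INR k) (-1 * _)) as [h2|h2]; try lra.
  exfalso. unfold Rabs in h. destruct Rcase_abs; lra.
Qed.

Lemma argmax (u : nat -> R) n : exists k, (k <= n)%nat /\ forall j, (j <= n)%nat -> u j <= u k.
Proof.
induction n.
- exists 0%nat. split; auto. intros j Hj. replace j with 0%nat by lia. lra.
- destruct IHn as (k & Hk & H). destruct (Rle_lt_dec (u (S n)) (u k)) as [h|h].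
  + exists k. split; [lia|]. intros j Hj. destruct (Nat.eq_dec j (S n)) as [->|]; [auto|apply H; lia].
  + exists (S n). split; [lia|]. intros j Hj. destruct (Nat.eq_dec j (S n)) as [->|]; [lra|].
    specialize (H j ltac:(lia)). lra.
Qed.

Lemma bin_ratio m k : bin m (S k) * (INR k + 1) = bin m k * (INR m - INR k).
Proof.
revert k; induction m; intros k.
- destruct k; simpl; lra.
- change (bin (S m) (S k)) with (bin m k + bin m (S k)). destruct k as [|k].
  + specialize (IHm 0%nat). rewrite S_INR. change (INR 0) with 0 in *.
    rewrite !bin_0 in *. lra.
  + assert (A := IHm k). assert (B := IHm (S k)).
    change (bin (S m) (S k)) with (bin m k + bin m (S k)). rewrite !S_INR in *. nra.
Qed.

Lemma bin_self m : bin m m = 1.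
Proof. induction m; simpl; [reflexivity|]. rewrite IHm, bin_gt by lia. lra. Qed.

Lemma bin_pos_strict m k : (k <= m)%nat -> 0 < bin m k.
Proof.
revert k; induction m; intros [|k] H; simpl; try lra; try lia.
specialize (IHm k ltac:(lia)). assert (A := bin_pos m (S k)). lra.
Qed.

(** For fixed [m] the numbers [bin(m,k) p^(m-k) (1-p)^k] sum to 1 over the [m + 1] values
    of [k]; the largest of them is at least the mean and is attained within 1 of [m (1 - p)]. *)
Lemma mode p m : 0 < p < 1 -> exists k, (k <= m)%nat /\
  1 <= (INR m + 1) * (bin m k * p ^ (m - k) * (1 - p) ^ k) /\ Rabs (INR m - INR k / (1 - p)) <= / (1 - p).
Proof.
intros Hp. set (q := 1 - p). assert (Hq : 0 < q < 1) by (unfold q; lra).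
destruct (argmax (fun k => bin m k * p ^ (m - k) * q ^ k) m) as (k & Hk & H).
exists k. split; [auto|]. split.
- assert (E := binomial_R p q m). replace (p + q) with 1 in E by (unfold q; ring). rewrite pow1 in E.
  eapply Rle_trans; [right; exact E|]. rewrite <- S_INR, <- Rsum_const. apply Rsum_le. intros j Hj. apply H; lia.
- assert (Hlo : INR m * q - p <= INR k).
  { destruct (Nat.eq_dec k m) as [->|hkm]; [assert (A := pos_INR m); nra|].
    specialize (H (S k) ltac:(lia)). simpl in H.
    replace (m - k)%nat with (S (m - S k)) in H by lia. simpl in H.
    assert (A := bin_ratio m k).
    assert (B := bin_pos_strict m k Hk).
    assert (P1 : 0 < p ^ (m - S k)) by (apply pow_lt; lra). assert (P2 : 0 < q ^ k) by (apply pow_lt; lra).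
    assert (H' : bin m (S k) * q <= bin m k * p).
    { apply Rmult_le_reg_r with (p ^ (m - S k) * q ^ k); [nra|]. nra. }
    assert (Hk0 := pos_INR k).
    assert ((bin m (S k) * (INR k + 1)) * q <= bin m k * p * (INR k + 1)) by nra.
    rewrite A in H0.
    assert ((INR m - INR k) * q <= p * (INR k + 1)) by nra. unfold q in *. nra. }
  assert (Hhi : INR k <= (INR m + 1) * q).
  { destruct k as [|k]; [simpl; assert (A := pos_INR m); nra|].
    specialize (H k ltac:(lia)). simpl in H.
    replace (m - k)%nat with (S (m - S k)) in H by lia. simpl in H.
    assert (A := bin_ratio m k).
    assert (B := bin_pos_strict m k ltac:(lia)).
    assert (P1 : 0 < p ^ (m - S k)) by (apply pow_lt; lra). assert (P2 : 0 < q ^ k) by (apply pow_lt; lra).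
    assert (H' : bin m k * p <= bin m (S k) * q).
    { apply Rmult_le_reg_r with (p ^ (m - S k) * q ^ k); [nra|]. nra. }
    assert (Hk0 := pos_INR k).
    assert (bin m k * p * (INR k + 1) <= (bin m (S k) * (INR k + 1)) * q) by nra.
    rewrite A in H0.
    assert (p * (INR k + 1) <= (INR m - INR k) * q) by nra. rewrite S_INR. unfold q in *. nra. }
  assert (E : INR m - INR k / q = (INR m * q - INR k) * / q) by (field; lra).
  rewrite E, Rabs_mult, (Rabs_pos_eq (/ q)) by (left; apply Rinv_0_lt_compat; lra).
  rewrite <- (Rmult_1_l (/ q)) at 2. apply Rmult_le_compat_r; [left; apply Rinv_0_lt_compat; lra|].
  apply Rabs_le. nra.
Qed.

(** * Multipliers coherent with the signs of the coefficients *)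

Lemma growth_upper_of_radius a : CV_radius a = Finite 1 -> growth_upper a.
Proof.
intros HR eps He. assert (H := CV_radius_bounded a). rewrite HR in H. destruct H as [_ Hlub].
assert (Hs : exp (- eps) < 1) by (rewrite <- exp_0; apply exp_increasing; lra).
assert (Hex : exists r, exp (- eps) < r /\ exists M, forall n, Rabs (a n * r ^ n) <= M).
{ apply NNPP. intros Hno. assert (A : Rbar_le (Finite 1) (Finite (exp (- eps)))).
  - apply Hlub. intros r [M HM]. simpl. apply Rnot_lt_le. intros h. apply Hno. exists r; eauto.
  - simpl in A. lra. }
destruct Hex as (r & Hr & M & HM). exists M. assert (Hp := exp_pos (- eps)).
assert (HM0 : 0 <= M) by (eapply Rle_trans; [apply Rabs_pos|apply (HM 0%nat)]).
split; [auto|]. intros m. specialize (HM m). rewrite Rabs_mult, (Rabs_pos_eq (r ^ m)) in HM by (apply pow_le; lra).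
assert (A : Rabs (a m) * exp (- eps) ^ m <= M).
{ eapply Rle_trans; [|apply HM]. apply Rmult_le_compat_l; [apply Rabs_pos|]. apply pow_incr; lra. }
rewrite exp_INR. replace (Rabs (a m)) with (Rabs (a m) * exp (- eps) ^ m * exp eps ^ m).
- apply Rmult_le_compat_r; [apply pow_le; left; apply exp_pos|auto].
- rewrite Rmult_assoc, <- Rpow_mult_distr, <- exp_plus, Rplus_opp_l, exp_0, pow1. ring.
Qed.

Lemma support_infinite a : CV_radius a = Finite 1 -> forall N, exists m, (N <= m)%nat /\ a m <> 0.
Proof.
intros HR N. apply NNPP. intros Hno. assert (H := CV_radius_bounded a). rewrite HR in H.
destruct H as [Hub _]. assert (A : Rbar_le (Finite 2) (Finite 1)).
- apply Hub. exists (Rsum (fun n => Rabs (a n * 2 ^ n)) N). intros n.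
  destruct (le_lt_dec N n) as [h|h].
  + assert (E : a n = 0) by (apply NNPP; intros h'; apply Hno; eauto).
    rewrite E, Rmult_0_l, Rabs_R0. apply Rsum_pos. intros; apply Rabs_pos.
  + apply (Rsum_term_le (fun n => Rabs (a n * 2 ^ n))); [intros; apply Rabs_pos|auto].
- simpl in A. lra.
Qed.

(** The root limit controls [|a_m|] from below on the support only, which is all that
    growth_lower asks. *)
Lemma growth_lower_of_root_limit a : root_limit_one_on_support a -> growth_lower a.
Proof.
intros H eps He.
assert (Hs : exp (- eps) < 1) by (rewrite <- exp_0; apply exp_increasing; lra).
assert (Hl : locally 1 (fun y => exp (- eps) < y)).
{ apply open_gt; auto. }
specialize (H _ Hl). unfold filtermap, within in H. destruct H as [N HN].
exists (S N). intros m Hm Hne. specialize (HN m ltac:(lia) Hne).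
assert (Hm0 : 0 < INR m) by (apply lt_0_INR; lia).
assert (Ha : 0 < Rabs (a m)) by (apply Rabs_pos_lt; auto).
unfold Rpower in HN. apply exp_lt_inv in HN.
left. rewrite <- (exp_ln (Rabs (a m))) by auto. apply exp_increasing.
apply Rmult_lt_reg_l with (/ INR m); [apply Rinv_0_lt_compat; auto|].
replace (/ INR m * (- eps * INR m)) with (- eps) by (field; lra). auto.
Qed.

(** Exponential sums with frequencies in [[-T, T]] and coefficient norm at most 1. *)
Definition bandlimited (T : R) (Psi : nat -> R) : Prop :=
  exists (n : nat) (c : nat -> C) (phi : nat -> R),
    Rsum (fun i => Cmod (c i)) n <= 1 /\ (forall i, (i < n)%nat -> Rabs (phi i) <= T) /\
    forall m, RtoC (Psi m) = Csum (fun i => c i * cis (phi i * INR m))%C n.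

(** Multiplying [a_m] by [e^(i phi m)] rotates the point of expansion, so a bandlimited
    multiplier averages Taylor coefficients taken at points of the arc. *)
Lemma bandlimited_series a p M T Psi k : 0 < p < 1 -> 0 <= M ->
  (forall th, Rabs th <= T -> taylor_bounded a p M th) -> bandlimited T Psi ->
  exists s, Cser (fun m => RtoC (a m * (bin m k * p ^ (m - k)) * Psi m)) s /\ Cmod s * (2 * (1 - p)) ^ k <= M.
Proof.
intros Hp HM Htb (n & c & phi & Hc & Hphi & HPsi).
assert (H : exists s, Cser (fun m => RtoC (a m * (bin m k * p ^ (m - k))) * Csum (fun i => c i * cis (phi i * INR m)) n)%C s
   /\ Cmod s * (2 * (1 - p)) ^ k <= Rsum (fun i => Cmod (c i)) n * M).
{ clear HPsi Hc. induction n.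
  - exists (RtoC 0). split.
    + apply (Cser_ext (fun _ => RtoC 0)); [intros; simpl; ring|]. apply (Cser_finite (fun _ => RtoC 0) 0); auto.
    + rewrite Cmod_0. simpl. lra.
  - destruct IHn as (s1 & Hs1 & Hb1); [intros; apply Hphi; lia|].
    destruct (Htb (phi n) (Hphi n ltac:(lia)) k) as (s2 & Hs2 & Hb2).
    exists (s1 + (c n * cis (phi n * INR k)) * s2)%C. split.
    + eapply Cser_ext; [|apply Cser_plus; [apply Hs1|apply Cser_scal, Hs2]].
      intros m. simpl Csum. rewrite Cmult_plus_distr_l. f_equal.
      destruct (le_lt_dec k m) as [h|h].
      * rewrite Cpow_mult_l, cis_pow, !RtoC_mult, RtoC_pow.
        replace (phi n * INR m) with (phi n * INR k + INR (m - k) * phi n) by (rewrite minus_INR by auto; ring).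
        rewrite cis_plus. ring.
      * rewrite (bin_gt m k) by auto. rewrite !RtoC_mult. ring.
    + eapply Rle_trans; [apply Rmult_le_compat_r; [apply pow_le; lra|apply Cmod_triangle]|].
      rewrite !Cmod_mult, Cmod_cis, Rmult_1_r. simpl Rsum.
      assert (A := Cmod_ge_0 (c n)).
      assert (B : Cmod (c n) * (Cmod s2 * (2 * (1 - p)) ^ k) <= Cmod (c n) * M) by (apply Rmult_le_compat_l; auto).
      nra. }
destruct H as (s & Hs & Hb). exists s. split.
- eapply Cser_ext; [|apply Hs]. intros m. simpl. rewrite <- HPsi, <- RtoC_mult. reflexivity.
- eapply Rle_trans; [apply Hb|]. nra.
Qed.

(** Choose [k] so that [m0] is the most likely index (mode).  In
    [sum_m a_m bin(m,k) p^(m-k) Psi(m)] all terms near [m0] have one sign, so the term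
    [m0] is at most the modulus of the sum, which is [O((2 q)^(-k))] by
    bandlimited_series, plus the far terms, which concentration makes small. *)
Lemma multiplier_bound a p M T : 0 < p < 1 -> 0 <= M -> growth_upper a -> growth_lower a ->
  (forall th, Rabs th <= T -> taylor_bounded a p M th) ->
  exists eta, 0 < eta /\ forall r, 0 < r -> exists c K m1, 0 < c /\ 0 < K /\
    forall m0, (m1 <= m0)%nat -> a m0 <> 0 ->
    forall Psi Bd sg, bandlimited T Psi -> (forall m, Rabs (Psi m) <= Bd) -> (sg = 1 \/ sg = -1) ->
    (forall m, Rabs (INR m - INR m0) <= r * INR m0 -> 0 <= sg * (a m * Psi m)) ->
    Rabs (Psi m0) <= K * (exp (- eta * INR m0) + Bd * exp (- c * INR m0)).
Proof.
intros Hp HM Hup Hlow Htb. set (q := 1 - p). assert (Hq : 0 < q < 1) by (unfold q; lra).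
assert (Hln2 : 0 < ln 2) by (rewrite <- ln_1; apply ln_increasing; lra).
exists (q * ln 2 / 2). split; [apply Rdiv_lt_0_compat; [apply Rmult_lt_0_compat|]; lra|].
intros r Hr.
destruct (concentration a p (r / 2) Hp ltac:(lra) Hup) as (lam & K & Hlam & HK & Hconc).
assert (Hlnl : ln lam < 0) by (rewrite <- ln_1; apply ln_increasing; lra).
set (c := - (q * ln lam / 2)). assert (Hc : 0 < c) by (unfold c; nra).
set (eta := q * ln 2 / 2) in *. assert (Heta : 0 < eta) by (unfold eta; nra).
set (eps := Rmin eta c / 2).
assert (Heps : 0 < eps) by (unfold eps; assert (0 < Rmin eta c) by (apply Rmin_glb_lt; auto); lra).
assert (He1 : 2 * eps <= eta) by (unfold eps; assert (Rmin eta c <= eta) by apply Rmin_l; lra).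
assert (He2 : 2 * eps <= c) by (unfold eps; assert (Rmin eta c <= c) by apply Rmin_r; lra).
destruct (Hlow eps Heps) as [N1 HN1]. destruct (exp_dominates 1 eps Heps) as [N2 HN2].
destruct (INR_unbounded (2 / (q * r))) as [N3 HN3].
exists c, (2 * M + K / lam + 1), (N1 + N2 + N3)%nat.
assert (HKl : 0 <= K / lam) by (apply Rle_div_r; lra).
split; [auto|]. split; [lra|].
intros m0 Hm0 Hne Psi Bd sg HPsi HBd Hsg Hsign.
destruct (mode p m0 Hp) as (k & Hk & Hmode & Hkq). fold q in Hmode, Hkq.
assert (HBd0 : 0 <= Bd) by (eapply Rle_trans; [apply Rabs_pos|apply (HBd 0%nat)]).
destruct (bandlimited_series a p M T Psi k Hp HM Htb HPsi) as (s & Hs & Hsb). fold q in Hsb.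
set (w := fun m => bin m k * p ^ (m - k)).
assert (Hw : forall m, 0 <= w m) by (intros m; apply Rmult_le_pos; [apply bin_pos|apply pow_le; lra]).
set (X := w m0 * Rabs (a m0 * Psi m0)).
assert (Hm3 : 2 / (q * r) <= INR m0) by (apply Rle_trans with (INR N3); [lra|apply le_INR; lia]).
assert (Hiq : / q <= r / 2 * INR m0).
{ apply Rle_div_l in Hm3; [|nra]. apply Rmult_le_reg_r with q; [lra|]. rewrite Rinv_l by lra. nra. }
assert (Hkm : INR k <= INR m0) by (apply le_INR; auto).
(* termwise lower bound: nonnegative near [m0], at least [X] at [m0], and at worst
   [- Bd] times the weighted coefficient far from it *)
assert (Hterm : forall m, (if Nat.eq_dec m m0 then X else 0) - Bd * (far q (r / 2) k m * (w m * Rabs (a m)))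
    <= sg * (a m * w m * Psi m)).
{ intros m. assert (Hfar : 0 <= far q (r/2) k m <= 1) by (unfold far; destruct Rle_dec; lra).
  assert (H0 : 0 <= w m * Rabs (a m)) by (apply Rmult_le_pos; [auto|apply Rabs_pos]).
  assert (Habs : - (w m * Rabs (a m) * Bd) <= sg * (a m * w m * Psi m)).
  { assert (Rabs (sg * (a m * w m * Psi m)) <= w m * Rabs (a m) * Bd).
    - replace (sg * (a m * w m * Psi m)) with (sg * (w m * (a m * Psi m))) by ring.
      rewrite !Rabs_mult. replace (Rabs sg) with 1 by (destruct Hsg as [->| ->]; [rewrite Rabs_R1|rewrite Rabs_left]; lra).
      rewrite (Rabs_pos_eq (w m)) by auto. rewrite Rmult_1_l, Rmult_assoc.
      apply Rmult_le_compat_l; [auto|]. apply Rmult_le_compat_l; [apply Rabs_pos|auto].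
    - apply Rabs_le_between in H. lra. }
  assert (Hnear : Rabs (INR m - INR m0) <= r * INR m0 -> 0 <= sg * (a m * w m * Psi m)).
  { intros h. replace (sg * (a m * w m * Psi m)) with (w m * (sg * (a m * Psi m))) by ring.
    apply Rmult_le_pos; auto. }
  destruct (Nat.eq_dec m m0) as [->|hne].
  - assert (E : sg * (a m0 * w m0 * Psi m0) = X).
    { unfold X. assert (A : 0 <= sg * (a m0 * Psi m0)).
      { apply Hsign. rewrite Rminus_diag, Rabs_R0. apply Rmult_le_pos; [lra|apply pos_INR]. }
      unfold Rabs. destruct Rcase_abs; destruct Hsg as [->| ->]; try lra;
      (assert (Z : a m0 * Psi m0 = 0) by lra; replace (a m0 * w m0 * Psi m0) with (w m0 * (a m0 * Psi m0)) by ring; rewrite Z; ring) || ring. }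
    rewrite E. assert (0 <= Bd * (far q (r / 2) k m0 * (w m0 * Rabs (a m0)))) by (apply Rmult_le_pos; [auto|apply Rmult_le_pos; [apply Hfar|auto]]). lra.
  - unfold far in *. destruct (Rle_dec _ _) as [h|h].
    + nra.
    + rewrite Rmult_0_l, Rmult_0_r, Rminus_0_r. apply Hnear.
      apply Rnot_le_lt in h.
      replace (INR m - INR m0) with ((INR m - INR k / q) - (INR m0 - INR k / q)) by ring.
      eapply Rle_trans; [apply Rabs_triang|]. rewrite Rabs_Ropp. nra. }
assert (Hqk : 0 < q ^ k) by (apply pow_lt; lra).
assert (HX : X <= Cmod s + Bd * (K * lam ^ k / q ^ k)).
{ apply Rnot_lt_le. intros Hlt.
  destruct (Hs (X - (Cmod s + Bd * (K * lam ^ k / q ^ k)))) as [N HN]; [lra|].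
  specialize (HN (N + S m0)%nat ltac:(lia)).
  rewrite (Csum_RtoC (fun m => a m * (bin m k * p ^ (m - k)) * Psi m)) in HN.
  set (Sn := Rsum (fun m => a m * (bin m k * p ^ (m - k)) * Psi m) (N + S m0)) in *.
  assert (A : X - Bd * (K * lam ^ k / q ^ k) <= sg * Sn).
  { unfold Sn. rewrite <- Rsum_scal.
    eapply Rle_trans; [|apply Rsum_le; intros i _; apply Hterm].
    unfold Rminus. rewrite (Rsum_plus (fun m => if Nat.eq_dec m m0 then X else 0) (fun m => - (Bd * (far q (r / 2) k m * (w m * Rabs (a m)))))).
    apply Rplus_le_compat.
    - assert (HX0 : 0 <= X) by (apply Rmult_le_pos; [auto|apply Rabs_pos]).
      eapply Rle_trans; [|apply (Rsum_term_le _ (N + S m0) m0); [|lia]].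
      + cbv beta. destruct (Nat.eq_dec m0 m0); [lra|contradiction].
      + intros j. cbv beta. destruct (Nat.eq_dec j m0); lra.
    - rewrite (Rsum_ext _ (fun m => (- Bd) * (far q (r / 2) k m * (w m * Rabs (a m))))) by (intros; ring).
      rewrite Rsum_scal. assert (B := Hconc k (N + S m0)%nat). fold q in B. apply Rle_div_r in B; [|auto].
      rewrite <- Ropp_mult_distr_l. apply Ropp_le_contravar, Rmult_le_compat_l; auto. }
  assert (B : Rabs Sn <= Cmod (RtoC Sn - s)%C + Cmod s).
  { rewrite <- (Cmod_R Sn). replace (RtoC Sn) with ((RtoC Sn - s) + s)%C at 1 by ring. apply Cmod_triangle. }
  assert (sg * Sn <= Rabs Sn) by (destruct Hsg as [->| ->]; unfold Rabs; destruct Rcase_abs; lra).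
  lra. }
assert (Hx1 : X * q ^ k <= M * (/ 2) ^ k + Bd * (K * lam ^ k)).
{ apply Rle_trans with ((Cmod s + Bd * (K * lam ^ k / q ^ k)) * q ^ k); [apply Rmult_le_compat_r; lra|].
  rewrite Rmult_plus_distr_r. apply Rplus_le_compat.
  - rewrite Rpow_mult_distr in Hsb. rewrite pow_inv.
    assert (0 < 2 ^ k) by (apply pow_lt; lra).
    apply Rmult_le_reg_r with (2 ^ k); [auto|]. field_simplify; [|lra]. nra.
  - right. field. lra. }
assert (Hkl : q * INR m0 - 1 <= INR k).
{ assert (E : INR m0 - INR k / q = (q * INR m0 - INR k) * / q) by (field; lra).
  apply Rabs_le_between in Hkq. rewrite E in Hkq.
  assert (0 < / q) by (apply Rinv_0_lt_compat; lra). nra. }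
assert (H2k : (/ 2) ^ k <= 2 * exp (- (2 * eta) * INR m0)).
{ replace (/2) with (exp (- ln 2)) by (rewrite exp_Ropp, exp_ln; lra).
  rewrite <- exp_INR. replace 2 with (exp (ln 2)) at 2 by (apply exp_ln; lra).
  rewrite <- exp_plus. apply exp_le. unfold eta. nra. }
assert (Hlk : lam ^ k <= / lam * exp (- (2 * c) * INR m0)).
{ replace lam with (exp (ln lam)) at 1 2 by (apply exp_ln; lra).
  rewrite <- exp_Ropp, <- exp_INR, <- exp_plus. apply exp_le. unfold c. nra. }
assert (Hap : exp (- eps * INR m0) <= Rabs (a m0)) by (apply HN1; [lia|auto]).
assert (Hm : INR m0 + 1 <= exp (eps * INR m0)) by (specialize (HN2 m0 ltac:(lia)); lra).
assert (Hfin : Rabs (a m0) * Rabs (Psi m0) <= (INR m0 + 1) * (X * q ^ k)).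
{ rewrite <- Rabs_mult. unfold X. fold (w m0) in Hmode.
  assert (A := Rabs_pos (a m0 * Psi m0)). nra. }
assert (E1 : exp (- eps * INR m0) * exp (eps * INR m0) = 1).
{ rewrite <- exp_plus. replace (- eps * INR m0 + eps * INR m0) with 0 by ring. apply exp_0. }
assert (HP0 := Rabs_pos (Psi m0)). assert (Hm00 := pos_INR m0).
set (Y := M * (2 * exp (- (2 * eta) * INR m0)) + Bd * (K * (/ lam * exp (- (2 * c) * INR m0)))).
assert (HY : X * q ^ k <= Y).
{ eapply Rle_trans; [apply Hx1|]. unfold Y. apply Rplus_le_compat; [apply Rmult_le_compat_l; auto|].
  apply Rmult_le_compat_l; [auto|]. apply Rmult_le_compat_l; auto. }
assert (HX0 : 0 <= X * q ^ k) by (apply Rmult_le_pos; [apply Rmult_le_pos; [auto|apply Rabs_pos]|lra]).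
assert (Hexp0 := exp_pos (eps * INR m0)).
assert (HPs : Rabs (Psi m0) <= exp (eps * INR m0) * (exp (eps * INR m0) * Y)).
{ apply Rle_trans with (exp (eps * INR m0) * (Rabs (a m0) * Rabs (Psi m0))).
  - replace (Rabs (Psi m0)) with (exp (eps * INR m0) * (exp (- eps * INR m0) * Rabs (Psi m0))) at 1
      by (rewrite <- Rmult_assoc, (Rmult_comm (exp (eps * _))), E1; ring).
    apply Rmult_le_compat_l; [lra|]. apply Rmult_le_compat_r; auto.
  - apply Rmult_le_compat_l; [lra|]. eapply Rle_trans; [apply Hfin|].
    apply Rmult_le_compat; lra. }
eapply Rle_trans; [apply HPs|].
assert (Ea : exp (eps * INR m0) * (exp (eps * INR m0) * exp (- (2 * eta) * INR m0)) <= exp (- eta * INR m0)).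
{ rewrite <- !exp_plus. apply exp_le. nra. }
assert (Eb : exp (eps * INR m0) * (exp (eps * INR m0) * exp (- (2 * c) * INR m0)) <= exp (- c * INR m0)).
{ rewrite <- !exp_plus. apply exp_le. nra. }
set (ea := exp (- eta * INR m0)) in *. set (eb := exp (- c * INR m0)) in *.
assert (0 < ea) by apply exp_pos. assert (0 < eb) by apply exp_pos.
replace (exp (eps * INR m0) * (exp (eps * INR m0) * Y)) with
  (2 * M * (exp (eps * INR m0) * (exp (eps * INR m0) * exp (- (2 * eta) * INR m0))) +
   K / lam * (Bd * (exp (eps * INR m0) * (exp (eps * INR m0) * exp (- (2 * c) * INR m0))))).
2:{ unfold Y. field. lra. }
assert (B1 : 2 * M * (exp (eps * INR m0) * (exp (eps * INR m0) * exp (- (2 * eta) * INR m0))) <= 2 * M * ea)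
  by (apply Rmult_le_compat_l; lra).
assert (B2 : K / lam * (Bd * (exp (eps * INR m0) * (exp (eps * INR m0) * exp (- (2 * c) * INR m0)))) <= K / lam * (Bd * eb)).
{ apply Rmult_le_compat_l; [auto|]. apply Rmult_le_compat_l; auto. }
assert (0 <= Bd * eb) by (apply Rmult_le_pos; lra).
assert (0 <= K / lam * ea) by (apply Rmult_le_pos; lra).
assert (0 <= 2 * M * (Bd * eb)) by (apply Rmult_le_pos; lra).
rewrite Rmult_plus_distr_l, !Rmult_plus_distr_r. lra.
Qed.

(** A multiplier that agrees in sign with [a] near a support point [m0] cannot have its
    value at [m0] both comparable with its maximum and larger than [exp(- eta m0)].  The
    rate [eta] does not depend on the radius [r] of the neighbourhood of agreement. *)
Lemma no_coherent_multiplier a p M T : 0 < p < 1 -> 0 <= M -> growth_upper a -> growth_lower a ->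
  (forall th, Rabs th <= T -> taylor_bounded a p M th) ->
  exists eta, 0 < eta /\ forall r, 0 < r -> exists c m1, 0 < c /\
    forall m0, (m1 <= m0)%nat -> a m0 <> 0 ->
    forall Psi Bd sg, bandlimited T Psi -> (forall m, Rabs (Psi m) <= Bd) -> (sg = 1 \/ sg = -1) ->
    (forall m, Rabs (INR m - INR m0) <= r * INR m0 -> 0 <= sg * (a m * Psi m)) ->
    exp (- eta * INR m0) <= Rabs (Psi m0) -> Bd <= Rabs (Psi m0) * exp (c * INR m0) -> False.
Proof.
intros Hp HM Hup Hlow Htb.
destruct (multiplier_bound a p M T Hp HM Hup Hlow Htb) as (eta & Heta & Hcore).
exists (eta / 2). split; [lra|]. intros r Hr.
destruct (Hcore r Hr) as (c & K & m1 & Hc & HK & Hcore').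
destruct (exp_dominates K (eta / 2) ltac:(lra)) as [N2 HN2].
destruct (exp_dominates K (c / 2) ltac:(lra)) as [N3 HN3].
exists (c / 2), (m1 + N2 + N3 + 2)%nat. split; [lra|].
intros m0 Hm0 Hne Psi Bd sg Hband Hbd Hsg Hcoh Hlarge HBd.
assert (Hfin := Hcore' m0 ltac:(lia) Hne Psi Bd sg Hband Hbd Hsg Hcoh).
set (Z := Rabs (Psi m0)) in *.
assert (HZ : 0 < Z) by (eapply Rlt_le_trans; [apply exp_pos|exact Hlarge]).
assert (B1 : exp (- eta * INR m0) <= Z * exp (- (eta / 2) * INR m0)).
{ replace (- eta * INR m0) with (- (eta / 2) * INR m0 + - (eta / 2) * INR m0) by field. rewrite exp_plus.
  apply Rmult_le_compat_r; [left; apply exp_pos|auto]. }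
assert (B2 : Bd * exp (- c * INR m0) <= Z * exp (- (c / 2) * INR m0)).
{ apply Rle_trans with (Z * exp (c / 2 * INR m0) * exp (- c * INR m0)).
  - apply Rmult_le_compat_r; [left; apply exp_pos|auto].
  - rewrite Rmult_assoc, <- exp_plus. apply Rmult_le_compat_l; [lra|]. apply exp_le. lra. }
assert (Hthird : forall al, 0 < al -> K * (INR m0 + 1) <= exp (al * INR m0) -> K * exp (- al * INR m0) <= / 3).
{ intros al Hal H. assert (H2 : 2 <= INR m0) by (change 2 with (INR 2); apply le_INR; lia).
  assert (A := exp_pos (- al * INR m0)).
  assert (Ee : exp (al * INR m0) * exp (- al * INR m0) = 1).
  { rewrite <- exp_plus. replace (al * INR m0 + - al * INR m0) with 0 by ring. apply exp_0. }
  assert (K * (INR m0 + 1) * exp (- al * INR m0) <= 1) by (eapply Rle_trans; [|right; exact Ee]; apply Rmult_le_compat_r; lra).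
  assert (HK0 : 0 <= K * exp (- al * INR m0)) by (apply Rmult_le_pos; lra).
  assert (K * exp (- al * INR m0) * 3 <= K * exp (- al * INR m0) * (INR m0 + 1)) by (apply Rmult_le_compat_l; lra). lra. }
assert (T1 := Hthird (eta / 2) ltac:(lra) (HN2 m0 ltac:(lia))).
assert (T2 := Hthird (c / 2) ltac:(lra) (HN3 m0 ltac:(lia))).
assert (Hend : Z <= K * (Z * exp (- (eta / 2) * INR m0) + Z * exp (- (c / 2) * INR m0))).
{ eapply Rle_trans; [apply Hfin|]. apply Rmult_le_compat_l; lra. }
assert (E1 : Z * (K * exp (- (eta / 2) * INR m0)) <= Z * / 3) by (apply Rmult_le_compat_l; lra).
assert (E2 : Z * (K * exp (- (c / 2) * INR m0)) <= Z * / 3) by (apply Rmult_le_compat_l; lra).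
lra.
Qed.

(** * Regularity excludes long gaps *)

Lemma Csum_extend u n N : (n <= N)%nat -> (forall i, (n <= i)%nat -> u i = RtoC 0) -> Csum u N = Csum u n.
Proof.
intros Hn Hu. induction Hn; [reflexivity|]. simpl. rewrite IHHn, Hu by auto. ring.
Qed.

Lemma Cser_partial_le u s n0 F : Cser u s ->
  (forall N, (n0 <= N)%nat -> Cmod (Csum u N - Csum u n0)%C <= F) -> Cmod (Csum u n0) <= Cmod s + F.
Proof.
intros Hs HF. apply Rnot_lt_le. intros Hlt.
destruct (Hs (Cmod (Csum u n0) - (Cmod s + F))) as [N HN]; [lra|].
specialize (HN (N + n0)%nat ltac:(lia)). specialize (HF (N + n0)%nat ltac:(lia)).
assert (A := Cmod_triangle (Csum u n0 - s) s). replace (Csum u n0 - s + s)%C with (Csum u n0) in A by ring.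
assert (B := Cmod_dist (Csum u n0) (Csum u (N + n0)) s). rewrite (Cmod_minus_sym (Csum u n0) (Csum u (N + n0))) in B. lra.
Qed.

Fixpoint Cprod (f : nat -> C) (n : nat) : C :=
  match n with O => RtoC 1 | S n => (Cprod f n * f n)%C end.

Lemma Cprod_le f n A : (forall j, (j < n)%nat -> Cmod (f j) <= A) -> Cmod (Cprod f n) <= A ^ n.
Proof.
induction n; intros H; simpl; [rewrite Cmod_1; lra|].
rewrite Cmod_mult, Rmult_comm. apply Rmult_le_compat; try apply Cmod_ge_0; [apply H; lia|].
apply IHn. intros; apply H; lia.
Qed.

Lemma Cprod_le_one f n A A0 j0 : (forall j, (j < n)%nat -> Cmod (f j) <= A) -> (j0 < n)%nat ->
  Cmod (f j0) <= A0 -> Cmod (Cprod f n) * A <= A0 * A ^ n.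
Proof.
induction n; intros H Hj H0; [lia|]. simpl. rewrite Cmod_mult.
assert (HA : 0 <= A) by (eapply Rle_trans; [apply Cmod_ge_0|apply (H n); lia]).
assert (HA0 : 0 <= A0) by (eapply Rle_trans; [apply Cmod_ge_0|apply H0]).
destruct (Nat.eq_dec j0 n) as [->|hne].
- assert (B := Cprod_le f n A ltac:(intros; apply H; lia)).
  replace (A0 * (A * A ^ n)) with (A ^ n * A0 * A) by ring.
  apply Rmult_le_compat_r; [auto|]. apply Rmult_le_compat; auto; apply Cmod_ge_0.
- assert (B := IHn ltac:(intros; apply H; lia) ltac:(lia) H0).
  assert (Hn := H n ltac:(lia)).
  replace (Cmod (Cprod f n) * Cmod (f n) * A) with ((Cmod (Cprod f n) * A) * Cmod (f n)) by ring.
  replace (A0 * (A * A ^ n)) with ((A0 * A ^ n) * A) by ring.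
  apply Rmult_le_compat; auto; [|apply Cmod_ge_0]. apply Rmult_le_pos; [apply Cmod_ge_0|auto].
Qed.

Definition psum (a : nat -> R) (n : nat) (z : C) : C := Csum (fun m => a m * z ^ m)%C (S n).

Lemma psum_rot_poly a n u : Cmod u = 1 -> exists lc B, Cmod lc = Rabs (a n) /\
  ispoly (fun z => psum a n (z * u)) n lc B.
Proof.
intros Hu. exists (a n * u ^ n)%C, (Rsum (fun i => Cmod (a i * u ^ i)%C) (S n)). split.
- rewrite Cmod_mult, Cmod_pow, Hu, pow1, Rmult_1_r, Cmod_R. reflexivity.
- exists (fun i => a i * u ^ i)%C. repeat split; [|lra].
  intros z. apply Csum_ext. intros i _. rewrite Cpow_mult_l. ring.
Qed.

Lemma rot_prod_poly a n (u : nat -> C) J : (forall j, Cmod (u j) = 1) -> exists lc B,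
  Cmod lc = Rabs (a n) ^ J /\ ispoly (fun z => Cprod (fun j => psum a n (z * u j)) J) (J * n) lc B.
Proof.
intros Hu. induction J as [|J (lc & B & H1 & H2)].
- exists (RtoC 1), (Cmod 1). split; [apply Cmod_1|]. exact (ispoly_const 1).
- destruct (psum_rot_poly a n (u J) (Hu J)) as (lc' & B' & H1' & H2').
  exists (lc * lc')%C, (B * B'). split.
  + rewrite Cmod_mult, H1, H1'. simpl. ring.
  + replace (S J * n)%nat with (J * n + n)%nat by lia. simpl Cprod. apply ispoly_mult; auto.
Qed.

(** The rotations are by multiples of the [Q]-th part of the circle, so some
    multiple moves any point to within [2 pi / Q] of 1. *)
Lemma rotate_into_arc (N Q t : nat) d : 0 < d -> (0 < Q)%nat -> 2 * PI / INR Q <= d -> (t < N)%nat ->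
  exists j th, (j < S Q)%nat /\ Rabs th <= d /\
    (cis (2 * PI * INR t / INR N) * cis (2 * PI * INR j / INR Q))%C = cis th.
Proof.
intros Hd HQ HQd Ht. set (j := (Q * (N - t) / N)%nat).
assert (Hj : (j <= Q)%nat). { unfold j. apply Nat.Div0.div_le_upper_bound. nia. }
assert (E := Nat.div_mod_eq (Q * (N - t)) N). fold j in E.
assert (Hmod := Nat.mod_upper_bound (Q * (N - t)) N ltac:(lia)).
set (e := ((Q * (N - t)) mod N)%nat) in *.
assert (HNp : 0 < INR N) by (apply lt_0_INR; lia). assert (HQp : 0 < INR Q) by (apply lt_0_INR; lia).
assert (HeN : 0 <= INR e < INR N) by (split; [apply pos_INR|apply lt_INR; lia]).
assert (ER : INR Q * (INR N - INR t) = INR N * INR j + INR e).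
{ rewrite <- minus_INR, <- !mult_INR, <- plus_INR by lia. f_equal. exact E. }
exists j, (- (2 * PI * (INR e / INR N) / INR Q)). split; [lia|]. split.
- rewrite Rabs_Ropp. assert (HP := PI_RGT_0).
  assert (Hf : 0 <= INR e / INR N < 1) by (split; [apply Rle_div_r; lra|apply Rlt_div_l; lra]).
  rewrite Rabs_pos_eq.
  + eapply Rle_trans; [|apply HQd]. apply Rmult_le_compat_r; [left; apply Rinv_0_lt_compat; auto|]. nra.
  + apply Rle_div_r; [auto|]. rewrite Rmult_0_l. apply Rmult_le_pos; lra.
- rewrite <- cis_plus.
  replace (2 * PI * INR t / INR N + 2 * PI * INR j / INR Q) with
    (- (2 * PI * (INR e / INR N) / INR Q) + 2 * PI * INR 1).
  + rewrite cis_plus, cis_2PI. ring.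
  + assert (Ej : INR j = (INR Q * (INR N - INR t) - INR e) / INR N) by (rewrite ER; field; lra).
    rewrite Ej. simpl INR. field; lra.
Qed.

(** If [a] vanished from [n] to [(1 + kap) n], the partial sum [s_n] would inherit the
    improved Taylor bounds of [f]: for each [k] either the terms up to [n] or those
    beyond the gap are far from [k / q].  Then [s_n] is subexponential on an arc of a circle of
    radius [rho > 1], whereas on the whole circle it is at most about [rho^n].  A product
    of rotated copies of [s_n] has a small factor at every point of the circle, and its
    leading coefficient, a power of [a_n], is too large for that. *)
Lemma no_gap a p M d kap : 0 < p < 1 -> 0 <= M -> 0 < d -> growth_upper a -> growth_lower a ->
  (forall th, Rabs th <= d -> taylor_bounded a p M th) -> 0 < kap ->
  exists n1, forall n, (n1 <= n)%nat -> a n <> 0 ->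
    (forall m, (n < m)%nat -> INR m <= (1 + kap) * INR n -> a m = 0) -> False.
Proof.
intros Hp HM Hd Hup Hlow Htb Hkap. set (q := 1 - p). assert (Hq : 0 < q < 1) by (unfold q; lra).
(* with this radius an index outside the gap is far from every [k / q] on the other
   side of the middle [(1 + kap / 2) n] of the gap *)
set (r := (kap / 2) / (1 + kap / 2)).
assert (Hr : 0 < r) by (apply Rdiv_lt_0_compat; lra).
assert (Hr1 : r * (1 + kap / 2) = kap / 2) by (unfold r; field; lra).
destruct (concentration a p r Hp Hr Hup) as (lam & K & Hlam & HK & Hconc). fold q in Hconc.
set (mu := Rmax (1/2) lam).
assert (Hmu : 1/2 <= mu < 1) by (unfold mu; split; [apply Rmax_l|apply Rmax_lub_lt; lra]).
assert (Hmul : lam <= mu) by apply Rmax_r.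
set (rho := p + q / mu).
assert (Hv : q < q / mu) by (apply Rlt_div_r; nra).
assert (Hrho : 1 < rho) by (unfold rho, q in *; lra).
set (l := ln rho). assert (Hl : 0 < l) by (unfold l; rewrite <- ln_1; apply ln_increasing; lra).
destruct (INR_unbounded (2 * PI / d)) as [Q0 HQ0]. set (Q := S Q0).
assert (HQp : 0 < INR Q) by (apply lt_0_INR; unfold Q; lia).
assert (HQd : 2 * PI / INR Q <= d).
{ apply Rle_div_l; [auto|]. apply Rlt_div_l in HQ0; [|auto]. unfold Q. rewrite S_INR. nra. }
set (eps := l / (2 * (3 * INR Q + 2))).
assert (Heps : 0 < eps) by (apply Rdiv_lt_0_compat; lra).
destruct (Hup eps Heps) as (C & HC & HCup).
destruct (Hlow eps Heps) as [N1 HN1].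
destruct (exp_dominates C eps Heps) as [N2 HN2].
destruct (exp_dominates (M + K) eps Heps) as [N3 HN3].
exists (N1 + N2 + N3 + 1)%nat. intros n Hn Hne Hgap.
assert (Hn0 : 0 < INR n) by (apply lt_0_INR; lia).
set (u := fun th k m => (RtoC (a m) * (bin m k * (p * cis th) ^ (m - k)))%C).
assert (Hu : forall th k m, Cmod (u th k m) = bin m k * p ^ (m - k) * Rabs (a m)).
{ intros. unfold u. rewrite !Cmod_mult, Cmod_pow, Cmod_mult, Cmod_cis, !Cmod_R, Rmult_1_r.
  rewrite (Rabs_pos_eq p) by lra. rewrite (Rabs_pos_eq (bin m k)) by apply bin_pos. ring. }
assert (Hw : forall k m, 0 <= bin m k * p ^ (m - k) * Rabs (a m)).
{ intros. apply Rmult_le_pos; [apply Rmult_le_pos; [apply bin_pos|apply pow_le; lra]|apply Rabs_pos]. }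
assert (Hfp : forall k m, 0 <= far q r k m) by (intros; unfold far; destruct Rle_dec; lra).
(* Taylor coefficients of the partial sum at [p e^(i th)] *)
assert (Hsk : forall th k, Rabs th <= d -> Cmod (Csum (u th k) (S n)) * q ^ k <= (M + K) * mu ^ k).
{ intros th k Hth.
  assert (Hqk : 0 < q ^ k) by (apply pow_lt; lra).
  assert (Hlm : K * lam ^ k <= K * mu ^ k) by (apply Rmult_le_compat_l; [auto|apply pow_incr; lra]).
  assert (Hmk : 0 <= M * mu ^ k) by (apply Rmult_le_pos; [auto|apply pow_le; lra]).
  assert (Hkq : INR k <= INR k / q).
  { apply Rle_div_r; [lra|]. assert (A := pos_INR k). nra. }
  assert (Hkq0 := pos_INR k).
  destruct (Rle_lt_dec ((1 + kap / 2) * INR n) (INR k / q)) as [h|h].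
  - apply Rle_trans with (K * lam ^ k); [|lra].
    eapply Rle_trans; [|apply (Hconc k (S n))]. apply Rmult_le_compat_r; [lra|].
    eapply Rle_trans; [apply Csum_Cmod|]. apply Rsum_le. intros m Hm. rewrite Hu.
    assert (Hmn : INR m <= INR n) by (apply le_INR; lia).
    unfold far. destruct (Rle_dec _ _) as [h'|h']; [lra|exfalso].
    apply h'. rewrite Rabs_left1 by nra.
    apply Rle_trans with (r * (INR k / q)); [apply Rmult_le_compat_l; lra|].
    apply Rmult_le_reg_l with (1 + kap / 2); [lra|].
    replace ((1 + kap / 2) * (r * (INR k / q))) with (kap / 2 * (INR k / q)) by (transitivity (r * (1 + kap / 2) * (INR k / q)); [rewrite Hr1; ring|ring]). nra.
  - destruct (Htb th Hth k) as (s & Hs & Hsb). fold q in Hsb. change (Cser (u th k) s) in Hs.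
    assert (HT : Cmod (Csum (u th k) (S n)) <= Cmod s + K * lam ^ k / q ^ k).
    { apply Cser_partial_le; [auto|]. intros N HN.
      apply Rle_trans with (Rsum (fun m => far q r k m * (bin m k * p ^ (m - k) * Rabs (a m))) N).
      2:{ apply Rle_div_r; auto. }
      induction HN.
      - replace (Csum (u th k) (S n) - Csum (u th k) (S n))%C with (RtoC 0) by ring. rewrite Cmod_0.
        apply Rsum_pos. intros; apply Rmult_le_pos; auto.
      - change (Csum (u th k) (S m)) with (Csum (u th k) m + u th k m)%C.
        replace (Csum (u th k) m + u th k m - Csum (u th k) (S n))%C
          with ((Csum (u th k) m - Csum (u th k) (S n)) + u th k m)%C by ring.
        eapply Rle_trans; [apply Cmod_triangle|].
        change (Rsum ?f (S m)) with (Rsum f m + f m). apply Rplus_le_compat; [auto|].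
        rewrite Hu. destruct (Rle_lt_dec (INR m) ((1 + kap) * INR n)) as [h1|h1].
        + rewrite (Hgap m) by (auto; lia). rewrite Rabs_R0. lra.
        + unfold far. destruct (Rle_dec _ _) as [h'|h']; [lra|exfalso].
          apply h'. rewrite Rabs_pos_eq by nra.
          apply Rle_trans with (r * (INR k / q)); [apply Rmult_le_compat_l; lra|].
          apply Rmult_le_reg_l with (1 + kap / 2); [lra|].
          replace ((1 + kap / 2) * (r * (INR k / q))) with (kap / 2 * (INR k / q)) by (transitivity (r * (1 + kap / 2) * (INR k / q)); [rewrite Hr1; ring|ring]). nra. }
    apply Rle_trans with ((Cmod s + K * lam ^ k / q ^ k) * q ^ k); [apply Rmult_le_compat_r; lra|].
    assert (B : Cmod s * q ^ k <= M * mu ^ k).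
    { rewrite Rpow_mult_distr in Hsb.
      assert (H2 : (1/2) ^ k <= mu ^ k) by (apply pow_incr; lra).
      assert (E2 : 2 ^ k * (1/2) ^ k = 1).
      { rewrite <- Rpow_mult_distr. replace (2 * (1/2)) with 1 by lra. apply pow1. }
      assert (H2p : 0 <= (1/2) ^ k) by (apply pow_le; lra).
      apply Rle_trans with (M * (1/2) ^ k); [|apply Rmult_le_compat_l; auto].
      replace (Cmod s * q ^ k) with ((Cmod s * (2 ^ k * q ^ k)) * (1/2) ^ k).
      - apply Rmult_le_compat_r; auto.
      - transitivity (Cmod s * q ^ k * (2 ^ k * (1/2) ^ k)); [ring|rewrite E2; ring]. }
    rewrite Rmult_plus_distr_r. replace (K * lam ^ k / q ^ k * q ^ k) with (K * lam ^ k) by (field; lra). lra. }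
(* [rho e^(i th)] is at distance [q / mu] from [p e^(i th)], so the powers of [mu]
   cancel *)
assert (Harc : forall th, Rabs th <= d -> Cmod (psum a n (rho * cis th)) <= exp (eps * INR n)).
{ intros th Hth. specialize (HN3 n ltac:(lia)). eapply Rle_trans; [|apply HN3].
  assert (E : psum a n (rho * cis th) = Csum (fun k => (RtoC (q / mu) * cis th) ^ k * Csum (u th k) (S n))%C (S n)).
  { unfold psum.
    rewrite (Csum_ext _ (fun m => Csum (fun k => (RtoC (q / mu) * cis th) ^ k * u th k m)%C (S n))).
    - rewrite Csum_swap. apply Csum_ext. intros k _. rewrite Csum_scal. reflexivity.
    - intros m Hm.
      replace (rho * cis th)%C with (p * cis th + RtoC (q / mu) * cis th)%C
        by (unfold rho; rewrite RtoC_plus; ring).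
      rewrite binomial_C. rewrite <- Csum_scal.
      rewrite <- (Csum_extend _ (S m) (S n)); [|lia|].
      + apply Csum_ext. intros k _. unfold u. ring.
      + intros i Hi. rewrite (bin_gt m i) by lia. ring. }
  rewrite E. eapply Rle_trans; [apply Csum_Cmod|].
  rewrite <- S_INR, (Rmult_comm (M + K)), <- Rsum_const. apply Rsum_le. intros k _.
  rewrite Cmod_mult, Cmod_pow, Cmod_mult, Cmod_cis, Cmod_R, Rmult_1_r.
  rewrite Rabs_pos_eq by lra.
  specialize (Hsk th k Hth).
  assert (Hmk : 0 < mu ^ k) by (apply pow_lt; lra).
  unfold Rdiv. rewrite Rpow_mult_distr, pow_inv.
  apply Rmult_le_reg_r with (mu ^ k); [auto|].
  replace (q ^ k * / mu ^ k * Cmod (Csum (u th k) (S n)) * mu ^ k) with (Cmod (Csum (u th k) (S n)) * q ^ k) by (field; lra).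
  auto. }
assert (Hfull : forall z, Cmod z = rho -> Cmod (psum a n z) <= exp (2 * eps * INR n) * rho ^ n).
{ intros z Hz. unfold psum. eapply Rle_trans; [apply Csum_Cmod|].
  apply Rle_trans with (INR (S n) * (C * exp (eps * INR n) * rho ^ n)).
  - rewrite <- Rsum_const. apply Rsum_le. intros m Hm. rewrite Cmod_mult, Cmod_pow, Hz, Cmod_R.
    apply Rmult_le_compat; [apply Rabs_pos|apply pow_le; lra| |apply Rle_pow; [lra|lia]].
    eapply Rle_trans; [apply HCup|]. apply Rmult_le_compat_l; [auto|]. apply exp_le.
    apply Rmult_le_compat_l; [lra|]. apply le_INR; lia.
  - specialize (HN2 n ltac:(lia)). rewrite S_INR.
    replace (2 * eps * INR n) with (eps * INR n + eps * INR n) by ring. rewrite exp_plus.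
    replace ((INR n + 1) * (C * exp (eps * INR n) * rho ^ n)) with (C * (INR n + 1) * (exp (eps * INR n) * rho ^ n)) by ring.
    rewrite (Rmult_assoc (exp (eps * INR n)) (exp (eps * INR n))). apply Rmult_le_compat_r; [|auto].
    apply Rmult_le_pos; [left; apply exp_pos|apply pow_le; lra]. }
destruct (rot_prod_poly a n (fun j => cis (2 * PI * INR j / INR Q)) (S Q)) as (lc & B & Hlc & Hpoly); [intros; apply Cmod_cis|].
set (A := exp (2 * eps * INR n) * rho ^ n). set (A0 := exp (eps * INR n)).
assert (HA : 0 < A) by (apply Rmult_lt_0_compat; [apply exp_pos|apply pow_lt; lra]).
(* at each grid point one factor is at most [A0], all others at most [A] *)
assert (G := ispoly_grid _ _ _ _ (S (S Q * n)) rho (A0 * A ^ (S Q) / A) Hpoly ltac:(lia) ltac:(lra)).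
assert (G' : Cmod lc * rho ^ (S Q * n) <= A0 * A ^ S Q / A).
{ apply G. intros t Ht. apply Rle_div_r; [auto|].
  destruct (rotate_into_arc (S (S Q * n)) Q t d Hd ltac:(unfold Q; lia) HQd Ht) as (j & th & Hj & Hth & E).
  apply (Cprod_le_one _ _ _ _ j); [|auto|].
  - intros i _. apply Hfull. rewrite !Cmod_mult, !Cmod_cis, Cmod_R, Rabs_pos_eq; lra.
  - rewrite <- Cmult_assoc, E. apply Harc; auto. }
rewrite Hlc in G'. specialize (HN1 n ltac:(lia) Hne).
assert (Erho : rho = exp l) by (unfold l; rewrite exp_ln; lra).
assert (EA : A = exp ((2 * eps + l) * INR n)).
{ unfold A. rewrite Erho, <- exp_INR, <- exp_plus. f_equal. ring. }
assert (G2 : exp (- eps * INR n * INR (S Q)) * exp (l * INR (S Q * n)) <= A0 * A ^ S Q / A).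
{ eapply Rle_trans; [|apply G']. rewrite Erho, exp_INR, <- exp_INR. rewrite (exp_INR l).
  apply Rmult_le_compat_r; [apply pow_le; left; apply exp_pos|].
  rewrite exp_INR. apply pow_incr. split; [left; apply exp_pos|auto]. }
unfold Rdiv in G2. rewrite EA, <- exp_INR, <- exp_Ropp in G2. unfold A0 in G2. rewrite <- !exp_plus in G2.
assert (G3 : - eps * INR n * INR (S Q) + l * INR (S Q * n) <= eps * INR n + (2 * eps + l) * INR n * INR (S Q) + - ((2 * eps + l) * INR n)).
{ apply Rnot_lt_le. intros hh. apply exp_increasing in hh. lra. }
rewrite mult_INR, S_INR in G3.
assert (G4 : l * INR n <= eps * (3 * INR Q + 2) * INR n) by nra.
assert (E3 : eps * (3 * INR Q + 2) = l / 2) by (unfold eps; field; lra).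
rewrite E3 in G4. nra.
Qed.

Lemma last_nonzero a y m : a m <> 0 -> (m <= y)%nat -> exists n, (m <= n <= y)%nat /\ a n <> 0 /\
  forall j, (n < j <= y)%nat -> a j = 0.
Proof.
intros Ha. induction y; intros Hm.
- exists m. repeat split; auto; intros; lia.
- destruct (classic (a (S y) = 0)) as [E|E].
  + destruct (Nat.eq_dec m (S y)) as [->|hm]; [contradiction|].
    destruct IHy as (n & Hn & Hne & H); [lia|]. exists n. repeat split; auto; try lia.
    intros j Hj. destruct (Nat.eq_dec j (S y)) as [->|hj]; [auto|apply H; lia].
  + exists (S y). repeat split; auto; try lia; intros; lia.
Qed.

Lemma support_dense a p M d kap : 0 < p < 1 -> 0 <= M -> 0 < d -> growth_upper a -> growth_lower a ->
  (forall N, exists m, (N <= m)%nat /\ a m <> 0) ->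
  (forall th, Rabs th <= d -> taylor_bounded a p M th) -> 0 < kap ->
  exists y1, forall y, (y1 <= y)%nat -> exists m, (y < m)%nat /\ INR m <= (1 + kap) * INR y /\ a m <> 0.
Proof.
intros Hp HM Hd Hup Hlow Hinf Htb Hkap.
destruct (no_gap a p M d kap Hp HM Hd Hup Hlow Htb Hkap) as [n1 Hn1].
destruct (Hinf n1) as (m0 & Hm0 & Hne0). exists m0. intros y Hy. apply NNPP. intros Hno.
destruct (last_nonzero a y m0 Hne0 Hy) as (n & Hn & Hne & Hlast).
apply (Hn1 n); [lia|auto|]. intros m Hm Hmk.
destruct (le_lt_dec m y) as [h|h]; [apply Hlast; lia|].
apply NNPP. intros hm. apply Hno. exists m. repeat split; auto.
eapply Rle_trans; [apply Hmk|]. apply Rmult_le_compat_l; [lra|]. apply le_INR; lia.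
Qed.

(** * Products of sines with zeros between given places *)

Fixpoint Rprod (f : nat -> R) (n : nat) : R :=
  match n with O => 1 | S n => Rprod f n * f n end.

Lemma Rprod_ext f g n : (forall i, (i < n)%nat -> f i = g i) -> Rprod f n = Rprod g n.
Proof.
induction n; intros H; simpl; [reflexivity|].
rewrite IHn, (H n) by (intros; try apply H; lia); reflexivity.
Qed.

Lemma Rprod_mult f g n : Rprod (fun i => f i * g i) n = Rprod f n * Rprod g n.
Proof. induction n; simpl; [ring|rewrite IHn; ring]. Qed.

Lemma Rprod_one f n : (forall i, (i < n)%nat -> f i = 1) -> Rprod f n = 1.
Proof.
induction n; intros H; simpl; [reflexivity|].
rewrite IHn, (H n) by (intros; try apply H; lia); ring.
Qed.

Lemma Rprod_single f n i0 : (i0 < n)%nat -> (forall i, (i < n)%nat -> i <> i0 -> f i = 1) -> Rprod f n = f i0.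
Proof.
induction n; intros Hi H; [lia|]. simpl. destruct (Nat.eq_dec i0 n) as [->|hn].
- rewrite Rprod_one; [ring|]. intros; apply H; lia.
- rewrite IHn, (H n); [ring|lia|lia|lia|]. intros; apply H; lia.
Qed.

Lemma Rprod_head f n : Rprod f (S n) = f 0%nat * Rprod (fun i => f (S i)) n.
Proof. induction n; [simpl; ring|]. simpl in *. rewrite IHn. ring. Qed.

Lemma Rprod_rev f n : Rprod f n = Rprod (fun i => f (n - 1 - i)%nat) n.
Proof.
induction n; [reflexivity|]. rewrite (Rprod_head (fun i => f (S n - 1 - i)%nat)).
simpl Rprod at 1. rewrite IHn, Rmult_comm. f_equal; [f_equal; lia|].
apply Rprod_ext. intros i Hi. f_equal. lia.
Qed.

Lemma Rprod_split f n m : Rprod f (n + m) = Rprod f n * Rprod (fun i => f (n + i)%nat) m.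
Proof.
induction m; [rewrite Nat.add_0_r; simpl; ring|].
rewrite Nat.add_succ_r. simpl. rewrite IHm. ring.
Qed.

Lemma Rprod_le f g n : (forall i, (i < n)%nat -> 0 <= f i <= g i) -> 0 <= Rprod f n <= Rprod g n.
Proof.
induction n; intros H; simpl; [lra|].
destruct IHn as [H1 H2]; [intros; apply H; lia|]. destruct (H n ltac:(lia)) as [H3 H4].
split; [apply Rmult_le_pos; auto|]. apply Rmult_le_compat; auto.
Qed.

Lemma Rprod_Rabs f n : Rabs (Rprod f n) = Rprod (fun i => Rabs (f i)) n.
Proof. induction n; simpl; [apply Rabs_R1|]. rewrite Rabs_mult, IHn. reflexivity. Qed.

Definition chi (E : nat -> Prop) (j : nat) : bool := if excluded_middle_informative (E j) then true else false.

Lemma chi_true E j : chi E j = true <-> E j.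
Proof. unfold chi. destruct (excluded_middle_informative (E j)); split; auto; discriminate. Qed.

Lemma chi_false E j : chi E j = false <-> ~ E j.
Proof. unfold chi. destruct (excluded_middle_informative (E j)); split; auto; try discriminate; contradiction. Qed.

Definition places (E : nat -> Prop) (y L : nat) : list nat := filter (chi E) (seq y L).
(** Zeros are placed midway between [j - 1] and [j], so the product changes sign
    from [j - 1] to [j] and never vanishes at an integer. *)
Definition zeros (E : nat -> Prop) (y L : nat) : list R := map (fun j => INR j - / 2) (places E y L).

Lemma places_S E y L : places E y (S L) = (places E y L ++ if chi E (y + L)%nat then (y + L)%nat :: nil else nil)%list.
Proof. unfold places. rewrite seq_S, filter_app. simpl. destruct (chi E (y + L)); reflexivity. Qed.

Lemma sprod_zeros E y n A t : sprod A (zeros E y n) t =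
  Rprod (fun i => if chi E (y + i) then sin (PI * (t - INR (y + i) + / 2) / A) else 1) n.
Proof.
unfold zeros. induction n; [reflexivity|].
rewrite places_S, map_app, sprod_app, IHn. simpl Rprod. f_equal.
destruct (chi E (y + n)); simpl; [|reflexivity]. rewrite Rmult_1_r. f_equal. unfold Rdiv. ring.
Qed.

(** The sign at [m] of the product of sines with these zeros, for [m] in the window: one
    factor -1 for every zero to the right of [m]. *)
Definition psign (E : nat -> Prop) (y n m : nat) : R :=
  Rprod (fun i => if chi E (y + i) then (if (m <? y + i)%nat then -1 else 1) else 1) n.

Lemma psign_sq E y n m : psign E y n m * psign E y n m = 1.
Proof.
unfold psign. rewrite <- Rprod_mult. apply Rprod_one. intros i _.
destruct (chi E (y + i)); [destruct (m <? y + i)%nat|]; ring.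
Qed.

Lemma psign_step E y n m : (y <= S m < y + n)%nat ->
  psign E y n (S m) = psign E y n m * (if chi E (S m) then -1 else 1).
Proof.
intros Hm. unfold psign.
transitivity (Rprod (fun i => (if chi E (y + i) then (if (m <? y + i)%nat then -1 else 1) else 1) *
   (if chi E (y + i) then if (y + i =? S m)%nat then -1 else 1 else 1)) n).
- apply Rprod_ext. intros i _. destruct (chi E (y + i)); [|ring].
  destruct (Nat.ltb_spec (S m) (y + i)); destruct (Nat.ltb_spec m (y + i)); destruct (Nat.eqb_spec (y + i) (S m)); try lia; ring.
- rewrite Rprod_mult. f_equal. rewrite (Rprod_single _ n (S m - y)).
  + replace (y + (S m - y))%nat with (S m) by lia. rewrite Nat.eqb_refl. reflexivity.
  + lia.
  + intros i Hi Hne. destruct (Nat.eqb_spec (y + i) (S m)); [lia|]. destruct (chi E (y + i)); reflexivity.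
Qed.

Lemma sin_window_sign (k A : R) : 0 < A -> - A < k < A -> 0 <= sin (PI * k / A) * (if Rlt_dec k 0 then -1 else 1).
Proof.
intros HA Hk. assert (HP := PI_RGT_0).
assert (Hf : - 1 < k / A < 1) by (split; [apply Rlt_div_r; lra|apply Rlt_div_l; lra]).
replace (PI * k / A) with (PI * (k / A)) by (unfold Rdiv; ring).
destruct (Rlt_dec k 0) as [h|h].
- assert (k / A < 0) by (apply Rlt_div_l; lra).
  assert (sin (PI * (k / A)) < 0) by (apply sin_lt_0_var; nra). lra.
- assert (0 <= k / A) by (apply Rle_div_r; lra).
  assert (0 <= sin (PI * (k / A))) by (apply sin_ge_0; nra). lra.
Qed.

Lemma sprod_zeros_sign E y n m : (y <= m < y + n)%nat ->
  0 <= psign E y n m * sprod (INR n) (zeros E y n) (INR m).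
Proof.
intros Hm. assert (Hn : 0 < INR n) by (apply lt_0_INR; lia).
rewrite sprod_zeros. unfold psign. rewrite <- Rprod_mult.
assert (G : forall N, (N <= n)%nat -> 0 <= Rprod (fun i =>
  (if chi E (y + i) then if (m <? y + i)%nat then -1 else 1 else 1) *
  (if chi E (y + i) then sin (PI * (INR m - INR (y + i) + / 2) / INR n) else 1)) N).
{ induction N; intros HN; simpl; [lra|]. apply Rmult_le_pos; [apply IHN; lia|].
  destruct (chi E (y + N)); [|lra].
  assert (A := sin_window_sign (INR m - INR (y + N) + / 2) (INR n) Hn).
  destruct (Nat.ltb_spec m (y + N)) as [h|h].
  - assert (h' : INR m + 1 <= INR (y + N)) by (rewrite <- S_INR; apply le_INR; lia).
    assert (h2 : INR (y + N) + 1 <= INR m + INR n) by (rewrite <- S_INR, <- plus_INR; apply le_INR; lia).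
    specialize (A ltac:(lra)). destruct (Rlt_dec _ _); lra.
  - assert (h' : INR (y + N) <= INR m) by (apply le_INR; lia).
    assert (h2 : INR m + 1 <= INR (y + N) + INR n) by (rewrite <- S_INR, <- plus_INR; apply le_INR; lia).
    specialize (A ltac:(lra)). destruct (Rlt_dec _ _); lra. }
apply G; auto.
Qed.

Lemma sprod_mod (L : nat) l m : (0 < L)%nat -> Rabs (sprod (INR L) l (INR m)) = Rabs (sprod (INR L) l (INR (m mod L))).
Proof.
intros HL. assert (HLp : 0 < INR L) by (apply lt_0_INR; lia).
rewrite (Nat.div_mod_eq m L) at 1. generalize (m / L)%nat (m mod L)%nat. intros u v.
induction u; [f_equal; f_equal; f_equal; lia|].
rewrite <- IHu, <- (sprod_period (INR L) l (INR (L * u + v))) by auto.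
rewrite <- plus_INR. do 3 f_equal. lia.
Qed.

Lemma sprod_at_window (L y : nat) l m : (0 < L)%nat -> exists g, (g < L)%nat /\
  Rabs (sprod (INR L) l (INR m)) = Rabs (sprod (INR L) l (INR (y + g))).
Proof.
intros HL. set (j := ((m + (L - 1) * y) mod L)%nat).
assert (Hj : (j < L)%nat) by (apply Nat.mod_upper_bound; lia). exists j. split; [auto|].
rewrite (sprod_mod L l m), (sprod_mod L l (y + j)) by auto. do 3 f_equal.
unfold j. rewrite Nat.Div0.add_mod_idemp_r.
replace (y + (m + (L - 1) * y))%nat with (m + y * L)%nat by nia. symmetry. apply Nat.Div0.mod_add.
Qed.

Lemma sprod_window_max (L y : nat) l : (0 < L)%nat -> exists i, (i < L)%nat /\
  forall m, Rabs (sprod (INR L) l (INR m)) <= Rabs (sprod (INR L) l (INR (y + i))).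
Proof.
intros HL. destruct (argmax (fun i => Rabs (sprod (INR L) l (INR (y + i)))) (L - 1)) as (i & Hi & H).
exists i. split; [lia|]. intros m.
destruct (sprod_at_window L y l m HL) as (g & Hg & ->). apply H. lia.
Qed.

(** Up to [pi / 3] the mean value theorem applies with [cos >= 1/2]; beyond,
    monotonicity and [sqrt 3 >= 17/10] suffice. *)
Lemma sin_ge_half x : 0 <= x <= PI / 2 -> x / 2 <= sin x.
Proof.
intros Hx. assert (HP := PI_RGT_0). assert (HP4 := PI_4).
destruct (Rle_lt_dec x (PI / 3)) as [h|h].
- destruct (Req_dec x 0) as [->|hx]; [rewrite sin_0; lra|]. assert (hx0 : 0 < x) by (destruct Hx as [[?|?] ?]; [auto|congruence]).
  destruct (MVT_cor2 sin cos 0 x) as (c & Hc & Hc'); [lra|intros; apply derivable_pt_lim_sin|].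
  rewrite sin_0, !Rminus_0_r in Hc. rewrite Hc.
  assert (1 / 2 <= cos c). { rewrite <- cos_PI3. apply cos_decr_1; lra. }
  nra.
- assert (A : sin (PI / 3) <= sin x) by (apply sin_incr_1; lra).
  rewrite sin_PI3 in A.
  assert (B : 17/10 <= sqrt 3).
  { rewrite <- (sqrt_Rsqr (17/10)) by lra. apply sqrt_le_1; unfold Rsqr; lra. }
  assert (PI <= 34 / 10). { assert (C := PI_ineq 2). unfold tg_alt, PI_tg in C. simpl in C. lra. }
  lra.
Qed.

Lemma sin_dist_lower u A : 0 < A -> 0 <= Rabs u <= A -> Rmin (Rabs u) (A - Rabs u) / A <= Rabs (sin (PI * u / A)).
Proof.
intros HA Hu.
assert (H : forall v, 0 <= v <= A -> Rmin v (A - v) / A <= sin (PI * v / A)).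
{ intros v Hv. assert (HP := PI2_3_2). assert (HP0 := PI_RGT_0).
  replace (PI * v / A) with (PI * (v / A)) by (unfold Rdiv; ring).
  assert (Hf : 0 <= v / A <= 1) by (split; [apply Rle_div_r|apply Rle_div_l]; lra).
  destruct (Rle_lt_dec v (A / 2)) as [h|h].
  - assert (v / A <= 1/2) by (apply Rle_div_l; lra).
    assert (B := sin_ge_half (PI * (v / A)) ltac:(nra)).
    rewrite Rmin_left by lra. unfold PI2 in HP. nra.
  - assert (1/2 < v / A) by (apply (proj1 (Rlt_div_r (1/2) v A HA)); lra).
    rewrite <- sin_PI_x.
    replace (PI - PI * (v / A)) with (PI * ((A - v) / A)) by (field; lra).
    assert (E : (A - v) / A = 1 - v / A) by (field; lra).
    assert (B := sin_ge_half (PI * ((A - v) / A)) ltac:(rewrite E; nra)).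
    rewrite Rmin_right by lra. rewrite E in *. unfold PI2 in HP. nra. }
eapply Rle_trans; [apply H; auto|].
unfold Rabs at 1. destruct (Rcase_abs u) as [h|h].
- replace (PI * - u / A) with (- (PI * u / A)) by (unfold Rdiv; ring). rewrite sin_neg, <- Rabs_Ropp. apply Rle_abs.
- apply Rle_abs.
Qed.

Lemma sin_compare x y D : Rabs (sin (x - y)) <= D -> sin y <> 0 -> Rabs (sin x) <= Rabs (sin y) * (1 + D / Rabs (sin y)).
Proof.
intros HD Hy. assert (Hy0 : 0 < Rabs (sin y)) by (apply Rabs_pos_lt; auto).
replace (Rabs (sin y) * (1 + D / Rabs (sin y))) with (Rabs (sin y) + D) by (field; lra).
replace (sin x) with (sin (x - y) * cos y + cos (x - y) * sin y) by (rewrite <- sin_plus; f_equal; ring).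
eapply Rle_trans; [apply Rabs_triang|]. rewrite !Rabs_mult.
assert (Rabs (cos y) <= 1) by (apply Rabs_le, COS_bound).
assert (Rabs (cos (x - y)) <= 1) by (apply Rabs_le, COS_bound).
assert (A := Rabs_pos (sin (x - y))). assert (B := Rabs_pos (cos y)). assert (C := Rabs_pos (cos (x - y))). nra.
Qed.

Definition harmonic_prod (X : R) (n : nat) : R := Rprod (fun j => 1 + X / (INR j + 1)) n.

Lemma harmonic_prod_ge_1 X n : 0 <= X -> 1 <= harmonic_prod X n.
Proof.
intros HX. unfold harmonic_prod. induction n; simpl; [lra|].
assert (0 <= X / (INR n + 1)). { assert (A := pos_INR n). apply Rle_div_r; lra. } nra.
Qed.

Lemma harmonic_prod_mono X X' n n' : 0 <= X <= X' -> (n <= n')%nat -> harmonic_prod X n <= harmonic_prod X' n'.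
Proof.
intros HX Hn. apply Rle_trans with (harmonic_prod X' n).
- apply Rprod_le. intros i _. assert (A := pos_INR i).
  assert (0 < / (INR i + 1)) by (apply Rinv_0_lt_compat; lra). unfold Rdiv. split; nra.
- induction Hn; [lra|]. eapply Rle_trans; [apply IHHn|]. unfold harmonic_prod. simpl. fold (harmonic_prod X' m).
  assert (A := harmonic_prod_ge_1 X' m ltac:(lra)).
  assert (0 <= X' / (INR m + 1)). { assert (B := pos_INR m). apply (proj1 (Rle_div_r 0 X' (INR m + 1) ltac:(lra))). lra. } nra.
Qed.

Lemma bin_step m k : bin (S m) k * (INR (S m) - INR k) = bin m k * INR (S m).
Proof.
destruct k as [|k]; [rewrite !bin_0; simpl INR at 2; ring|].
change (bin (S m) (S k)) with (bin m k + bin m (S k)). assert (A := bin_ratio m k). rewrite !S_INR. nra.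
Qed.

(** For an integer [Q] the product telescopes to a binomial coefficient. *)
Lemma harmonic_prod_bin Q n : harmonic_prod (INR Q) n = bin (n + Q) Q.
Proof.
induction n; [simpl; symmetry; apply bin_self|]. unfold harmonic_prod. simpl Rprod. fold (harmonic_prod (INR Q) n). rewrite IHn.
assert (A := bin_step (n + Q) Q). rewrite !S_INR, plus_INR in A.
assert (B := pos_INR n). change (S n + Q)%nat with (S (n + Q)).
apply Rmult_eq_reg_r with (INR n + 1); [|lra].
transitivity (bin (n + Q) Q * (INR n + INR Q + 1)); [field; lra|]. rewrite <- A. ring.
Qed.

(** By harmonic_prod_bin the product is a binomial coefficient [bin(n+Q,Q)] with [Q] a small
    proportion of [n + Q], bounded by the entropy estimate
    [bin(n+Q,Q) w^Q <= (1 + w)^(n+Q)]. *)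
Lemma harmonic_prod_small delta : 0 < delta -> exists kap L0, 0 < kap /\ forall L, (L0 <= L)%nat ->
  forall X n, 0 <= X <= kap * INR L -> (n <= L)%nat -> harmonic_prod X n <= exp (delta * INR L).
Proof.
intros Hd. set (v := exp (- 1 - 4 / delta)).
assert (Hv : 0 < Rmin (delta / 8) (1/2) < 1).
{ split; [apply Rmin_glb_lt; lra|]. eapply Rle_lt_trans; [apply Rmin_r|lra]. }
set (w := Rmin (delta / 8) (1/2)) in *. assert (Hw1 : w <= delta / 8) by apply Rmin_l.
set (t := - ln w).
assert (Ht : 0 < t). { unfold t. assert (ln w < ln 1) by (apply ln_increasing; lra). rewrite ln_1 in H. lra. }
set (kap := Rmin 1 (delta / (4 * t))).
assert (Hkap : 0 < kap) by (apply Rmin_glb_lt; [lra|apply Rdiv_lt_0_compat; lra]).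
assert (Hk1 : kap <= 1) by apply Rmin_l.
assert (Hk2 : kap * t <= delta / 4).
{ apply Rle_trans with (delta / (4 * t) * t); [apply Rmult_le_compat_r; [lra|apply Rmin_r]|]. right; field; lra. }
destruct (INR_unbounded (4 * t / delta + 4)) as [L0 HL0].
exists kap, L0. split; [auto|]. intros L HL X n HX Hn.
apply le_INR in HL. apply le_INR in Hn as HnR.
destruct (nfloor_ex X) as [Q0 HQ0]; [lra|]. set (Q := S Q0).
assert (HXQ : X <= INR Q) by (unfold Q; rewrite S_INR; lra).
assert (HQX : INR Q <= kap * INR L + 1) by (unfold Q; rewrite S_INR; lra).
eapply Rle_trans; [apply (harmonic_prod_mono X (INR Q) n n); [lra|lia]|]. rewrite harmonic_prod_bin.
assert (Hb : bin (n + Q) Q * w ^ Q <= (1 + w) ^ (n + Q)).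
{ rewrite binomial_R. 
  eapply Rle_trans; [|apply (Rsum_term_le (fun k => bin (n + Q) k * 1 ^ (n + Q - k) * w ^ k) (S (n + Q)) Q)].
  - cbv beta. rewrite pow1, Rmult_1_r. lra.
  - intros j. rewrite pow1, Rmult_1_r. apply Rmult_le_pos; [apply bin_pos|apply pow_le; lra].
  - lia. }
assert (Hwq : w ^ Q = exp (- t * INR Q)).
{ unfold t. rewrite exp_INR. f_equal. rewrite Ropp_involutive, exp_ln; lra. }
assert (H1w : (1 + w) ^ (n + Q) <= exp (w * INR (n + Q))).
{ rewrite exp_INR. apply pow_incr. split; [lra|]. apply exp_ineq1_le. }
apply Rmult_le_reg_r with (w ^ Q); [apply pow_lt; lra|].
eapply Rle_trans; [apply Hb|]. eapply Rle_trans; [apply H1w|].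
rewrite Hwq, <- exp_plus. apply exp_le. rewrite plus_INR.
assert (HL4 : 4 * t <= delta * (INR L - 4)).
{ assert (A : 4 * t / delta <= INR L - 4) by lra. apply Rle_div_l in A; [|lra]. lra. }
assert (0 <= 4 * t / delta) by (apply Rle_div_r; lra).
assert (HQL : INR Q <= 2 * INR L) by nra.
assert (Pn := pos_INR n). assert (PQ := pos_INR Q). assert (w * (INR n + INR Q) <= delta / 8 * (3 * INR L)) by (apply Rmult_le_compat; lra).
assert (t * INR Q <= t * (kap * INR L + 1)) by (apply Rmult_le_compat_l; lra).
assert (kap * t * INR L <= delta / 4 * INR L) by (apply Rmult_le_compat_r; lra). nra.
Qed.

(** * Variation of such a product over short distances *)

(** Bound for the relative change of the [i]-th sine factor when the argument moves away
    from the place of index [g].  The two parts come from the two ways round the circle of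
    length [L] between the places [i] and [g]. *)
Definition harmonic_factor (X : R) (g L i : nat) : R :=
  if (i <=? g)%nat then (1 + X / (INR (g - i) + 1)) * (1 + X / (INR i + 1))
  else (1 + X / (INR (i - g - 1) + 1)) * (1 + X / (INR (L - 1 - i) + 1)).

Lemma harmonic_factor_prod X g L : 0 <= X -> (g < L)%nat -> Rprod (harmonic_factor X g L) L <= harmonic_prod X L ^ 4.
Proof.
intros HX Hg. replace L with (S g + (L - 1 - g))%nat at 2 by lia.
rewrite Rprod_split. set (n' := (L - 1 - g)%nat).
replace (Rprod (harmonic_factor X g L) (S g)) with (harmonic_prod X (S g) * harmonic_prod X (S g)).
2:{ unfold harmonic_prod. rewrite (Rprod_rev (fun j => 1 + X / (INR j + 1))) at 1. rewrite <- Rprod_mult.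
  apply Rprod_ext. intros i Hi. unfold harmonic_factor. destruct (Nat.leb_spec i g); [|lia].
  replace (S g - 1 - i)%nat with (g - i)%nat by lia. reflexivity. }
replace (Rprod (fun i => harmonic_factor X g L (S g + i)%nat) n') with (harmonic_prod X n' * harmonic_prod X n').
2:{ unfold harmonic_prod. rewrite (Rprod_rev (fun j => 1 + X / (INR j + 1))) at 2. rewrite <- Rprod_mult.
  apply Rprod_ext. intros i Hi. unfold harmonic_factor. destruct (Nat.leb_spec (S g + i) g); [lia|].
  replace (S g + i - g - 1)%nat with i by lia. replace (L - 1 - (S g + i))%nat with (n' - 1 - i)%nat by (unfold n'; lia). reflexivity. }
assert (A := harmonic_prod_mono X X (S g) L ltac:(lra) ltac:(lia)).
assert (B := harmonic_prod_mono X X n' L ltac:(lra) ltac:(unfold n'; lia)).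
assert (A1 := harmonic_prod_ge_1 X (S g) HX). assert (B1 := harmonic_prod_ge_1 X n' HX).
replace (harmonic_prod X L ^ 4) with ((harmonic_prod X L * harmonic_prod X L) * (harmonic_prod X L * harmonic_prod X L)) by ring.
apply Rmult_le_compat; nra.
Qed.

Lemma inv_le_of x y X : 0 <= X -> 0 < y -> y / 2 <= x -> X / x <= 2 * X / y.
Proof.
intros HX Hy Hxy. assert (Hx : 0 < x) by lra.
apply Rmult_le_reg_r with (x * y); [nra|].
replace (X / x * (x * y)) with (X * y) by (field; lra).
replace (2 * X / y * (x * y)) with (X * (2 * x)) by (field; lra). apply Rmult_le_compat_l; lra.
Qed.

(** Moving the argument from [m0] by [t - m0] multiplies a factor [sin y] by at most
    [1 + D / |sin y|] (sin_compare), and [|sin y|] is bounded below by the distance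
    of [m0] from the zero, measured on the circle and at least 1/2. *)
Lemma zeros_compare E y L t m0 D : (y <= m0 < y + L)%nat -> 0 <= D ->
  Rabs (sin (PI * (t - INR m0) / INR L)) <= D ->
  Rabs (sprod (INR L) (zeros E y L) t) <=
  Rabs (sprod (INR L) (zeros E y L) (INR m0)) * harmonic_prod (2 * D * INR L) L ^ 4.
Proof.
intros Hm HD Ht. assert (HL : 0 < INR L) by (apply lt_0_INR; lia).
set (X := 2 * D * INR L). assert (HX : 0 <= X) by (unfold X; nra).
set (g := (m0 - y)%nat).
rewrite !sprod_zeros, !Rprod_Rabs.
eapply Rle_trans; [|apply Rmult_le_compat_l; [|apply (harmonic_factor_prod X g L); [auto|unfold g; lia]]].
2:{ rewrite <- Rprod_Rabs. apply Rabs_pos. }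
rewrite <- Rprod_mult. apply Rprod_le. intros i Hi. split; [apply Rabs_pos|].
assert (Hh : 1 <= harmonic_factor X g L i).
{ unfold harmonic_factor. assert (H1 := pos_INR (g - i)). assert (H2 := pos_INR i). assert (H3 := pos_INR (i - g - 1)).
  assert (H4 := pos_INR (L - 1 - i)).
  assert (Q : forall z, 0 <= z -> 0 <= X / (z + 1)) by (intros z Hz; apply Rmult_le_pos; [auto|left; apply Rinv_0_lt_compat; lra]).
  assert (Q1 := Q _ H1). assert (Q2 := Q _ H2). assert (Q3 := Q _ H3). assert (Q4 := Q _ H4).
  destruct (i <=? g)%nat; nra. }
destruct (chi E (y + i)); [|rewrite Rabs_R1; lra].
set (u := INR m0 - INR (y + i) + / 2).
assert (Hlow : exists x1 x2, 0 < x1 /\ 0 < x2 /\ Rmin x1 x2 / INR L <= Rabs (sin (PI * u / INR L)) /\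
   (1 + D * INR L / x1) * (1 + D * INR L / x2) <= harmonic_factor X g L i).
{ assert (HDL : 0 <= D * INR L) by nra.
  destruct (le_lt_dec i g) as [h|h].
  - assert (Eu : u = INR (g - i) + / 2).
    { unfold u, g. rewrite !minus_INR, plus_INR by lia. ring. }
    assert (Hg1 := pos_INR (g - i)). assert (Hi1 := pos_INR i).
    assert (HgL : INR (g - i) + 1 + INR i <= INR L) by (rewrite <- S_INR, <- plus_INR; apply le_INR; unfold g; lia).
    exists u, (INR L - u). repeat split; try lra.
    + rewrite <- (Rabs_pos_eq u) at 1 2 by lra. apply sin_dist_lower; [auto|]. rewrite Rabs_pos_eq; lra.
    + unfold harmonic_factor. destruct (Nat.leb_spec i g); [|lia].
      assert (A1 := inv_le_of u (INR (g - i) + 1) (D * INR L) HDL ltac:(lra) ltac:(lra)).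
      assert (A2 := inv_le_of (INR L - u) (INR i + 1) (D * INR L) HDL ltac:(lra) ltac:(lra)).
      replace (2 * (D * INR L)) with X in * by (unfold X; ring).
      assert (0 <= D * INR L / u) by (apply Rmult_le_pos; [auto|left; apply Rinv_0_lt_compat; lra]).
      assert (0 <= D * INR L / (INR L - u)) by (apply Rmult_le_pos; [auto|left; apply Rinv_0_lt_compat; lra]).
      apply Rmult_le_compat; lra.
  - assert (Eu : u = - (INR (i - g - 1) + / 2)).
    { unfold u, g in *. rewrite !minus_INR, plus_INR by lia. simpl (INR 1). lra. }
    assert (Hg1 := pos_INR (i - g - 1)). assert (Hi1 := pos_INR (L - 1 - i)).
    assert (HgL : INR (i - g - 1) + 1 + INR (L - 1 - i) + 1 <= INR L)
      by (rewrite <- !S_INR, <- plus_INR, <- S_INR; apply le_INR; lia).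
    exists (- u), (INR L - - u). repeat split; try lra.
    + replace (- u) with (Rabs u) by (apply Rabs_left; lra). apply sin_dist_lower; [auto|]. rewrite Rabs_left; lra.
    + unfold harmonic_factor. destruct (Nat.leb_spec i g); [lia|].
      assert (A1 := inv_le_of (- u) (INR (i - g - 1) + 1) (D * INR L) HDL ltac:(lra) ltac:(lra)).
      assert (A2 := inv_le_of (INR L - - u) (INR (L - 1 - i) + 1) (D * INR L) HDL ltac:(lra) ltac:(lra)).
      replace (2 * (D * INR L)) with X in * by (unfold X; ring).
      assert (0 <= D * INR L / - u) by (apply Rmult_le_pos; [auto|left; apply Rinv_0_lt_compat; lra]).
      assert (0 <= D * INR L / (INR L - - u)) by (apply Rmult_le_pos; [auto|left; apply Rinv_0_lt_compat; lra]).
      apply Rmult_le_compat; lra. }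
destruct Hlow as (x1 & x2 & Hx1 & Hx2 & Hs & Hhf).
set (sy := Rabs (sin (PI * u / INR L))) in *.
assert (Hmin : 0 < Rmin x1 x2) by (apply Rmin_glb_lt; auto).
assert (Hsy : 0 < sy). { eapply Rlt_le_trans; [|apply Hs]. apply Rdiv_lt_0_compat; auto. }
eapply Rle_trans; [apply (sin_compare _ (PI * u / INR L) D)|].
- replace (PI * (t - INR (y + i) + / 2) / INR L - PI * u / INR L) with (PI * (t - INR m0) / INR L)
    by (unfold u; field; lra). auto.
- intros h. unfold sy in Hsy. rewrite h, Rabs_R0 in Hsy. lra.
- fold sy. apply Rmult_le_compat_l; [lra|]. eapply Rle_trans; [|apply Hhf].
  assert (P1 : 0 <= D * INR L / x1) by (apply Rmult_le_pos; [nra|left; apply Rinv_0_lt_compat; lra]).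
  assert (P2 : 0 <= D * INR L / x2) by (apply Rmult_le_pos; [nra|left; apply Rinv_0_lt_compat; lra]).
  assert (HDs : D / sy <= D * INR L / x1 + D * INR L / x2).
  { apply Rle_trans with (D * INR L / Rmin x1 x2).
    - apply Rmult_le_reg_r with (sy * Rmin x1 x2); [nra|].
      replace (D / sy * (sy * Rmin x1 x2)) with (D * Rmin x1 x2) by (field; lra).
      replace (D * INR L / Rmin x1 x2 * (sy * Rmin x1 x2)) with (D * (INR L * sy)) by (field; lra).
      apply Rmult_le_compat_l; [auto|]. apply Rle_div_l in Hs; [|auto]. lra.
    - unfold Rmin. destruct (Rle_dec x1 x2); lra. }
  nra.
Qed.

Lemma zeros_length E y L : length (zeros E y L) = length (places E y L).
Proof. apply length_map. Qed.

Lemma sprod_bandlimited L l T : 0 < L -> INR (length l) * PI / L <= T -> bandlimited T (fun m => sprod L l (INR m)).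
Proof.
intros HL HT. destruct (sprod_spectrum L l HL) as (c & Hc & H).
exists (S (length l)), c, (fun i => (2 * INR i - INR (length l)) * PI / L). split; [auto|]. split.
- intros i Hi. assert (A : INR i <= INR (length l)) by (apply le_INR; lia). assert (B := pos_INR i).
  assert (HP := PI_RGT_0).
  eapply Rle_trans; [|apply HT]. unfold Rdiv. rewrite !Rabs_mult.
  rewrite (Rabs_pos_eq PI) by lra. rewrite (Rabs_pos_eq (/ L)) by (left; apply Rinv_0_lt_compat; auto).
  apply Rmult_le_compat_r; [left; apply Rinv_0_lt_compat; auto|].
  apply Rmult_le_compat_r; [lra|]. apply Rabs_le. lra.
- intros m. rewrite H. apply Csum_ext. intros i _. f_equal. f_equal. unfold Rdiv. ring.
Qed.

Lemma sprod_repeat L e n t : sprod L (repeat e n) t = sin (PI * (t - e) / L) ^ n.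
Proof. induction n; simpl; [reflexivity|rewrite IHn; reflexivity]. Qed.

(** Between consecutive support points [j < m] at most the place [m] can be a sign change,
    and it is one exactly when [a_j a_m < 0]. *)
Lemma sign_coherent a y n m0 : (y <= m0 < y + n)%nat -> a m0 <> 0 ->
  forall m, (y <= m < y + n)%nat -> a m <> 0 ->
  0 < (a m * psign (sign_change_at a) y n m) * (a m0 * psign (sign_change_at a) y n m0).
Proof.
set (s := psign (sign_change_at a) y n).
assert (Hsq : forall m, s m * s m = 1) by (intros; apply psign_sq).
assert (Hrun : forall k m, (y <= k <= m)%nat -> (m < y + n)%nat ->
   (forall j, (k < j <= m)%nat -> ~ sign_change_at a j) -> s m = s k).
{ intros k m Hk Hm Hno. induction m.
  - replace k with 0%nat by lia. reflexivity.
  - destruct (Nat.eq_dec k (S m)) as [->|hk]; [reflexivity|].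
    unfold s. rewrite psign_step by lia.
    replace (chi (sign_change_at a) (S m)) with false by (symmetry; apply chi_false, Hno; lia).
    rewrite Rmult_1_r. apply IHm; [lia|lia|]. intros j Hj. apply Hno. lia. }
assert (Hpair : forall m, (m < y + n)%nat -> a m <> 0 -> forall k, (y <= k <= m)%nat -> a k <> 0 ->
   0 < (a m * s m) * (a k * s k)).
{ induction m as [m IH] using lt_wf_ind. intros Hm Ham k Hk Hak.
  destruct (Nat.eq_dec k m) as [->|hkm].
  - replace (a m * s m * (a m * s m)) with (a m * a m * (s m * s m)) by ring. rewrite Hsq. nra.
  - destruct m as [|m']; [lia|].
    destruct (last_nonzero a m' k Hak ltac:(lia)) as (j & Hj & Haj & Hlast).
    assert (Hstep : 0 < (a (S m') * s (S m')) * (a j * s j)).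
    { assert (Hno : forall i, (j < i <= m')%nat -> ~ sign_change_at a i).
      { intros i Hi (k0 & _ & Hneg & _). rewrite (Hlast i) in Hneg by lia. lra. }
      assert (Es : s (S m') = s m' * (if chi (sign_change_at a) (S m') then -1 else 1)) by (apply psign_step; lia).
      assert (Ej : s m' = s j) by (apply Hrun; auto; lia).
      rewrite Es, Ej. specialize (Hsq j).
      destruct (chi (sign_change_at a) (S m')) eqn:Ec.
      - apply chi_true in Ec. destruct Ec as (k0 & Hk0 & Hneg & Hz).
        assert (k0 = j).
        { destruct (lt_eq_lt_dec k0 j) as [[h|h]|h]; [|auto|].
          - exfalso. apply Haj, Hz. lia.
          - exfalso. rewrite (Hlast k0) in Hneg by lia. lra. }
        subst k0.
        replace (a (S m') * (s j * -1) * (a j * s j)) with (- (a (S m') * a j) * (s j * s j)) by ring. rewrite Hsq. lra.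
      - apply chi_false in Ec.
        replace (a (S m') * (s j * 1) * (a j * s j)) with ((a (S m') * a j) * (s j * s j)) by ring. rewrite Hsq.
        rewrite Rmult_1_r. apply Rnot_le_lt. intros hle. apply Ec. exists j. split; [lia|]. split.
        + destruct hle as [hlt|he]; [auto|]. exfalso. apply Rmult_integral in he. tauto.
        + intros i Hi. apply Hlast. lia. }
    assert (Hrest := IH j ltac:(lia) ltac:(lia) Haj k ltac:(lia) Hak).
    set (A := a (S m') * s (S m')) in *. set (B := a j * s j) in *. set (D := a k * s k) in *.
    assert (0 < (A * B) * (B * D)) by (apply Rmult_lt_0_compat; auto).
    assert (0 < B * B) by nra.
    apply Rmult_lt_reg_r with (B * B); [auto|]. rewrite Rmult_0_l. lra. }
intros Hm0 Ha0 m Hm Ham. destruct (le_lt_dec m0 m) as [h|h].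
- apply Hpair; auto; lia.
- rewrite Rmult_comm. apply Hpair; auto; lia.
Qed.

(** * Every short window contains many sign changes *)

Lemma pow_exp_le x n y : 0 <= x -> x * INR n <= y -> (1 + x) ^ n <= exp y.
Proof.
intros Hx Hy. apply Rle_trans with (exp (x * INR n)); [|apply exp_le; auto].
rewrite exp_INR. apply pow_incr. split; [lra|apply exp_ineq1_le].
Qed.

Lemma half_pow_exp n : exp (- INR n) <= (/ 2) ^ n.
Proof.
replace (- INR n) with (-1 * INR n) by ring. rewrite exp_INR. apply pow_incr.
split; [left; apply exp_pos|]. replace (-1) with (- (1)) by ring. rewrite exp_Ropp.
apply Rinv_le_contravar; [lra|]. assert (A := exp_ineq1_le 1). lra.
Qed.

(** If a window has fewer than [De L] sign changes, the frequencies left over up to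
    [pi b] are spent on a zero of even order at the edge of the window.  This does not
    disturb the signs inside, but forces the maximum of the multiplier away from both edges
    of the window.  A support point [m0] near that maximum and the agreement of
    signs in a neighbourhood of [m0] contradict no_coherent_multiplier. *)
Lemma many_sign_changes a p M b De : 0 < p < 1 -> 0 <= M -> growth_upper a -> growth_lower a ->
  (forall N, exists m, (N <= m)%nat /\ a m <> 0) -> 0 <= De < b -> b < 1 ->
  (forall th, Rabs th <= PI * b -> taylor_bounded a p M th) ->
  exists r0, 0 < r0 /\ forall r, 0 < r < r0 -> exists x1, forall x, (x1 <= x)%nat ->
    forall L, r * INR x <= INR L <= 2 * r * INR x ->
    De * INR L <= INR (length (places (sign_change_at a) (S x) L)).
Proof.
intros Hp HM Hup Hlow Hinf Hb Hb1 Htb. assert (HP := PI_RGT_0). assert (HP4 := PI_4). assert (HP3 := PI2_3_2).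
destruct (no_coherent_multiplier a p M (PI * b) Hp HM Hup Hlow Htb) as (eta & Heta & Hcore).
exists (Rmin (1/2) (eta / 8)). split; [apply Rmin_glb_lt; lra|].
intros r Hr. assert (Hr1 : r < 1/2) by (eapply Rlt_le_trans; [apply Hr|apply Rmin_l]).
assert (Hr2 : r < eta / 8) by (eapply Rlt_le_trans; [apply Hr|apply Rmin_r]).
assert (Hr0 : 0 < r) by apply Hr. clear Hr.
set (eps0 := b - De). assert (He0 : 0 < eps0 <= 1) by (unfold eps0; lra).
(* [s L] will be the distance of the maximum from the edges: closer than that, the
   zero of order [2 F] makes the multiplier smaller than [exp (- L)] *)
set (s := exp (- (2 / eps0)) / PI).
assert (Hs : 0 < s < 1/2).
{ unfold s. split; [apply Rdiv_lt_0_compat; [apply exp_pos|auto]|].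
  assert (exp (- (2 / eps0)) < 1).
  { rewrite <- exp_0. apply exp_increasing. assert (0 < 2 / eps0) by (apply Rdiv_lt_0_compat; lra). lra. }
  apply (proj2 (Rlt_div_l (exp (- (2 / eps0))) (1/2) PI HP)). unfold PI2 in HP3. lra. }
destruct (Hcore (s * r / 4)) as (c & m1 & Hc & Hcore'). { nra. }
(* admissible exponential loss, relative to [L], in passing from the maximum of the
   multiplier to a support point *)
set (kp := Rmin 1 (c / (4 * r))).
assert (Hkp : 0 < kp) by (apply Rmin_glb_lt; [lra|apply Rdiv_lt_0_compat; lra]).
assert (Hkp1 : kp <= 1) by apply Rmin_l.
assert (Hkp2 : kp * (4 * r) <= c).
{ apply Rle_trans with (c / (4 * r) * (4 * r)); [apply Rmult_le_compat_r; [lra|apply Rmin_r]|right; field; lra]. }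
destruct (harmonic_prod_small (kp / 8)) as (kap1 & L1 & Hkap1 & HHp); [lra|].
set (D := Rmin (kap1 / 2) (kp * s / 4)).
assert (HD : 0 < D) by (apply Rmin_glb_lt; nra).
assert (HD1 : D <= kap1 / 2) by apply Rmin_l. assert (HD2 : D <= kp * s / 4) by apply Rmin_r.
set (kap := Rmin (D / 4) (s / 4)).
assert (Hkap : 0 < kap) by (apply Rmin_glb_lt; lra).
assert (Hkd : kap <= D / 4) by apply Rmin_l. assert (Hks : kap <= s / 4) by apply Rmin_r.
destruct (support_dense a p M (PI * b) (kap * r / 2) Hp HM ltac:(nra) Hup Hlow Hinf Htb ltac:(nra)) as [y1 Hy1].
destruct (INR_unbounded ((4 / eps0 + INR L1 + 1) / r)) as [N4 HN4].
exists (y1 + m1 + N4 + 2)%nat. intros x Hx L HL.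
assert (HxR : INR N4 <= INR x) by (apply le_INR; lia).
assert (Hx0 : 0 < INR x) by (apply lt_0_INR; lia).
assert (HLbig : 4 / eps0 + INR L1 + 1 <= INR L).
{ apply Rlt_div_l in HN4; [|auto]. nra. }
assert (H4e : 0 < 4 / eps0) by (apply Rdiv_lt_0_compat; lra).
assert (HL1 := pos_INR L1).
assert (HLp : 0 < INR L) by lra.
assert (HsL : 0 < s * INR L) by (apply Rmult_lt_0_compat; lra).
assert (HLx : INR L <= INR x) by (assert (r * INR x <= 1/2 * INR x) by (apply Rmult_le_compat_r; lra); lra).
assert (HkL : kap * INR L <= s / 4 * INR L) by (apply Rmult_le_compat_r; lra).
assert (HkD : kap * INR L <= D / 4 * INR L) by (apply Rmult_le_compat_r; lra).
assert (HLL1 : (L1 <= L)%nat) by (apply INR_le; lra).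
assert (HLnat : (0 < L)%nat) by (apply INR_lt; simpl; lra).
assert (HLe : eps0 * INR L >= 4).
{ assert (A : 4 / eps0 <= INR L) by lra. apply Rle_div_l in A; lra. }
set (E := sign_change_at a). set (y := S x). apply Rnot_lt_le. intros Hfew.
set (N := length (places E y L)) in *. fold E in Hfew. fold y in Hfew. fold N in Hfew.
(* the edge carries a zero of even order [2 F], about the number of frequencies
   that [De L] sign changes leave below [b L] *)
destruct (nfloor_ex (eps0 * INR L / 2)) as [F HF]; [nra|].
set (e := INR y - / 2).
set (l := (repeat e (2 * F) ++ zeros E y L)%list).
assert (Hlen : length l = (2 * F + N)%nat) by (unfold l; rewrite length_app, repeat_length, zeros_length; reflexivity).
assert (H2F : eps0 * INR L - 2 <= INR (2 * F) <= eps0 * INR L) by (rewrite mult_INR; simpl (INR 2); lra).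
assert (H2FL : INR (2 * F) <= INR L) by (assert (eps0 * INR L <= 1 * INR L) by (apply Rmult_le_compat_r; lra); lra).
assert (HlenR : INR (length l) <= b * INR L).
{ rewrite Hlen, plus_INR. unfold eps0 in *. nra. }
assert (HlenL : (length l < L)%nat) by (apply INR_lt; nra).
set (psi := fun m => sprod (INR L) l (INR m)).
assert (Epsi : forall t, sprod (INR L) l t = sin (PI * (t - e) / INR L) ^ (2 * F) * sprod (INR L) (zeros E y L) t).
{ intros t. unfold l. rewrite sprod_app, sprod_repeat. reflexivity. }
assert (Hband : bandlimited (PI * b) psi).
{ apply sprod_bandlimited; [auto|]. apply Rle_div_l; [auto|]. nra. }
(* [ts] is the place of the maximum *)
destruct (sprod_window_max L y l HLnat) as (i0 & Hi0 & Hmax).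
set (ts := (y + i0)%nat) in *. fold (psi ts) in Hmax.
assert (Hts : exp (- INR L) < Rabs (psi ts)).
{ destruct (sprod_large L l HlenL) as (t & _ & Ht).
  apply Rlt_le_trans with ((/2) ^ length l).
  - apply Rlt_le_trans with (exp (- INR (length l))); [|apply half_pow_exp].
    apply exp_increasing. apply lt_INR in HlenL. lra.
  - eapply Rle_trans; [apply Ht|apply Hmax]. }
assert (Hyx : INR y = INR x + 1) by (unfold y; apply S_INR).
assert (Hets : INR ts - e = INR i0 + / 2) by (unfold ts, e; rewrite plus_INR; ring).
assert (Hi0R : INR i0 + 1 <= INR L) by (rewrite <- S_INR; apply le_INR; lia).
assert (Hi00 := pos_INR i0).
(* the maximum is not near the edges *)
assert (Hedge : forall d, 0 <= d <= INR L -> Rabs (sin (PI * (INR ts - e) / INR L)) <= PI * d / INR L -> s * INR L <= d).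
{ intros d Hd Hsin. apply Rnot_lt_le. intros Hlt.
  assert (Hsmall : Rabs (sin (PI * (INR ts - e) / INR L)) <= exp (- (2 / eps0))).
  { eapply Rle_trans; [apply Hsin|]. apply Rle_div_l; [auto|].
    assert (Es : exp (- (2 / eps0)) = PI * s) by (unfold s; field; lra). rewrite Es. nra. }
  assert (Hb2 : Rabs (psi ts) <= exp (- (2 / eps0)) ^ (2 * F)).
  { unfold psi. rewrite Epsi, Rabs_mult, <- RPow_abs.
    assert (A := sprod_le_1 (INR L) (zeros E y L) (INR ts)).
    assert (B : Rabs (sin (PI * (INR ts - e) / INR L)) ^ (2 * F) <= exp (- (2 / eps0)) ^ (2 * F))
      by (apply pow_incr; split; [apply Rabs_pos|auto]).
    assert (C : 0 <= Rabs (sin (PI * (INR ts - e) / INR L)) ^ (2 * F)) by (apply pow_le, Rabs_pos).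
    assert (C' := Rabs_pos (sprod (INR L) (zeros E y L) (INR ts))). nra. }
  rewrite <- exp_INR in Hb2.
  assert (exp (- (2 / eps0) * INR (2 * F)) <= exp (- INR L)).
  { apply exp_le. assert (A : INR L <= 2 / eps0 * INR (2 * F)); [|lra].
    replace (INR L) with (2 / eps0 * (eps0 * INR L / 2)) by (field; lra).
    apply Rmult_le_compat_l; [left; apply Rdiv_lt_0_compat; lra|lra]. }
  lra. }
assert (Hleft : s * INR L <= INR i0 + / 2).
{ apply Hedge; [lra|]. rewrite Hets. eapply Rle_trans; [apply Rabs_sin_le|].
  rewrite Rabs_pos_eq; [lra|].
  apply Rmult_le_pos; [apply Rmult_le_pos; lra|left; apply Rinv_0_lt_compat; lra]. }
assert (Hright : s * INR L <= INR L - (INR i0 + / 2)).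
{ apply Hedge; [lra|]. rewrite Hets.
  replace (PI * (INR i0 + / 2) / INR L) with (PI - PI * (INR L - (INR i0 + / 2)) / INR L) by (field; lra).
  rewrite sin_PI_x. eapply Rle_trans; [apply Rabs_sin_le|].
  rewrite Rabs_pos_eq; [lra|].
  apply Rmult_le_pos; [apply Rmult_le_pos; lra|left; apply Rinv_0_lt_compat; lra]. }
assert (HtsR : INR ts <= 2 * INR x).
{ unfold ts. rewrite plus_INR, Hyx. lra. }
destruct (Hy1 ts) as (m0 & Hm0 & Hm0k & Hne); [unfold ts, y; lia|].
assert (Hm0R : INR ts < INR m0) by (apply lt_INR; auto).
assert (Hdist : INR m0 - INR ts <= kap * INR L).
{ assert (A1 : kap * r / 2 * INR ts <= kap * r / 2 * (2 * INR x)) by (apply Rmult_le_compat_l; [apply Rmult_le_pos; [apply Rmult_le_pos; lra|lra]|lra]).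
  assert (A2 : kap * (r * INR x) <= kap * INR L) by (apply Rmult_le_compat_l; lra). lra. }
assert (Hu1 : s * INR L <= INR m0 - e) by lra.
assert (Hu2 : INR m0 - e <= INR L - 3 / 4 * s * INR L) by lra.
assert (Hm0y : (y <= m0 < y + L)%nat).
{ split; [unfold ts in Hm0; lia|]. apply INR_lt. rewrite plus_INR. unfold e in Hu2. lra. }
assert (Hm0x : INR x <= INR m0 <= 2 * INR x).
{ split; [apply le_INR; unfold y in Hm0y; lia|]. assert (A : INR m0 + 1 <= INR y + INR L) by (rewrite <- S_INR, <- plus_INR; apply le_INR; lia). lra. }
set (Z := Rabs (psi m0)).
assert (Hsin0 : Rabs (sin (PI * (INR ts - INR m0) / INR L)) <= D).
{ eapply Rle_trans; [apply Rabs_sin_le|]. unfold Rdiv. rewrite !Rabs_mult.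
  rewrite (Rabs_pos_eq PI), (Rabs_left (INR ts - INR m0)) by lra.
  rewrite (Rabs_pos_eq (/ INR L)) by (left; apply Rinv_0_lt_compat; auto).
  apply Rle_div_l; [auto|].
  assert (PI * (INR m0 - INR ts) <= 4 * (INR m0 - INR ts)) by (apply Rmult_le_compat_r; lra). lra. }
(* between [ts] and [m0] the zeros at the sign changes cost half of [kp], the multiple zero
   the other half *)
assert (Hcmp : Rabs (psi ts) <= Z * exp (kp * INR L)).
{ unfold Z, psi. rewrite !Epsi, !Rabs_mult, <- !RPow_abs.
  assert (A := zeros_compare E y L (INR ts) m0 D Hm0y ltac:(lra) Hsin0).
  assert (HX : 0 <= 2 * D * INR L <= kap1 * INR L).
  { split; [apply Rmult_le_pos; lra|apply Rmult_le_compat_r; lra]. }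
  assert (HH := HHp L HLL1 (2 * D * INR L) L HX (le_n _)).
  assert (HH1 := harmonic_prod_ge_1 (2 * D * INR L) L ltac:(lra)).
  assert (HH4 : harmonic_prod (2 * D * INR L) L ^ 4 <= exp (kp / 2 * INR L)).
  { apply Rle_trans with (exp (kp / 8 * INR L) ^ 4); [apply pow_incr; lra|].
    rewrite <- exp_INR. right. f_equal. simpl (INR 4). field. }
  set (se := Rabs (sin (PI * (INR m0 - e) / INR L))).
  assert (Hse : s / 2 <= se).
  { assert (B := sin_dist_lower (INR m0 - e) (INR L) HLp). rewrite Rabs_pos_eq in B by lra.
    eapply Rle_trans; [|apply B; lra]. apply (proj1 (Rle_div_r _ _ _ HLp)).
    apply Rmin_glb; lra. }
  assert (Hfake : Rabs (sin (PI * (INR ts - e) / INR L)) ^ (2 * F) <= se ^ (2 * F) * exp (kp / 2 * INR L)).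
  { apply Rle_trans with ((se * (1 + D / (s / 2))) ^ (2 * F)).
    - apply pow_incr. split; [apply Rabs_pos|].
      eapply Rle_trans; [apply (sin_compare _ (PI * (INR m0 - e) / INR L) D)|].
      + replace (PI * (INR ts - e) / INR L - PI * (INR m0 - e) / INR L) with (PI * (INR ts - INR m0) / INR L) by (field; lra). auto.
      + intros h. unfold se in Hse. rewrite h, Rabs_R0 in Hse. lra.
      + fold se. apply Rmult_le_compat_l; [lra|]. apply Rplus_le_compat_l.
        apply Rmult_le_compat_l; [lra|]. apply Rinv_le_contravar; lra.
    - rewrite Rpow_mult_distr. apply Rmult_le_compat_l; [apply pow_le; lra|].
      apply pow_exp_le; [apply Rmult_le_pos; [lra|left; apply Rinv_0_lt_compat; lra]|].
      assert (B : D / (s / 2) <= kp / 2).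
      { apply Rle_div_l; [lra|]. lra. }
      assert (B0 : 0 <= D / (s / 2)) by (apply Rmult_le_pos; [lra|left; apply Rinv_0_lt_compat; lra]).
      assert (0 <= INR (2 * F)) by apply pos_INR.
      apply Rmult_le_compat; lra. }
  set (z0 := Rabs (sprod (INR L) (zeros E y L) (INR m0))) in *.
  assert (Hz0 : 0 <= z0) by apply Rabs_pos.
  apply Rle_trans with ((se ^ (2 * F) * exp (kp / 2 * INR L)) * (z0 * exp (kp / 2 * INR L))).
  - apply Rmult_le_compat; [apply pow_le, Rabs_pos|apply Rabs_pos|auto|].
    eapply Rle_trans; [apply A|]. apply Rmult_le_compat_l; auto.
  - right. replace (kp * INR L) with (kp / 2 * INR L + kp / 2 * INR L) by field. rewrite exp_plus. ring. }
assert (HZ : 0 < Z).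
{ assert (A := exp_pos (- INR L)). assert (B := exp_pos (kp * INR L)).
  apply Rnot_le_lt. intros h. assert (Z * exp (kp * INR L) <= 0 * exp (kp * INR L)) by (apply Rmult_le_compat_r; lra). lra. }
assert (Hpsi0 : a m0 <> 0 /\ psi m0 <> 0).
{ split; [auto|]. intros h. unfold Z in HZ. rewrite h, Rabs_R0 in HZ. lra. }
assert (Hin : forall m, Rabs (INR m - INR m0) <= s * r / 4 * INR m0 -> (y <= m < y + L)%nat).
{ intros m Hm. assert (Hb2 : s * r / 4 * INR m0 <= s * INR L / 2).
  { assert (B1 : r * INR m0 <= r * (2 * INR x)) by (apply Rmult_le_compat_l; lra).
    assert (B2 : s / 4 * (r * INR m0) <= s / 4 * (2 * INR L)) by (apply Rmult_le_compat_l; lra). lra. }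
  apply Rabs_le_between in Hm. unfold e in *.
  assert (A1 : INR y - 1 < INR m) by lra. assert (A2 : INR m < INR y + INR L) by lra.
  rewrite <- plus_INR in A2. apply INR_lt in A2.
  assert (INR y < INR (S m)) by (rewrite S_INR; lra). apply INR_lt in H. lia. }
assert (Hsg : forall m, (y <= m < y + L)%nat -> 0 <= psign E y L m * psi m).
{ intros m Hm. unfold psi. rewrite Epsi, pow_mult.
  assert (A := sprod_zeros_sign E y L m Hm).
  assert (B : 0 <= (sin (PI * (INR m - e) / INR L) ^ 2) ^ F) by (apply pow_le, pow2_ge_0).
  match goal with |- 0 <= ?u * (?v * ?w) => replace (u * (v * w)) with (v * (u * w)) by ring end.
  apply Rmult_le_pos; auto. }
set (w0 := a m0 * psign E y L m0).
assert (Hw0 : w0 <> 0).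
{ unfold w0. assert (A := psign_sq E y L m0). intros h. apply Rmult_integral in h. destruct h as [h|h]; [auto|]. rewrite h in A. lra. }
set (sg := if Rlt_dec 0 w0 then 1 else -1).
assert (HLm : INR L <= 2 * r * INR m0) by (apply Rle_trans with (2 * r * INR x); [lra|apply Rmult_le_compat_l; lra]).
apply (Hcore' m0 ltac:(unfold y in Hm0y; lia) Hne psi (Rabs (psi ts)) sg Hband Hmax).
- unfold sg. destruct Rlt_dec; auto.
- intros m Hm. apply Hin in Hm. destruct (Req_dec (a m) 0) as [h|h]; [rewrite h; lra|].
  assert (A := sign_coherent a y L m0 Hm0y Hne m Hm h). fold E in A. fold w0 in A.
  assert (B := Hsg m Hm). assert (C := psign_sq E y L m).
  set (q := psign E y L m) in *.
  replace (a m * psi m) with ((a m * q) * (q * psi m)) by (transitivity (a m * psi m * (q * q)); [ring|rewrite C; ring]).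
  unfold sg. destruct (Rlt_dec 0 w0) as [hw|hw].
  + assert (0 < a m * q) by (apply Rmult_lt_reg_r with w0; lra).
    rewrite Rmult_1_l. apply Rmult_le_pos; lra.
  + assert (w0 < 0) by lra. assert (Hneg : a m * q < 0) by (apply Rmult_lt_reg_r with (- w0); lra).
    assert (a m * q * (q * psi m) <= 0 * (q * psi m)) by (apply Rmult_le_compat_r; lra). lra.
- apply Rle_trans with (exp (- INR L) * exp (- (kp * INR L))).
  + rewrite <- exp_plus. apply exp_le.
    assert (kp * INR L <= 1 * INR L) by (apply Rmult_le_compat_r; lra).
    assert (4 * r * INR m0 <= eta / 2 * INR m0) by (apply Rmult_le_compat_r; lra).
    assert (0 <= eta * INR m0) by (apply Rmult_le_pos; lra). lra.
  + apply Rmult_le_reg_r with (exp (kp * INR L)); [apply exp_pos|].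
    rewrite Rmult_assoc, <- (exp_plus (- (kp * INR L))), Rplus_opp_l, exp_0. fold Z. lra.
- fold Z. eapply Rle_trans; [exact Hcmp|]. apply Rmult_le_compat_l; [lra|]. apply exp_le.
  assert (kp * INR L <= kp * (2 * r * INR m0)) by (apply Rmult_le_compat_l; lra).
  assert (kp * (4 * r) * INR m0 <= c * INR m0) by (apply Rmult_le_compat_r; lra).
  assert (0 <= kp * (4 * r) * INR m0) by (apply Rmult_le_pos; [apply Rmult_le_pos; lra|lra]). lra.
Qed.

(** * A measurable set of sign changes *)

Lemma sprod_root L l t e : In e l -> sin (PI * (t - e) / L) = 0 -> sprod L l t = 0.
Proof.
induction l as [|e' l IH]; intros H Hs; [contradiction|]. simpl.
destruct H as [->|H]; [rewrite Hs|rewrite IH]; auto; ring.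
Qed.

(** Here the multiplier vanishes at all integers of a period except those congruent to
    [m0], so agreement of signs near [m0] is automatic. *)
Lemma no_regular_circle a p M : 0 < p < 1 -> 0 <= M -> growth_upper a -> growth_lower a ->
  (forall N, exists m, (N <= m)%nat /\ a m <> 0) ->
  (forall th, Rabs th <= PI -> taylor_bounded a p M th) -> False.
Proof.
intros Hp HM Hup Hlow Hinf Htb. assert (HP := PI_RGT_0).
destruct (no_coherent_multiplier a p M PI Hp HM Hup Hlow Htb) as (eta & Heta & Hcore).
set (r := eta / 8). assert (Hr : 0 < r) by (unfold r; lra).
destruct (Hcore r Hr) as (c & m1 & Hc & Hcore').
destruct (INR_unbounded (1 / r)) as [N4 HN4].
destruct (Hinf (m1 + N4 + 2)%nat) as (m0 & Hm0 & Hne).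
assert (Hm0r : 1 < r * INR m0).
{ apply Rlt_div_l in HN4; [|auto]. assert (INR N4 <= INR m0) by (apply le_INR; lia). nra. }
destruct (nfloor_ex (r * INR m0)) as [L0 HL0]; [lra|]. set (L := S L0).
assert (HLR : r * INR m0 < INR L <= 2 * r * INR m0) by (unfold L; rewrite S_INR; lra).
assert (HL : 0 < INR L) by lra.
(* the zeros are all integers of the period [[m0, m0 + L)] but [m0] *)
set (l := map (fun j => INR (m0 + 1 + j)) (seq 0 L0)).
assert (Hlen : length l = L0) by (unfold l; rewrite length_map, length_seq; reflexivity).
set (psi := fun m => sprod (INR L) l (INR m)).
assert (Hmod : forall m, m mod L = m0 mod L -> Rabs (psi m) = Rabs (psi m0)).
{ intros m Hm. unfold psi. rewrite (sprod_mod L l m), (sprod_mod L l m0), Hm by (unfold L; lia). reflexivity. }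
assert (Hzero : forall m, m mod L <> m0 mod L -> psi m = 0).
{ intros m Hm. set (j := ((m + (L - 1) * (m0 + 1)) mod L)%nat).
  assert (Hj : (j < L)%nat) by (apply Nat.mod_upper_bound; unfold L; lia).
  assert (Hj2 : ((m0 + 1 + j) mod L = m mod L)%nat).
  { unfold j. rewrite Nat.Div0.add_mod_idemp_r.
    replace (m0 + 1 + (m + (L - 1) * (m0 + 1)))%nat with (m + (m0 + 1) * L)%nat by (unfold L; nia). apply Nat.Div0.mod_add. }
  assert (HjL : j <> L0).
  { intros h. apply Hm. rewrite <- Hj2, h. replace (m0 + 1 + L0)%nat with (m0 + 1 * L)%nat by (unfold L; lia).
    apply Nat.Div0.mod_add. }
  assert (E : Rabs (psi m) = 0).
  { unfold psi. rewrite (sprod_mod L l m), <- Hj2, <- sprod_mod by (unfold L; lia).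
    rewrite (sprod_root (INR L) l _ (INR (m0 + 1 + j))), Rabs_R0; [reflexivity| |].
    - unfold l. apply (in_map (fun j => INR (m0 + 1 + j))). apply in_seq. unfold L in Hj. lia.
    - replace (PI * (INR (m0 + 1 + j) - INR (m0 + 1 + j)) / INR L) with 0 by (field; lra). apply sin_0. }
  apply NNPP. intros h. apply Rabs_no_R0 in h. contradiction. }
set (Z := Rabs (psi m0)).
assert (HZ : exp (- INR L) <= Z).
{ destruct (sprod_large L l ltac:(rewrite Hlen; unfold L; lia)) as (t & _ & Ht).
  assert (A : exp (- INR L) <= (/ 2) ^ length l).
  { eapply Rle_trans; [|apply half_pow_exp]. apply exp_le. rewrite Hlen. unfold L. rewrite S_INR. lra. }
  fold (psi t) in Ht. assert (B := exp_pos (- INR L)).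
  destruct (Nat.eq_dec (t mod L) (m0 mod L)) as [h|h].
  - unfold Z. rewrite <- (Hmod t h). lra.
  - rewrite (Hzero t h), Rabs_R0 in Ht. lra. }
assert (Hbd : forall m, Rabs (psi m) <= Z).
{ intros m. destruct (Nat.eq_dec (m mod L) (m0 mod L)) as [h|h].
  - right. apply Hmod; auto.
  - rewrite (Hzero m h), Rabs_R0. apply Rabs_pos. }
assert (Hband : bandlimited PI psi).
{ apply sprod_bandlimited; [auto|]. rewrite Hlen. apply Rle_div_l; [auto|].
  rewrite Rmult_comm. apply Rmult_le_compat_l; [lra|]. apply le_INR. unfold L; lia. }
set (sg := if Rle_dec 0 (a m0 * psi m0) then 1 else -1).
apply (Hcore' m0 ltac:(lia) Hne psi Z sg Hband Hbd).
- unfold sg. destruct Rle_dec; auto.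
- intros m Hm. destruct (Nat.eq_dec m m0) as [->|hne].
  + unfold sg. destruct Rle_dec; lra.
  + rewrite Hzero; [lra|]. intros h.
    assert (E1 := Nat.div_mod_eq m L). assert (E2 := Nat.div_mod_eq m0 L).
    apply Rabs_le_between in Hm.
    assert (A1 : INR m < INR (m0 + L)) by (rewrite plus_INR; lra).
    assert (A2 : INR m0 < INR (m + L)) by (rewrite plus_INR; lra).
    apply INR_lt in A1. apply INR_lt in A2.
    assert ((m / L = m0 / L)%nat) by nia. apply hne. congruence.
- eapply Rle_trans; [|apply HZ]. apply exp_le. unfold r in *. lra.
- fold Z. rewrite <- (Rmult_1_r Z) at 1. apply Rmult_le_compat_l; [apply Rabs_pos|].
  apply exp_ge_1. apply Rmult_le_pos; [lra|apply pos_INR].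
Qed.

Lemma places_app E y n m : places E y (n + m) = (places E y n ++ places E (y + n) m)%list.
Proof. unfold places. rewrite seq_app, filter_app. reflexivity. Qed.

Lemma places_length_le E y n : (length (places E y n) <= n)%nat.
Proof. unfold places. rewrite <- (length_seq n y) at 2. apply filter_length_le. Qed.

Lemma count_upto_floor E m x : INR m <= x < INR m + 1 -> count_upto E x = length (places E 0 (S m)).
Proof.
intros Hx. unfold count_upto.
assert (Hup : Z.to_nat (up x) = S m).
{ rewrite <- (tech_up x (Z.of_nat (S m))); [apply Nat2Z.id| |]; rewrite <- INR_IZR_INZ, S_INR; lra. }
rewrite Hup, seq_S, filter_app, length_app. change (0 + S m)%nat with (S m).
assert (Hlast : length (filter (fun k => if excluded_middle_informative (E k /\ INR k <= x) then true else false) (S m :: nil)) = 0%nat).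
{ cbn [filter]. destruct (excluded_middle_informative _) as [[_ h]|h]; [|reflexivity].
  rewrite S_INR in h. lra. }
rewrite Hlast, Nat.add_0_r. unfold places. f_equal. apply filter_ext_in. intros k Hk.
apply in_seq in Hk. unfold chi.
assert (Hkx : INR k <= x) by (apply Rle_trans with (INR m); [apply le_INR; lia|lra]).
destruct (excluded_middle_informative (E k)); destruct (excluded_middle_informative (E k /\ INR k <= x)); tauto.
Qed.

Lemma has_density_intro E d :
  (forall eps, 0 < eps -> exists N, forall m, (N <= m)%nat ->
     Rabs (INR (length (places E 0 (S m))) - d * INR m) <= eps * INR m) -> has_density E d.
Proof.
intros H. unfold has_density. apply is_lim_spec. intros [eps He]. simpl.
destruct (H (eps / 4)) as [N HN]; [lra|].
exists (Rmax (INR N + 1) (4 * Rabs d / eps + 1)). intros x Hx.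
assert (Hx1 : INR N + 1 < x) by (eapply Rle_lt_trans; [apply Rmax_l|apply Hx]).
assert (Hx2 : 4 * Rabs d / eps + 1 < x) by (eapply Rle_lt_trans; [apply Rmax_r|apply Hx]).
assert (HN0 := pos_INR N).
destruct (nfloor_ex x) as [m Hm]; [lra|].
assert (HmN : (N <= m)%nat). { assert (A : INR N < INR m + 1) by lra. rewrite <- S_INR in A. apply INR_lt in A. lia. }
rewrite (count_upto_floor E m x) by lra. specialize (HN m HmN).
set (n := INR (length (places E 0 (S m)))) in *.
assert (Hd : 4 * Rabs d < eps * x).
{ assert (A : 4 * Rabs d / eps < x) by lra. apply Rlt_div_l in A; lra. }
assert (E1 : n / x - d = (n - d * INR m - d * (x - INR m)) / x) by (field; lra).
rewrite E1. unfold Rdiv. rewrite Rabs_mult, (Rabs_pos_eq (/ x)) by (left; apply Rinv_0_lt_compat; lra).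
apply (proj2 (Rlt_div_l _ eps x ltac:(lra))).
assert (A : Rabs (n - d * INR m - d * (x - INR m)) <= Rabs (n - d * INR m) + Rabs d * 1).
{ unfold Rminus at 1. eapply Rle_trans; [apply Rabs_triang|]. apply Rplus_le_compat_l.
  rewrite Rabs_Ropp, Rabs_mult. apply Rmult_le_compat_l; [apply Rabs_pos|]. rewrite Rabs_pos_eq; lra. }
assert (eps / 4 * INR m <= eps / 4 * x) by (apply Rmult_le_compat_l; lra).
assert (0 < eps * x) by (apply Rmult_lt_0_compat; lra). lra.
Qed.

Lemma has_density_elim E d : has_density E d -> forall eps, 0 < eps -> exists N, forall m, (N <= m)%nat ->
     Rabs (INR (length (places E 0 (S m))) - d * INR m) <= eps * INR m.
Proof.
intros H eps He. unfold has_density in H. apply is_lim_spec in H.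
destruct (H (mkposreal eps He)) as [M HM]. simpl in HM.
destruct (INR_unbounded (Rmax M 0)) as [N HN]. exists N. intros m Hm. apply le_INR in Hm.
assert (M < INR m) by (assert (A := Rmax_l M 0); lra).
assert (Hm0 : 0 < INR m) by (assert (A := Rmax_r M 0); lra).
specialize (HM (INR m) H0). rewrite (count_upto_floor E m (INR m)) in HM by lra.
replace (INR (length (places E 0 (S m))) - d * INR m) with ((INR (length (places E 0 (S m))) / INR m - d) * INR m) by (field; lra).
rewrite Rabs_mult, (Rabs_pos_eq (INR m)) by lra. apply Rmult_le_compat_r; lra.
Qed.

(** Number of elements selected up to [m], when an element is taken as soon as
    this keeps the count below [d m]. *)
Fixpoint greedy (E : nat -> Prop) (d : R) (m : nat) : nat :=
  match m with
  | O => O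
  | S m' => if chi E (S m') then
              if Rle_dec (INR (greedy E d m') + 1) (d * INR (S m')) then S (greedy E d m') else greedy E d m'
            else greedy E d m'
  end.

Lemma greedy_S E d m : greedy E d (S m) =
  if chi E (S m) then if Rle_dec (INR (greedy E d m) + 1) (d * INR (S m)) then S (greedy E d m) else greedy E d m
  else greedy E d m.
Proof. reflexivity. Qed.

Definition selected (E : nat -> Prop) (d : R) (m : nat) : Prop :=
  match m with O => False | S m' => greedy E d (S m') <> greedy E d m' end.

Lemma selected_sub E d m : selected E d m -> E m.
Proof.
destruct m as [|m]; [contradiction|]. simpl. destruct (chi E (S m)) eqn:h; [|tauto].
intros _. apply chi_true; auto.
Qed.

Lemma selected_count E d m : length (places (selected E d) 0 (S m)) = greedy E d m.
Proof.
induction m.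
- rewrite places_S. replace (chi (selected E d) (0 + 0)) with false; [reflexivity|].
  symmetry. apply chi_false. simpl. tauto.
- rewrite places_S, length_app, IHm. change (0 + S m)%nat with (S m).
  destruct (chi (selected E d) (S m)) eqn:h.
  + apply chi_true in h. simpl in *. destruct (chi E (S m)); [|tauto]. destruct Rle_dec; [lia|tauto].
  + apply chi_false in h. unfold selected in h. apply NNPP in h. rewrite h. simpl. lia.
Qed.

Lemma greedy_le E d m : 0 <= d -> INR (greedy E d m) <= d * INR m.
Proof.
intros Hd. induction m; [simpl; lra|].
assert (A : d * INR m <= d * INR (S m)) by (apply Rmult_le_compat_l; [auto|rewrite S_INR; lra]).
rewrite greedy_S. destruct (chi E (S m)); [|lra].
destruct (Rle_dec (INR (greedy E d m) + 1) (d * INR (S m))) as [h|h]; [|lra].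
rewrite (S_INR (greedy E d m)). lra.
Qed.

(** Consider the last place [y] at which an element was refused: the count was then above
    [d y - 1], and after [y] every element is selected. *)
Lemma greedy_last_skip E d m : exists y, (y <= m)%nat /\ d * INR y - INR (greedy E d y) < 1 /\
  greedy E d m = (greedy E d y + length (places E (S y) (m - y)))%nat.
Proof.
induction m as [|m (y & Hy & Hd & Hg)].
- exists 0%nat. simpl. repeat split; [lia|lra].
- assert (Hpl : length (places E (S y) (S m - y)) = (length (places E (S y) (m - y)) + if chi E (S m) then 1 else 0)%nat).
  { replace (S m - y)%nat with (S (m - y)) by lia. rewrite places_S, length_app.
    replace (S y + (m - y))%nat with (S m) by lia. destruct (chi E (S m)); reflexivity. }
  destruct (chi E (S m)) eqn:h.
  + destruct (Rle_dec (INR (greedy E d m) + 1) (d * INR (S m))) as [h1|h1].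
    * exists y. split; [lia|]. split; [auto|]. rewrite Hpl, greedy_S, h. destruct Rle_dec; [lia|contradiction].
    * assert (Eg : greedy E d (S m) = greedy E d m).
      { rewrite greedy_S, h. destruct Rle_dec; [contradiction|reflexivity]. }
      exists (S m). split; [lia|]. split; [rewrite Eg; lra|].
      replace (S m - S m)%nat with 0%nat by lia. simpl length. lia.
  + exists y. split; [lia|]. split; [auto|]. rewrite Hpl, greedy_S, h. lia.
Qed.

(** The interval is cut into consecutive windows of length proportional to their left
    end; only the last, incomplete one is lost. *)
Lemma count_by_tiling E De r x1 : 0 <= De <= 1 -> 0 < r -> 1 <= r * INR x1 ->
  (forall x, (x1 <= x)%nat -> forall L, r * INR x <= INR L <= 2 * r * INR x ->
     De * INR L <= INR (length (places E (S x) L))) ->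
  forall n y m, (m - y <= n)%nat -> (x1 <= y <= m)%nat ->
    De * INR (m - y) - (r * INR m + 1) <= INR (length (places E (S y) (m - y))).
Proof.
intros HDe Hr Hx1 HW. induction n; intros y m Hn Hy.
- replace (m - y)%nat with 0%nat by lia. simpl. assert (A := pos_INR m). nra.
- assert (Hyx : r * INR x1 <= r * INR y) by (apply Rmult_le_compat_l; [lra|apply le_INR; lia]).
  destruct (nfloor_ex (r * INR y)) as [L0 HL0]; [lra|]. set (L := S L0).
  assert (HL : r * INR y <= INR L <= 2 * r * INR y) by (unfold L; rewrite S_INR; lra).
  destruct (le_lt_dec L (m - y)) as [h|h].
  + assert (A := HW y ltac:(lia) L HL).
    assert (B := IHn (y + L)%nat m ltac:(unfold L; lia) ltac:(lia)).
    replace (m - y)%nat with (L + (m - (y + L)))%nat by lia.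
    rewrite places_app, length_app, !plus_INR. replace (S y + L)%nat with (S (y + L)) by lia. lra.
  + assert (A := pos_INR (length (places E (S y) (m - y)))).
    assert (B : INR (m - y) <= INR L0) by (apply le_INR; unfold L in h; lia).
    assert (C : r * INR y <= r * INR m) by (apply Rmult_le_compat_l; [lra|apply le_INR; lia]).
    assert (D : De * INR (m - y) <= 1 * INR (m - y)) by (apply Rmult_le_compat_r; [apply pos_INR|lra]). lra.
Qed.

Lemma greedy_density E De : 0 <= De <= 1 ->
  (exists r0, 0 < r0 /\ forall r, 0 < r < r0 -> exists x1, forall x, (x1 <= x)%nat ->
    forall L, r * INR x <= INR L <= 2 * r * INR x ->
    De * INR L <= INR (length (places E (S x) L))) ->
  has_density (selected E De) De.
Proof.
intros HDe (r0 & Hr0 & HW). apply has_density_intro. intros eps He.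
set (r := Rmin (r0 / 2) (eps / 2)).
assert (Hr : 0 < r) by (apply Rmin_glb_lt; lra).
assert (Hr1 : r <= r0 / 2) by apply Rmin_l. assert (Hr2 : r <= eps / 2) by apply Rmin_r.
destruct (HW r) as [x1' HW']; [lra|].
destruct (INR_unbounded (1 / r)) as [N1 HN1]. set (x1 := (x1' + N1)%nat).
assert (Hx1 : 1 <= r * INR x1).
{ apply Rlt_div_l in HN1; [|auto]. assert (INR N1 <= INR x1) by (apply le_INR; unfold x1; lia). nra. }
assert (HT := count_by_tiling E De r x1 HDe Hr Hx1 ltac:(intros; apply HW'; unfold x1 in *; auto; lia)).
destruct (INR_unbounded ((2 + INR x1) / (eps / 2))) as [N2 HN2].
exists N2. intros m Hm. rewrite selected_count.
assert (Hup := greedy_le E De m ltac:(lra)).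
assert (HmR : INR N2 <= INR m) by (apply le_INR; auto).
assert (Hm2 : 2 + INR x1 <= eps / 2 * INR m).
{ apply Rlt_div_l in HN2; [|lra]. nra. }
rewrite Rabs_left1 by lra.
destruct (greedy_last_skip E De m) as (y & Hy & Hd & Hg).
assert (Hgm : INR (greedy E De m) = INR (greedy E De y) + INR (length (places E (S y) (m - y)))) by (rewrite Hg; apply plus_INR).
assert (Hmy : INR (m - y) = INR m - INR y) by (apply minus_INR; auto).
assert (Hcnt : De * INR (m - y) - (r * INR m + 1 + INR x1) <= INR (length (places E (S y) (m - y)))).
{ assert (Hx0 := pos_INR x1). assert (Hm0 := pos_INR m).
  assert (Hrm : 0 <= r * INR m) by (apply Rmult_le_pos; lra).
  destruct (le_lt_dec x1 y) as [h|h].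
  - assert (A := HT (m - y)%nat y m ltac:(lia) ltac:(lia)). lra.
  - destruct (le_lt_dec x1 m) as [h1|h1].
    + assert (A := HT (m - x1)%nat x1 m ltac:(lia) ltac:(lia)).
      replace (m - y)%nat with ((x1 - y) + (m - x1))%nat by lia.
      rewrite places_app, length_app, !plus_INR. replace (S y + (x1 - y))%nat with (S x1) by lia.
      assert (B := pos_INR (length (places E (S y) (x1 - y)))).
      assert (C : INR (x1 - y) <= INR x1) by (apply le_INR; lia).
      assert (D : De * INR (x1 - y) <= 1 * INR (x1 - y)) by (apply Rmult_le_compat_r; [apply pos_INR|lra]). lra.
    + assert (B := pos_INR (length (places E (S y) (m - y)))).
      assert (C : INR (m - y) <= INR x1) by (apply le_INR; lia).
      assert (D : De * INR (m - y) <= 1 * INR (m - y)) by (apply Rmult_le_compat_r; [apply pos_INR|lra]). lra. }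
rewrite Hmy in Hcnt.
assert (r * INR m <= eps / 2 * INR m) by (apply Rmult_le_compat_r; [apply pos_INR|auto]).
lra.
Qed.

(** A level [(Delta + b) / 2] strictly between [Delta] and the angle [pi b] to which
    regularity extends is reached in all windows, hence by a measurable subset. *)
Lemma density_implies_singular (Delta : R) (hDelta : 0 <= Delta <= 1) (Lambda : nat -> Prop) :
  (forall Lambda' : nat -> Prop, (forall m : nat, Lambda' m -> Lambda m) ->
     forall d : R, has_density Lambda' d -> d <= Delta) ->
  forall a : nat -> R, CV_radius a = Finite 1 -> root_limit_one_on_support a ->
    (forall m : nat, sign_change_at a m -> Lambda m) -> singular_on a (on_arc Delta).
Proof.
intros Hdens a HR Hroot Hsc. apply NNPP. intros Hns. assert (HP := PI_RGT_0).
assert (Hup := growth_upper_of_radius a HR). assert (Hlow := growth_lower_of_root_limit a Hroot).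
assert (Hinf := support_infinite a HR).
destruct (taylor_bounded_arc a (PI * Delta)) as (d & p & M & Hd & Hp & HM & Htb).
{ apply Rmult_le_pos; lra. }
{ intros th Hth. apply NNPP. intros h. apply Hns. exists (cis th). split; [|auto]. exists th. split; auto. }
destruct (Rle_lt_dec 1 Delta) as [h1|h1].
- apply (no_regular_circle a p M Hp ltac:(lra) Hup Hlow Hinf). intros th Hth. apply Htb. nra.
- set (b := Delta + Rmin (d / PI) ((1 - Delta) / 2)).
  assert (Hb : Delta < b).
  { unfold b. assert (0 < Rmin (d / PI) ((1 - Delta) / 2)); [|lra].
    apply Rmin_glb_lt; [apply Rdiv_lt_0_compat; lra|lra]. }
  assert (Hb1 : b < 1) by (unfold b; assert (A := Rmin_r (d / PI) ((1 - Delta) / 2)); lra).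
  assert (HbP : PI * b <= PI * Delta + d).
  { unfold b. rewrite Rmult_plus_distr_l. apply Rplus_le_compat_l.
    apply Rle_trans with (PI * (d / PI)); [apply Rmult_le_compat_l; [lra|apply Rmin_l]|right; field; lra]. }
  assert (HW := many_sign_changes a p M b ((Delta + b) / 2) Hp ltac:(lra) Hup Hlow Hinf ltac:(lra) Hb1 ltac:(intros; apply Htb; lra)).
  assert (HG := greedy_density (sign_change_at a) ((Delta + b) / 2) ltac:(lra) HW).
  assert (A := Hdens _ (fun m h => Hsc m (selected_sub _ _ m h)) _ HG). lra.
Qed.

(** * The logarithm of the sine as a kernel *)

(** Abel summation against a monotone weight. *)
Lemma abel_incr x v n B V : 0 <= V -> (forall k, (k <= n)%nat -> Rabs (Rsum x k) <= B) ->
  (forall i, (S i < n)%nat -> v i <= v (S i)) ->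
  (forall i, (i < n)%nat -> Rabs (v i) <= V) -> Rabs (Rsum (fun i => x i * v i) n) <= 3 * B * V.
Proof.
intros HV0 Hx Hv HV.
assert (HB : 0 <= B) by (eapply Rle_trans; [apply Rabs_pos|apply (Hx 0%nat); lia]).
destruct n as [|n].
{ simpl. rewrite Rabs_R0. apply Rmult_le_pos; lra. }
assert (H : forall k, (k <= n)%nat ->
  Rabs (Rsum (fun i => x i * v i) (S k) - Rsum x (S k) * v k) <= B * (v k - v 0%nat)).
{ induction k; intros Hk.
  - simpl. replace (0 + x 0%nat * v 0%nat - (0 + x 0%nat) * v 0%nat) with 0 by ring. rewrite Rabs_R0. lra.
  - change (Rsum (fun i => x i * v i) (S (S k))) with (Rsum (fun i => x i * v i) (S k) + x (S k) * v (S k)).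
    change (Rsum x (S (S k))) with (Rsum x (S k) + x (S k)).
    set (A := Rsum (fun i => x i * v i) (S k)) in *. set (X := Rsum x (S k)) in *.
    replace (A + x (S k) * v (S k) - (X + x (S k)) * v (S k))
      with ((A - X * v k) + X * (v k - v (S k))) by ring.
    eapply Rle_trans; [apply Rabs_triang|]. specialize (IHk ltac:(lia)).
    assert (B1 : Rabs (X * (v k - v (S k))) <= B * (v (S k) - v k)).
    { rewrite Rabs_mult. specialize (Hv k ltac:(lia)). rewrite (Rabs_left1 (v k - _)) by lra.
      replace (- (v k - v (S k))) with (v (S k) - v k) by ring.
      apply Rmult_le_compat_r; [lra|]. apply Hx; lia. }
    lra. }
specialize (H n (le_n _)). assert (H0 := HV 0%nat ltac:(lia)). assert (Hn := HV n ltac:(lia)).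
assert (HX := Hx (S n) (le_n _)).
set (X := Rsum x (S n)) in *.
assert (B1 : Rabs (X * v n) <= B * V) by (rewrite Rabs_mult; apply Rmult_le_compat; auto; apply Rabs_pos).
apply Rabs_le_between in H0. apply Rabs_le_between in Hn.
assert (B * (v n - v 0%nat) <= B * (2 * V)) by (apply Rmult_le_compat_l; lra).
set (A := Rsum (fun i => x i * v i) (S n)) in *.
replace A with ((A - X * v n) + X * v n) by ring.
eapply Rle_trans; [apply Rabs_triang|]. lra.
Qed.

Lemma abel_decr x v n B V : 0 <= V -> (forall k, (k <= n)%nat -> Rabs (Rsum x k) <= B) ->
  (forall i, (S i < n)%nat -> v (S i) <= v i) ->
  (forall i, (i < n)%nat -> Rabs (v i) <= V) -> Rabs (Rsum (fun i => x i * v i) n) <= 3 * B * V.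
Proof.
intros HV0 Hx Hv HV. rewrite <- Rabs_Ropp.
replace (- Rsum (fun i => x i * v i) n) with (Rsum (fun i => x i * - v i) n).
- apply abel_incr; auto.
  + intros i Hi. specialize (Hv i Hi). lra.
  + intros i Hi. rewrite Rabs_Ropp; auto.
- rewrite <- (Rmult_1_l (Rsum (fun i => x i * v i) n)), Ropp_mult_distr_l, <- Rsum_scal.
  apply Rsum_ext. intros; ring.
Qed.

(** Logarithm of the factor contributed by a zero at distance [k + 1/2].  On the circle of
    length [L] the kernel is symmetric, singular at both ends and increasing up to the
    middle. *)
Definition log_sine (L k : nat) : R := ln (sin (PI * (INR k + / 2) / INR L)).

Lemma log_sine_sin_pos L k : (k < L)%nat -> 0 < sin (PI * (INR k + / 2) / INR L) <= 1.
Proof.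
intros Hk. assert (HP := PI_RGT_0). assert (HL : 0 < INR L) by (apply lt_0_INR; lia).
assert (Hk0 := pos_INR k). assert (Hk1 : INR k + 1 <= INR L) by (rewrite <- S_INR; apply le_INR; lia).
split; [|apply SIN_bound]. apply sin_gt_0.
- apply Rdiv_lt_0_compat; [apply Rmult_lt_0_compat; lra|auto].
- apply (proj2 (Rlt_div_l _ PI _ HL)). apply Rmult_lt_compat_l; lra.
Qed.

Lemma log_sine_sym L k : (k < L)%nat -> log_sine L (L - 1 - k) = log_sine L k.
Proof.
intros Hk. assert (HL : 0 < INR L) by (apply lt_0_INR; lia). unfold log_sine. f_equal.
rewrite !minus_INR by lia. rewrite <- sin_PI_x. f_equal. simpl (INR 1). field. lra.
Qed.

Lemma log_sine_nonpos L k : (k < L)%nat -> log_sine L k <= 0.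
Proof.
intros Hk. destruct (log_sine_sin_pos L k Hk) as [H1 [H2|H2]]; unfold log_sine.
- rewrite <- ln_1. left. apply ln_increasing; auto.
- rewrite H2, ln_1. lra.
Qed.

Lemma log_sine_incr h k : (S k < h)%nat -> log_sine (2 * h) k <= log_sine (2 * h) (S k).
Proof.
intros Hk. assert (HP := PI_RGT_0). assert (HL : 0 < INR (2 * h)) by (apply lt_0_INR; lia).
assert (Hk0 := pos_INR k). assert (Hk1 : INR k + 2 <= INR h) by (change 2 with (INR 2); rewrite <- plus_INR; apply le_INR; lia).
assert (EL : INR (2 * h) = 2 * INR h) by (rewrite mult_INR; reflexivity).
unfold log_sine. left. apply ln_increasing; [apply log_sine_sin_pos; lia|].
rewrite S_INR. apply sin_increasing_1.
- apply Rle_trans with 0; [lra|]. apply Rmult_le_pos; [apply Rmult_le_pos; lra|left; apply Rinv_0_lt_compat; lra].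
- apply Rle_div_l; [auto|]. rewrite EL. nra.
- apply Rle_trans with 0; [lra|]. apply Rmult_le_pos; [apply Rmult_le_pos; lra|left; apply Rinv_0_lt_compat; lra].
- apply Rle_div_l; [auto|]. rewrite EL. nra.
- unfold Rdiv. apply Rmult_lt_compat_r; [apply Rinv_0_lt_compat; auto|]. apply Rmult_lt_compat_l; lra.
Qed.

Lemma ln_le_sqrt x : 0 < x -> ln x <= 2 * sqrt x.
Proof.
intros Hx. assert (Hs := sqrt_lt_R0 x Hx).
replace (ln x) with (2 * ln (sqrt x)).
- assert (A := exp_ineq1_le (ln (sqrt x))). rewrite exp_ln in A by auto. lra.
- rewrite <- (sqrt_sqrt x) at 2 by lra. rewrite ln_mult by auto. ring.
Qed.

Lemma log_sine_lower h k : (k < h)%nat -> (INR k + / 2) / INR (2 * h) <= sin (PI * (INR k + / 2) / INR (2 * h)).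
Proof.
intros Hk. assert (HL : 0 < INR (2 * h)) by (apply lt_0_INR; lia).
assert (EL : INR (2 * h) = 2 * INR h) by (rewrite mult_INR; reflexivity).
assert (Hk0 := pos_INR k). assert (Hk1 : INR k + 1 <= INR h) by (rewrite <- S_INR; apply le_INR; lia).
assert (A := sin_dist_lower (INR k + / 2) (INR (2 * h)) HL). rewrite Rabs_pos_eq in A by lra.
rewrite Rmin_left in A by lra. rewrite Rabs_pos_eq in A by (left; apply log_sine_sin_pos; lia).
apply A. lra.
Qed.

Lemma log_sine_abs h k : (k < h)%nat -> Rabs (log_sine (2 * h) k) <= 2 * sqrt (2 * INR (2 * h)) * / sqrt (INR k + 1).
Proof.
intros Hk. assert (HL : 0 < INR (2 * h)) by (apply lt_0_INR; lia).
assert (Hk0 := pos_INR k). rewrite Rabs_left1 by (apply log_sine_nonpos; lia). unfold log_sine.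
assert (Hp := proj1 (log_sine_sin_pos (2 * h) k ltac:(lia))). assert (Hl := log_sine_lower h k Hk).
rewrite <- ln_Rinv by auto.
rewrite Rmult_assoc, <- sqrt_inv, <- sqrt_mult; [|lra|left; apply Rinv_0_lt_compat; lra].
assert (Hq : 0 < (INR k + / 2) / INR (2 * h)) by (apply Rdiv_lt_0_compat; lra).
apply Rle_trans with (ln (2 * INR (2 * h) * / (INR k + 1))).
- assert (Hle : / sin (PI * (INR k + / 2) / INR (2 * h)) <= 2 * INR (2 * h) * / (INR k + 1)).
  { apply Rle_trans with (/ ((INR k + / 2) / INR (2 * h))); [apply Rinv_le_contravar; auto|].
    replace (/ ((INR k + / 2) / INR (2 * h))) with (INR (2 * h) / (INR k + / 2)) by (field; lra).
    replace (2 * INR (2 * h) * / (INR k + 1)) with (2 * INR (2 * h) / (INR k + 1)) by reflexivity.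
    apply inv_le_of; lra. }
  destruct Hle as [Hlt|He]; [left; apply ln_increasing; [apply Rinv_0_lt_compat; auto|auto]|rewrite He; lra].
- apply ln_le_sqrt. apply Rmult_lt_0_compat; [lra|apply Rinv_0_lt_compat; lra].
Qed.

Lemma sum_inv_sqrt q : Rsum (fun k => / sqrt (INR k + 1)) q <= 2 * sqrt (INR q).
Proof.
induction q; [simpl; rewrite sqrt_0; lra|]. simpl Rsum. rewrite S_INR.
assert (Hq := pos_INR q).
assert (E1 := sqrt_sqrt (INR q) Hq). assert (E2 := sqrt_sqrt (INR q + 1) ltac:(lra)).
assert (P1 := sqrt_pos (INR q)). assert (P2 := sqrt_lt_R0 (INR q + 1) ltac:(lra)).
set (s := sqrt (INR q)) in *. set (t := sqrt (INR q + 1)) in *.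
assert (H : / t <= 2 * t - 2 * s); [|lra].
apply Rmult_le_reg_r with t; [auto|]. rewrite Rinv_l by lra. nra.
Qed.

Lemma log_sine_near h q : (q <= h)%nat -> Rsum (fun k => Rabs (log_sine (2 * h) k)) q <= 4 * sqrt (2 * INR (2 * h)) * sqrt (INR q).
Proof.
intros Hq. eapply Rle_trans.
- apply Rsum_le. intros k Hk. apply log_sine_abs. lia.
- rewrite Rsum_scal. assert (A := sum_inv_sqrt q). assert (B := sqrt_pos (2 * INR (2 * h))). nra.
Qed.

Lemma Rsum_rev f n : Rsum f n = Rsum (fun i => f (n - 1 - i)%nat) n.
Proof.
induction n; [reflexivity|]. rewrite (Rsum_head (fun i => f (S n - 1 - i)%nat)).
simpl Rsum at 1. rewrite IHn, Rplus_comm. f_equal; [f_equal; lia|].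
apply Rsum_ext. intros i Hi. f_equal. lia.
Qed.

Lemma Rsum_Rabs f n : Rabs (Rsum f n) <= Rsum (fun i => Rabs (f i)) n.
Proof. induction n; simpl; [rewrite Rabs_R0; lra|]. eapply Rle_trans; [apply Rabs_triang|lra]. Qed.

(** Away from the [q] places nearest to each singular end the kernel is bounded by
    [ln(2 L / q)] and monotone on each half, so Abel summation exploits the small
    partial sums of [x]; near the ends the kernel is summable. *)
Lemma log_sine_correlation h q (x : nat -> R) B : (1 <= q <= h)%nat ->
  (forall k, Rabs (x k) <= 1) -> (forall k, (k <= 2 * h)%nat -> Rabs (Rsum x k) <= B) ->
  Rabs (Rsum (fun k => x k * log_sine (2 * h) k) (2 * h)) <=
    12 * B * ln (2 * INR (2 * h) / INR q) + 8 * sqrt (2 * INR (2 * h)) * sqrt (INR q).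
Proof.
intros Hq Hx1 HxB. set (L := (2 * h)%nat). set (V := ln (2 * INR L / INR q)).
assert (HL : 0 < INR L) by (apply lt_0_INR; unfold L; lia).
assert (Hq0 : 1 <= INR q) by (change 1 with (INR 1); apply le_INR; lia).
assert (HqL : INR q <= INR L) by (apply le_INR; unfold L; lia).
assert (HV0 : 0 <= V).
{ unfold V. rewrite <- ln_1.
  assert (A : 1 < 2 * INR L / INR q) by (apply (proj1 (Rlt_div_r 1 (2 * INR L) (INR q) ltac:(lra))); lra).
  left. apply ln_increasing; lra. }
assert (HVh : forall k, (q <= k < h)%nat -> Rabs (log_sine L k) <= V).
{ intros k Hk. rewrite Rabs_left1 by (apply log_sine_nonpos; unfold L; lia).
  assert (Hp := proj1 (log_sine_sin_pos L k ltac:(unfold L; lia))). assert (Hl := log_sine_lower h k ltac:(lia)). fold L in Hl.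
  unfold V, log_sine. rewrite <- ln_Rinv by auto.
  assert (Hkq : INR q <= INR k) by (apply le_INR; lia).
  assert (Hle : / sin (PI * (INR k + / 2) / INR L) <= 2 * INR L / INR q).
  { assert (Hq1 : 0 < (INR k + / 2) / INR L) by (apply Rdiv_lt_0_compat; lra).
    apply Rle_trans with (/ ((INR k + / 2) / INR L)); [apply Rinv_le_contravar; auto|].
    replace (/ ((INR k + / 2) / INR L)) with (INR L / (INR k + / 2)) by (field; lra).
    apply inv_le_of; lra. }
  destruct Hle as [Hlt|He]; [left; apply ln_increasing; [apply Rinv_0_lt_compat; auto|auto]|rewrite He; lra]. }
assert (HVL : forall k, (h <= k < L - q)%nat -> Rabs (log_sine L k) <= V).
{ intros k Hk. rewrite <- log_sine_sym by lia. apply HVh. unfold L in *. lia. }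
assert (Hseg : forall s k, (s + k <= L)%nat -> Rabs (Rsum (fun i => x (s + i)%nat) k) <= 2 * B).
{ intros s k Hsk. assert (E := Rsum_split x s k).
  assert (A1 := HxB (s + k)%nat Hsk). assert (A2 := HxB s ltac:(unfold L in Hsk; lia)).
  apply Rabs_le. apply Rabs_le_between in A1. apply Rabs_le_between in A2. lra. }
assert (EL : L = (q + ((h - q) + ((h - q) + q)))%nat) by (unfold L; lia).
rewrite (f_equal (Rsum (fun k => x k * log_sine L k)) EL), !Rsum_split.
assert (N1 : Rabs (Rsum (fun k => x k * log_sine L k) q) <= 4 * sqrt (2 * INR L) * sqrt (INR q)).
{ eapply Rle_trans; [apply Rsum_Rabs|]. eapply Rle_trans; [|apply log_sine_near; lia].
  apply Rsum_le. intros k _. rewrite Rabs_mult. assert (A := Rabs_pos (log_sine L k)). specialize (Hx1 k). fold L. nra. }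
assert (N2 : Rabs (Rsum (fun i => x (q + (i))%nat * log_sine L (q + i)%nat) (h - q)) <= 3 * (2 * B) * V).
{ apply (abel_incr (fun i => x (q + i)%nat) (fun i => log_sine L (q + i)%nat)); auto.
  - intros k Hk. apply Hseg. unfold L; lia.
  - intros i Hi. rewrite Nat.add_succ_r. apply log_sine_incr. lia.
  - intros i Hi. apply HVh. lia. }
assert (N3 : Rabs (Rsum (fun i => x (q + (h - q + i))%nat * log_sine L (q + (h - q + i))%nat) (h - q)) <= 3 * (2 * B) * V).
{ apply (abel_decr (fun i => x (q + (h - q + i))%nat) (fun i => log_sine L (q + (h - q + i))%nat)); auto.
  - intros k Hk. rewrite (Rsum_ext _ (fun i => x (h + i)%nat)) by (intros; f_equal; lia). apply Hseg. unfold L; lia.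
  - intros i Hi. rewrite <- (log_sine_sym L (q + (h - q + S i))), <- (log_sine_sym L (q + (h - q + i))) by (unfold L; lia).
    replace (L - 1 - (q + (h - q + i)))%nat with (S (L - 1 - (q + (h - q + S i)))) by (unfold L; lia).
    apply log_sine_incr. unfold L. lia.
  - intros i Hi. apply HVL. unfold L. lia. }
assert (N4 : Rabs (Rsum (fun i => x (q + (h - q + (h - q + i)))%nat * log_sine L (q + (h - q + (h - q + i)))%nat) q)
   <= 4 * sqrt (2 * INR L) * sqrt (INR q)).
{ eapply Rle_trans; [apply Rsum_Rabs|]. eapply Rle_trans; [|apply (log_sine_near h q); lia].
  rewrite (Rsum_rev (fun k => Rabs (log_sine (2 * h) k))). apply Rsum_le. intros k Hk. rewrite Rabs_mult. fold L.
  rewrite <- (log_sine_sym L (q + (h - q + (h - q + k)))) by (unfold L; lia).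
  replace (L - 1 - (q + (h - q + (h - q + k))))%nat with (q - 1 - k)%nat by (unfold L; lia).
  assert (A := Rabs_pos (log_sine L (q - 1 - k))). specialize (Hx1 (q + (h - q + (h - q + k)))%nat). nra. }
cbv beta.
eapply Rle_trans; [apply Rabs_triang|]. eapply Rle_trans; [apply Rplus_le_compat; [apply N1|]|].
{ eapply Rle_trans; [apply Rabs_triang|]. apply Rplus_le_compat; [apply N2|].
  eapply Rle_trans; [apply Rabs_triang|]. apply Rplus_le_compat; [apply N3|apply N4]. }
lra.
Qed.

(** * Products of sines over a measurable set *)

(** Sums over a full period do not depend on the starting point; placing the singularity
    of the kernel at the origin requires such a rotation. *)
Lemma Rsum_rot F s L : (s <= L)%nat -> Rsum F L = Rsum (fun k => F ((s + k) mod L)%nat) L.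
Proof.
intros Hs. destruct (Nat.eq_dec L 0) as [->|HL]; [reflexivity|].
assert (E1 : L = (s + (L - s))%nat) by lia. assert (E2 : L = ((L - s) + s)%nat) by lia.
transitivity (Rsum F (s + (L - s))); [f_equal; auto|].
transitivity (Rsum (fun k => F ((s + k) mod L)%nat) ((L - s) + s)); [|f_equal; auto].
rewrite !Rsum_split, Rplus_comm. f_equal; apply Rsum_ext; intros i Hi; f_equal; symmetry.
- apply Nat.mod_small. lia.
- replace (s + (L - s + i))%nat with (i + 1 * L)%nat by lia. rewrite Nat.Div0.mod_add. apply Nat.mod_small. lia.
Qed.

Lemma Rsum_rot_partial x s L B n : (s <= L)%nat -> (n <= L)%nat -> (0 < L)%nat ->
  (forall k, (k <= L)%nat -> Rabs (Rsum x k) <= B) ->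
  Rabs (Rsum (fun k => x ((s + k) mod L)%nat) n) <= 3 * B.
Proof.
intros Hs Hn HL HB.
assert (Hfirst : forall k, (k <= L - s)%nat -> Rsum (fun k => x ((s + k) mod L)%nat) k = Rsum x (s + k) - Rsum x s).
{ intros k Hk. rewrite Rsum_split. rewrite (Rsum_ext _ (fun i => x (s + i)%nat)); [ring|].
  intros i Hi. f_equal. apply Nat.mod_small. lia. }
assert (HBs := HB s Hs). assert (HB0 : 0 <= B) by (eapply Rle_trans; [apply Rabs_pos|apply HBs]).
destruct (le_lt_dec n (L - s)) as [h|h].
- rewrite Hfirst by auto. assert (A := HB (s + n)%nat ltac:(lia)).
  apply Rabs_le. apply Rabs_le_between in A. apply Rabs_le_between in HBs. lra.
- set (k := (n - (L - s))%nat). assert (En : n = ((L - s) + k)%nat) by (unfold k; lia).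
  rewrite En, Rsum_split, Hfirst by lia.
  rewrite (Rsum_ext _ x k).
  2:{ intros i Hi. f_equal. replace (s + (L - s + i))%nat with (i + 1 * L)%nat by lia.
      rewrite Nat.Div0.mod_add. apply Nat.mod_small. lia. }
  assert (A := HB (s + (L - s))%nat ltac:(lia)). assert (A2 := HB k ltac:(unfold k; lia)).
  apply Rabs_le. apply Rabs_le_between in A. apply Rabs_le_between in A2. apply Rabs_le_between in HBs. lra.
Qed.

Definition indic (E : nat -> Prop) (j : nat) : R := if chi E j then 1 else 0.

Lemma Rprod_exp f n : Rprod (fun i => exp (f i)) n = exp (Rsum f n).
Proof. induction n; simpl; [symmetry; apply exp_0|]. rewrite IHn, exp_plus. reflexivity. Qed.

(** The logarithm of the product at the place [y + g] is the correlation of the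
    indicator of [E] with the logarithmic kernel centred there. *)
Lemma log_sprod E y L g : (g < L)%nat ->
  Rabs (sprod (INR L) (zeros E y L) (INR (y + g))) =
  exp (Rsum (fun k => indic E (y + (S g + k) mod L)%nat * log_sine L k) L).
Proof.
intros Hg. assert (HL : 0 < INR L) by (apply lt_0_INR; lia).
rewrite sprod_zeros, Rprod_Rabs.
rewrite (Rprod_ext _ (fun i => exp (indic E (y + i)%nat * log_sine L ((L + i - S g) mod L)%nat))).
- rewrite Rprod_exp. f_equal. rewrite (Rsum_rot _ (S g) L) by lia. apply Rsum_ext. intros k Hk.
  f_equal. f_equal.
  destruct (le_lt_dec L (S g + k)) as [h|h].
  + replace (S g + k)%nat with ((S g + k - L) + 1 * L)%nat by lia. rewrite Nat.Div0.mod_add.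
    rewrite (Nat.mod_small (S g + k - L) L) by lia. rewrite Nat.mod_small by lia. lia.
  + rewrite (Nat.mod_small (S g + k) L) by lia. replace (L + (S g + k) - S g)%nat with (k + 1 * L)%nat by lia.
    rewrite Nat.Div0.mod_add. apply Nat.mod_small. lia.
- intros i Hi. unfold indic. destruct (chi E (y + i)); [|rewrite Rmult_0_l, exp_0; apply Rabs_R1].
  rewrite Rmult_1_l. unfold log_sine. rewrite exp_ln by (apply log_sine_sin_pos, Nat.mod_upper_bound; lia).
  rewrite !plus_INR. replace (INR y + INR g - (INR y + INR i) + / 2) with (INR g - INR i + / 2) by ring.
  destruct (le_lt_dec i g) as [h|h].
  + replace ((L + i - S g) mod L)%nat with (L - 1 - (g - i))%nat by (rewrite Nat.mod_small; lia).
    rewrite !minus_INR by lia. simpl (INR 1).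
    assert (Hgi := log_sine_sin_pos L (g - i) ltac:(lia)). rewrite minus_INR in Hgi by lia.
    rewrite Rabs_pos_eq by lra. rewrite <- sin_PI_x. f_equal. field. lra.
  + replace ((L + i - S g) mod L)%nat with (i - g - 1)%nat.
    2:{ replace (L + i - S g)%nat with ((i - g - 1) + 1 * L)%nat by lia. rewrite Nat.Div0.mod_add, Nat.mod_small; lia. }
    assert (Hgi := log_sine_sin_pos L (i - g - 1) ltac:(lia)). rewrite !minus_INR in * by lia. simpl (INR 1) in *.
    replace (PI * (INR g - INR i + / 2) / INR L) with (- (PI * (INR i - INR g - 1 + / 2) / INR L)) by (field; lra).
    rewrite sin_neg, Rabs_Ropp. apply Rabs_pos_eq; lra.
Qed.

Lemma sprod_zeros_lower E y h m : (1 <= h)%nat ->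
  exp (- (16 * INR h)) <= Rabs (sprod (INR (2 * h)) (zeros E y (2 * h)) (INR m)).
Proof.
intros Hh. destruct (sprod_at_window (2 * h) y (zeros E y (2 * h)) m ltac:(lia)) as (g & Hg & ->).
rewrite log_sprod by auto. apply exp_le.
set (L := (2 * h)%nat). assert (HhR : 1 <= INR h) by (change 1 with (INR 1); apply le_INR; lia).
assert (EL : INR L = 2 * INR h) by (unfold L; rewrite mult_INR; reflexivity).
assert (A : Rsum (fun k => - Rabs (log_sine L k)) L <= Rsum (fun k => indic E (y + (S g + k) mod L)%nat * log_sine L k) L).
{ apply Rsum_le. intros k Hk. assert (B := log_sine_nonpos L k Hk). rewrite Rabs_left1 by auto.
  unfold indic. destruct (chi E _); lra. }
eapply Rle_trans; [|apply A].
rewrite (Rsum_ext _ (fun k => (-1) * Rabs (log_sine L k))) by (intros; ring). rewrite Rsum_scal.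
assert (N := log_sine_near h h (le_n _)). fold L in N.
assert (E2 : Rsum (fun k => Rabs (log_sine L k)) L = 2 * Rsum (fun k => Rabs (log_sine L k)) h).
{ transitivity (Rsum (fun k => Rabs (log_sine L k)) (h + h)); [f_equal; unfold L; lia|]. rewrite Rsum_split.
  rewrite (Rsum_rev (fun i => Rabs (log_sine L (h + i))) h).
  rewrite (Rsum_ext (fun i => Rabs (log_sine L (h + (h - 1 - i)))) (fun k => Rabs (log_sine L k))); [ring|].
  intros i Hi. rewrite <- (log_sine_sym L i) by (unfold L; lia). do 2 f_equal. unfold L; lia. }
rewrite E2.
assert (E3 : sqrt (2 * INR L) * sqrt (INR h) = 2 * INR h).
{ rewrite <- sqrt_mult by lra. rewrite EL. replace (2 * (2 * INR h) * INR h) with ((2 * INR h) * (2 * INR h)) by ring.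
  apply sqrt_square; lra. }
rewrite Rmult_assoc, E3 in N. lra.
Qed.

(** If [E] is evenly distributed with proportion [be], its correlation with the kernel
    differs from [be] times the total mass of the kernel, which does not depend on the
    place, by an amount controlled by log_sine_correlation. *)
Lemma sprod_zeros_uniform E y h q be B : (1 <= q <= h)%nat -> 0 <= be <= 1 ->
  (forall n, (n <= 2 * h)%nat -> Rabs (Rsum (fun i => indic E (y + i)%nat - be) n) <= B) ->
  forall m m', Rabs (sprod (INR (2 * h)) (zeros E y (2 * h)) (INR m)) <=
    exp (72 * B * ln (2 * INR (2 * h) / INR q) + 16 * sqrt (2 * INR (2 * h)) * sqrt (INR q))
    * Rabs (sprod (INR (2 * h)) (zeros E y (2 * h)) (INR m')).
Proof.
intros Hq Hbe HB m m'.
set (L := (2 * h)%nat). set (W := Rsum (log_sine L) L).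
set (K := 12 * (3 * B) * ln (2 * INR L / INR q) + 8 * sqrt (2 * INR L) * sqrt (INR q)).
assert (Key : forall g, (g < L)%nat ->
   Rabs (Rsum (fun k => indic E (y + (S g + k) mod L)%nat * log_sine L k) L - be * W) <= K).
{ intros g Hg. set (x := fun k => indic E (y + (S g + k) mod L)%nat - be).
  replace (Rsum (fun k => indic E (y + (S g + k) mod L)%nat * log_sine L k) L - be * W) with (Rsum (fun k => x k * log_sine L k) L).
  2:{ unfold W. rewrite <- Rsum_scal. unfold x.
    rewrite (Rsum_ext _ (fun k => indic E (y + (S g + k) mod L)%nat * log_sine L k + (-1) * (be * log_sine L k))) by (intros; ring).
    rewrite Rsum_plus, (Rsum_scal (-1)). ring. }
  apply log_sine_correlation; [auto| |].
  - intros k. unfold x, indic. destruct (chi E _); apply Rabs_le; lra.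
  - intros n Hn. apply (Rsum_rot_partial (fun j => indic E (y + j)%nat - be) (S g) L B n); auto; unfold L in *; lia. }
destruct (sprod_at_window L y (zeros E y L) m ltac:(unfold L; lia)) as (g & Hg & ->).
destruct (sprod_at_window L y (zeros E y L) m' ltac:(unfold L; lia)) as (g' & Hg' & ->).
rewrite !log_sprod by auto. rewrite <- exp_plus. apply exp_le.
assert (A := Key g Hg). assert (A' := Key g' Hg'). unfold K in *.
apply Rabs_le_between in A. apply Rabs_le_between in A'. lra.
Qed.

Lemma indic_sum_places E y n : Rsum (fun i => indic E (y + i)%nat) n = INR (length (places E y n)).
Proof.
induction n; [reflexivity|]. rewrite places_S, length_app, plus_INR, <- IHn. simpl Rsum. f_equal.
unfold indic. destruct (chi E (y + n)); reflexivity.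
Qed.

(** The count in a window is a difference of two counts from the origin; the error is
    small compared with the distance to the origin, not with the length of the window. *)
Lemma density_window F d : has_density F d -> forall eps, 0 < eps -> exists A, 0 <= A /\
  forall y n, Rabs (Rsum (fun i => indic F (y + i)%nat - d) n) <= eps * INR (y + n) + A.
Proof.
intros H eps He.
destruct (has_density_elim F d H (eps / 2)) as [N HN]; [lra|].
set (A := INR N + 1 + Rabs d * (INR N + 1)).
assert (HA : 0 <= A) by (unfold A; assert (P := pos_INR N); assert (Q := Rabs_pos d); nra).
assert (Hc : forall k, Rabs (INR (length (places F 0 k)) - d * INR k) <= eps / 2 * INR k + A).
{ intros k. assert (Hk0 := pos_INR k). assert (PN := pos_INR N). assert (Pd := Rabs_pos d).
  destruct (le_lt_dec k N) as [h|h].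
  - assert (HkN : INR k <= INR N) by (apply le_INR; auto).
    assert (B : INR (length (places F 0 k)) <= INR k) by (apply le_INR, places_length_le).
    assert (B0 := pos_INR (length (places F 0 k))).
    unfold Rminus. eapply Rle_trans; [apply Rabs_triang|]. rewrite Rabs_Ropp, Rabs_mult.
    rewrite (Rabs_pos_eq (INR (length _))), (Rabs_pos_eq (INR k)) by auto.
    assert (Rabs d * INR k <= Rabs d * (INR N + 1)) by (apply Rmult_le_compat_l; lra).
    assert (0 <= eps / 2 * INR k) by (apply Rmult_le_pos; lra). unfold A. lra.
  - destruct k as [|k]; [lia|]. specialize (HN k ltac:(lia)). rewrite S_INR.
    assert (Hk1 := pos_INR k).
    replace (INR (length (places F 0 (S k))) - d * (INR k + 1)) with
      ((INR (length (places F 0 (S k))) - d * INR k) + - d) by ring.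
    eapply Rle_trans; [apply Rabs_triang|]. rewrite Rabs_Ropp.
    assert (Rabs d * 1 <= Rabs d * (INR N + 1)) by (apply Rmult_le_compat_l; lra). unfold A. lra. }
exists (2 * A). split; [lra|]. intros y n.
assert (E : Rsum (fun i => indic F (y + i)%nat - d) n =
  (INR (length (places F 0 (y + n))) - d * INR (y + n)) - (INR (length (places F 0 y)) - d * INR y)).
{ rewrite places_app, length_app, !plus_INR. simpl (0 + y)%nat.
  rewrite (Rsum_ext _ (fun i => indic F (y + i)%nat + - d)) by (intros; ring).
  rewrite Rsum_plus, Rsum_const, indic_sum_places. ring. }
rewrite E. assert (H1 := Hc (y + n)%nat). assert (H2 := Hc y).
assert (INR y <= INR (y + n)) by (apply le_INR; lia).
assert (eps / 2 * INR y <= eps / 2 * INR (y + n)) by (apply Rmult_le_compat_l; lra).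
apply Rabs_le. apply Rabs_le_between in H1. apply Rabs_le_between in H2. lra.
Qed.

Lemma density_between F d : has_density F d -> 0 <= d <= 1.
Proof.
intros H. split; apply Rnot_lt_le; intros Hlt.
- destruct (has_density_elim F d H (- d / 2)) as [N HN]; [lra|]. specialize (HN (S N) ltac:(lia)).
  assert (A := pos_INR (length (places F 0 (S (S N))))). assert (B := lt_0_INR (S N) ltac:(lia)).
  apply Rabs_le_between in HN. nra.
- destruct (has_density_elim F d H ((d - 1) / 2)) as [N HN]; [lra|].
  destruct (INR_unbounded (2 / (d - 1))) as [N2 HN2].
  specialize (HN (N + N2)%nat ltac:(lia)).
  assert (A : INR (length (places F 0 (S (N + N2)))) <= INR (S (N + N2))) by (apply le_INR, places_length_le).
  rewrite S_INR in A. assert (B : INR N2 <= INR (N + N2)) by (apply le_INR; lia).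
  apply Rlt_div_l in HN2; [|lra].
  apply Rabs_le_between in HN.
  assert (INR N2 * (d - 1) <= INR (N + N2) * (d - 1)) by (apply Rmult_le_compat_r; lra). nra.
Qed.

(** Product of sines over the places outside [F] in the window of radius [h] about [c]. *)
Definition window_sines (F : nat -> Prop) (c h m : nat) : R :=
  sprod (INR (2 * h)) (zeros (fun j => ~ F j) (c + 1 - h) (2 * h)) (INR m).

Lemma window_sines_uniform F d delta r : has_density F d -> 0 < delta -> 0 < r <= 1 ->
  exists c0, forall c, (c0 <= c)%nat -> forall h, (1 <= h)%nat -> r * INR c <= INR h <= INR c ->
  forall m m', Rabs (window_sines F c h m) <= exp (delta * INR c) * Rabs (window_sines F c h m').
Proof.
intros HF Hd Hr. assert (Hd01 := density_between F d HF).
(* [q] is a proportion between [2 sg] and [3 sg] of [h]: small enough for the singular part, fixed before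
   the evenness [eps] of the window, which must beat [ln (2 / sg)] *)
set (sg := Rmin (1/4) ((delta / 256) * (delta / 256))).
assert (Hsg : 0 < sg) by (apply Rmin_glb_lt; [lra|apply Rmult_lt_0_compat; lra]).
assert (Hsg1 : sg <= 1/4) by apply Rmin_l. assert (Hsg2 : sg <= (delta / 256) * (delta / 256)) by apply Rmin_r.
set (V := ln (2 / sg)).
assert (HV : 0 < V). { unfold V. rewrite <- ln_1. apply ln_increasing; [lra|]. apply (proj1 (Rlt_div_r 1 2 sg Hsg)). lra. }
set (eps := delta / (600 * V)).
assert (Heps : 0 < eps) by (apply Rdiv_lt_0_compat; lra).
destruct (density_window F d HF eps Heps) as (A & HA & Hwin).
destruct (INR_unbounded ((A + 1) / eps)) as [N1 HN1]. destruct (INR_unbounded (1 / (sg * r))) as [N2 HN2].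
exists (N1 + N2 + 1)%nat. intros c Hc h Hh HhR m m'.
assert (Hc1 : 1 <= INR c) by (change 1 with (INR 1); apply le_INR; lia).
assert (HcA : A <= eps * INR c).
{ apply Rlt_div_l in HN1; [|auto]. assert (INR N1 <= INR c) by (apply le_INR; lia).
  assert (INR N1 * eps <= INR c * eps) by (apply Rmult_le_compat_r; lra). lra. }
assert (Hsh : 1 <= sg * INR h).
{ apply Rlt_div_l in HN2; [|apply Rmult_lt_0_compat; lra]. assert (INR N2 <= INR c) by (apply le_INR; lia).
  assert (INR N2 * (sg * r) <= INR c * (sg * r)) by (apply Rmult_le_compat_r; [apply Rmult_le_pos; lra|auto]).
  assert (sg * (r * INR c) <= sg * INR h) by (apply Rmult_le_compat_l; lra). lra. }
assert (EL : INR (2 * h) = 2 * INR h) by (rewrite mult_INR; reflexivity).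
assert (Hh0 : 0 < INR h) by (apply lt_0_INR; lia).
destruct (nfloor_ex (2 * sg * INR h)) as [q0 Hq0]; [lra|]. set (q := S q0).
assert (HqR : 2 * sg * INR h <= INR q <= 3 * sg * INR h) by (unfold q; rewrite S_INR; lra).
assert (Hqh : (1 <= q <= h)%nat).
{ split; [unfold q; lia|]. apply INR_le. assert (3 * sg * INR h <= 1 * INR h) by (apply Rmult_le_compat_r; lra). lra. }
set (y := (c + 1 - h)%nat).
assert (HB : forall n, (n <= 2 * h)%nat -> Rabs (Rsum (fun i => indic (fun j => ~ F j) (y + i)%nat - (1 - d)) n) <= 4 * eps * INR c).
{ intros n Hn. rewrite <- Rabs_Ropp.
  replace (- Rsum (fun i => indic (fun j => ~ F j) (y + i)%nat - (1 - d)) n) with (Rsum (fun i => indic F (y + i)%nat - d) n).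
  - eapply Rle_trans; [apply Hwin|].
    assert (Hyn : INR (y + n) <= INR (c + c + 1)).
    { apply le_INR. assert (h <= c)%nat by (apply INR_le; lra). unfold y. lia. }
    rewrite !plus_INR in Hyn. simpl (INR 1) in Hyn. rewrite <- plus_INR in Hyn.
    assert (eps * INR (y + n) <= eps * (3 * INR c)) by (apply Rmult_le_compat_l; lra). lra.
  - rewrite <- (Rmult_1_l (Rsum (fun i => indic (fun j => ~ F j) _ - _) n)), Ropp_mult_distr_l, <- Rsum_scal.
    apply Rsum_ext. intros i _. unfold indic, chi.
    destruct (excluded_middle_informative (F (y + i)%nat)); destruct (excluded_middle_informative (~ F (y + i)%nat)); try tauto; ring. }
assert (U := sprod_zeros_uniform (fun j => ~ F j) y h q (1 - d) (4 * eps * INR c) Hqh ltac:(lra) HB m m').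
unfold window_sines. fold y. eapply Rle_trans; [apply U|]. apply Rmult_le_compat_r; [apply Rabs_pos|]. apply exp_le.
assert (Hq1 : 0 < INR q) by (apply lt_0_INR; lia).
assert (T1 : ln (2 * INR (2 * h) / INR q) <= V).
{ unfold V. assert (Hle : 2 * INR (2 * h) / INR q <= 2 / sg).
  { rewrite EL. apply Rmult_le_reg_r with (sg * INR q); [apply Rmult_lt_0_compat; auto|].
    replace (2 * (2 * INR h) / INR q * (sg * INR q)) with (4 * (sg * INR h)) by (field; lra).
    replace (2 / sg * (sg * INR q)) with (2 * INR q) by (field; lra). lra. }
  assert (0 < 2 * INR (2 * h) / INR q) by (apply Rdiv_lt_0_compat; lra).
  destruct Hle as [Hlt|He]; [left; apply ln_increasing; auto|rewrite He; lra]. }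
assert (T2 : 72 * (4 * eps * INR c) * ln (2 * INR (2 * h) / INR q) <= delta / 2 * INR c).
{ apply Rle_trans with (72 * (4 * eps * INR c) * V).
  - apply Rmult_le_compat_l; [|auto]. apply Rmult_le_pos; [lra|]. apply Rmult_le_pos; lra.
  - unfold eps. replace (72 * (4 * (delta / (600 * V)) * INR c) * V) with (288 / 600 * delta * INR c) by (field; lra). nra. }
assert (T3 : sqrt (2 * INR (2 * h)) * sqrt (INR q) <= 4 * (delta / 256) * INR c).
{ rewrite <- sqrt_mult by lra.
  apply Rle_trans with (sqrt ((4 * (delta / 256) * INR h) * (4 * (delta / 256) * INR h))).
  - apply sqrt_le_1_alt. rewrite EL.
    apply Rle_trans with (4 * INR h * (3 * sg * INR h)); [apply Rle_trans with (4 * INR h * INR q); [lra|apply Rmult_le_compat_l; lra]|].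
    replace (4 * INR h * (3 * sg * INR h)) with (12 * (INR h * INR h) * sg) by ring.
    replace (4 * (delta / 256) * INR h * (4 * (delta / 256) * INR h)) with (16 * (INR h * INR h) * ((delta / 256) * (delta / 256))) by ring.
    assert (0 < INR h * INR h) by (apply Rmult_lt_0_compat; auto).
    apply Rmult_le_compat; lra.
  - rewrite sqrt_square; [apply Rmult_le_compat_l; lra|apply Rmult_le_pos; lra]. }
rewrite (Rmult_assoc 16). assert (0 <= delta * INR c) by (apply Rmult_le_pos; lra). lra.
Qed.

(** * Polynomial blocks that are small on an arc *)

Definition bump_radius (c : nat) : nat := (c / 2)%nat.
Definition bump_start (c : nat) : nat := (c - bump_radius c)%nat.
(** Coefficients of [z^(c - b) ((1 + z) / 2)^(2 b)] with [b = c / 2]: a Gaussian-like bump of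
    maximum at [m = c], supported in [[c/2, 3c/2]], whose generating function is explicit. *)
Definition bump (c m : nat) : R := if (bump_start c <=? m)%nat then bin (2 * bump_radius c) (m - bump_start c) * (/ 4) ^ bump_radius c else 0.

Lemma bump_radius_bounds c : (2 * bump_radius c <= c < 2 * bump_radius c + 2)%nat.
Proof. unfold bump_radius. assert (A := Nat.div_mod_eq c 2). assert (B := Nat.mod_upper_bound c 2 ltac:(lia)). lia. Qed.

Lemma bump_nonneg c m : 0 <= bump c m.
Proof.
unfold bump. destruct (bump_start c <=? m)%nat; [|lra]. apply Rmult_le_pos; [apply bin_pos|apply pow_le; lra].
Qed.

Lemma bump_support c m : bump c m <> 0 -> (c <= 2 * m /\ 2 * m <= 3 * c)%nat.
Proof.
assert (B := bump_radius_bounds c). unfold bump. destruct (Nat.leb_spec (bump_start c) m) as [h|h]; [|tauto]. intros Hne.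
destruct (le_lt_dec (m - bump_start c) (2 * bump_radius c)) as [h1|h1].
- unfold bump_start in *. lia.
- exfalso. apply Hne. rewrite bin_gt by auto. ring.
Qed.

Lemma bin_le_centre b k : bin (2 * b) k <= bin (2 * b) b.
Proof.
assert (Hup : forall j, (j <= b)%nat -> bin (2 * b) (b - j) <= bin (2 * b) b).
{ induction j; intros Hj; [rewrite Nat.sub_0_r; lra|].
  eapply Rle_trans; [|apply IHj; lia].
  replace (b - j)%nat with (S (b - S j)) by lia. set (i := (b - S j)%nat).
  assert (A := bin_ratio (2 * b) i). assert (P := bin_pos (2 * b) i). assert (P' := bin_pos (2 * b) (S i)).
  assert (Hi : 2 * INR i + 2 <= INR (2 * b)).
  { change 2 with (INR 2). rewrite <- mult_INR, <- plus_INR. apply le_INR. unfold i. lia. }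
  assert (Hi0 := pos_INR i).
  apply Rmult_le_reg_r with (INR i + 1); [lra|]. rewrite A. apply Rmult_le_compat_l; lra. }
assert (Hdown : forall j, bin (2 * b) (b + j) <= bin (2 * b) b).
{ induction j; [rewrite Nat.add_0_r; lra|]. eapply Rle_trans; [|apply IHj].
  rewrite Nat.add_succ_r. set (i := (b + j)%nat).
  assert (A := bin_ratio (2 * b) i). assert (P := bin_pos (2 * b) i).
  assert (Hi : INR (2 * b) <= 2 * INR i).
  { change 2 with (INR 2). rewrite <- mult_INR. apply le_INR. unfold i. lia. }
  assert (Hi0 := pos_INR i).
  apply Rmult_le_reg_r with (INR i + 1); [lra|]. rewrite A. apply Rmult_le_compat_l; lra. }
destruct (le_lt_dec k b) as [h|h].
- replace k with (b - (b - k))%nat by lia. apply Hup. lia.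
- replace k with (b + (k - b))%nat by lia. apply Hdown.
Qed.

Lemma pow_quarter b : 2 ^ (2 * b) * (/ 4) ^ b = 1.
Proof. rewrite pow_mult, <- Rpow_mult_distr. replace (2 ^ 2 * / 4) with 1 by field. apply pow1. Qed.

Lemma bump_centre c : / (INR c + 1) <= bump c c.
Proof.
assert (B := bump_radius_bounds c). unfold bump. destruct (Nat.leb_spec (bump_start c) c) as [h|h]; [|unfold bump_start in h; lia].
replace (c - bump_start c)%nat with (bump_radius c) by (unfold bump_start; lia).
set (b := bump_radius c) in *.
assert (E : 2 ^ (2 * b) <= INR (S (2 * b)) * bin (2 * b) b).
{ replace 2 with (1 + 1) at 1 by ring. rewrite binomial_R, <- Rsum_const. apply Rsum_le. intros k _.
  rewrite !pow1, !Rmult_1_r. apply bin_le_centre. }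
assert (Hq : 0 < (/ 4) ^ b) by (apply pow_lt; lra).
assert (H1 : 1 <= INR (S (2 * b)) * (bin (2 * b) b * (/ 4) ^ b)).
{ rewrite <- (pow_quarter b), <- Rmult_assoc. apply Rmult_le_compat_r; lra. }
assert (H2 : INR (S (2 * b)) <= INR c + 1) by (rewrite <- S_INR; apply le_INR; lia).
assert (Hc := pos_INR c).
assert (H3 : 0 <= bin (2 * b) b * (/ 4) ^ b) by (apply Rmult_le_pos; [apply bin_pos|lra]).
apply Rmult_le_reg_l with (INR c + 1); [lra|]. rewrite Rinv_r by lra.
eapply Rle_trans; [apply H1|]. apply Rmult_le_compat_r; auto.
Qed.

(** Both exponentials obey [exp z <= 1 + z + 2 z^2] for [|z| <= 1/2], which
    follows from [exp (-z) >= 1 - z]. *)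
Lemma cosh_bound y : Rabs y <= / 2 -> (exp y + exp (- y)) / 2 <= exp (2 * (y * y)).
Proof.
intros Hy. apply Rabs_le_between in Hy.
assert (H : forall z, - / 2 <= z <= / 2 -> exp z <= 1 + z + 2 * (z * z)).
{ intros z Hz. assert (A := exp_ineq1_le (- z)). assert (P := exp_pos z).
  assert (E : exp z * exp (- z) = 1) by (rewrite <- exp_plus, Rplus_opp_r; apply exp_0).
  assert (B : exp z * (1 - z) <= 1) by (rewrite <- E; apply Rmult_le_compat_l; lra).
  apply Rmult_le_reg_r with (1 - z); [lra|]. eapply Rle_trans; [apply B|].
  replace ((1 + z + 2 * (z * z)) * (1 - z)) with (1 + (z * z) * (1 - 2 * z)) by ring.
  assert (0 <= (z * z) * (1 - 2 * z)); [|lra]. apply Rmult_le_pos; [apply Rle_0_sqr|lra]. }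
assert (A := H y ltac:(lra)). assert (B := H (- y) ltac:(lra)).
assert (D := exp_ineq1_le (2 * (y * y))). nra.
Qed.

(** Hoeffding's inequality for the symmetric binomial law, by the exponential moment with
    parameter [t / (2 b)], where [t = m - c]. *)
Lemma bump_tail c m h : (2 <= c)%nat -> 0 <= h -> h <= Rabs (INR m - INR c) -> bump c m <= exp (- (h * h) / (2 * INR c)).
Proof.
intros Hc Hh Ht. assert (B := bump_radius_bounds c). unfold bump.
destruct (Nat.leb_spec (bump_start c) m) as [hk|hk]; [|left; apply exp_pos].
destruct (le_lt_dec (m - bump_start c) (2 * bump_radius c)) as [h1|h1].
2:{ rewrite bin_gt, Rmult_0_l by auto. left; apply exp_pos. }
set (b := bump_radius c) in *. set (k := (m - bump_start c)%nat) in *.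
assert (Hb1 : 1 <= INR b) by (change 1 with (INR 1); apply le_INR; lia).
assert (HbR : 2 * INR b <= INR c) by (change 2 with (INR 2); rewrite <- mult_INR; apply le_INR; lia).
set (t := INR k - INR b).
assert (Etm : t = INR m - INR c).
{ unfold t, k, bump_start. rewrite minus_INR by auto. unfold bump_start in *. rewrite minus_INR by lia. unfold b. ring. }
rewrite <- Etm in Ht.
assert (HkR : 0 <= INR k <= 2 * INR b).
{ split; [apply pos_INR|]. change 2 with (INR 2). rewrite <- mult_INR. apply le_INR; auto. }
(* the parameter that optimises the exponential bound *)
set (la := t / (2 * INR b)).
assert (Ela : la * (2 * INR b) = t) by (unfold la; field; lra).
assert (Hla : Rabs (la / 2) <= / 2).
{ unfold t in Ela. apply Rabs_le. split; apply Rmult_le_reg_r with (2 * INR b); lra. }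
assert (Hbin : bin (2 * b) k * exp (la * INR k) <= (1 + exp la) ^ (2 * b)).
{ rewrite binomial_R, exp_INR.
  eapply Rle_trans; [|apply (Rsum_term_le (fun k => bin (2 * b) k * 1 ^ (2 * b - k) * exp la ^ k) (S (2 * b)) k)].
  - cbv beta. rewrite pow1, Rmult_1_r. lra.
  - intros j. rewrite pow1, Rmult_1_r. apply Rmult_le_pos; [apply bin_pos|apply pow_le; left; apply exp_pos].
  - lia. }
assert (Hcosh := cosh_bound (la / 2) Hla).
assert (E1 : 1 + exp la = 2 * exp (la / 2) * ((exp (la / 2) + exp (- (la / 2))) / 2)).
{ replace (2 * exp (la / 2) * ((exp (la / 2) + exp (- (la / 2))) / 2)) with
   (exp (la / 2) * exp (la / 2) + exp (la / 2) * exp (- (la / 2))) by field.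
  rewrite <- !exp_plus. replace (la / 2 + la / 2) with la by field. rewrite Rplus_opp_r, exp_0. ring. }
assert (H2 : (1 + exp la) ^ (2 * b) <= 2 ^ (2 * b) * exp ((la / 2 + 2 * (la / 2 * (la / 2))) * INR (2 * b))).
{ rewrite E1. rewrite !Rpow_mult_distr, Rmult_assoc, exp_INR. apply Rmult_le_compat_l; [apply pow_le; lra|].
  rewrite exp_plus, Rpow_mult_distr. apply Rmult_le_compat_l; [apply pow_le; left; apply exp_pos|].
  apply pow_incr. split; [|auto].
  assert (P1 := exp_pos (la / 2)). assert (P2 := exp_pos (- (la / 2))). lra. }
assert (Hq : 0 < (/ 4) ^ b) by (apply pow_lt; lra).
assert (H3 : bin (2 * b) k * (/ 4) ^ b * exp (la * INR k) <= exp ((la / 2 + 2 * (la / 2 * (la / 2))) * INR (2 * b))).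
{ apply Rle_trans with ((1 + exp la) ^ (2 * b) * (/ 4) ^ b).
  - replace (bin (2 * b) k * (/ 4) ^ b * exp (la * INR k)) with (bin (2 * b) k * exp (la * INR k) * (/ 4) ^ b) by ring.
    apply Rmult_le_compat_r; lra.
  - apply Rle_trans with (2 ^ (2 * b) * exp ((la / 2 + 2 * (la / 2 * (la / 2))) * INR (2 * b)) * (/ 4) ^ b); [apply Rmult_le_compat_r; lra|].
    right. transitivity ((2 ^ (2 * b) * (/ 4) ^ b) * exp ((la / 2 + 2 * (la / 2 * (la / 2))) * INR (2 * b))); [ring|].
    rewrite pow_quarter. ring. }
apply Rmult_le_reg_r with (exp (la * INR k)); [apply exp_pos|].
eapply Rle_trans; [apply H3|]. rewrite <- exp_plus. apply exp_le.
rewrite mult_INR. simpl (INR 2).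
assert (Ek : INR k = t + INR b) by (unfold t; ring). rewrite Ek.
assert (Hh2 : h * h <= t * t).
{ assert (t * t = Rabs t * Rabs t) by (rewrite <- Rabs_mult; symmetry; apply Rabs_pos_eq, Rle_0_sqr). rewrite H. apply Rmult_le_compat; auto. }
assert (Hfin : h * h / (2 * INR c) <= t * t / (4 * INR b)).
{ unfold Rdiv. apply Rmult_le_compat; [apply Rle_0_sqr|left; apply Rinv_0_lt_compat; lra|auto|].
  apply Rinv_le_contravar; lra. }
assert (E4 : la * t - la * la * INR b = t * t / (4 * INR b)) by (unfold la; field; lra).
replace (- (h * h) / (2 * INR c)) with (- (h * h / (2 * INR c))) by (unfold Rdiv; ring).
replace ((la / 2 + 2 * (la / 2 * (la / 2))) * (2 * INR b)) with (la * INR b + la * la * INR b) by field.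
lra.
Qed.

Definition bump_gf (c : nat) (z : C) : C := (z ^ bump_start c * ((1 + z) * / 2) ^ (2 * bump_radius c))%C.

Lemma bump_gf_sum c z : bump_gf c z = Csum (fun m => bump c m * z ^ m)%C (2 * c + 1).
Proof.
assert (B := bump_radius_bounds c). set (b := bump_radius c) in *. set (a := bump_start c).
assert (Hac : (a = c - b)%nat) by reflexivity.
assert (E : (2 * c + 1 = a + (S (2 * b) + (c - b)))%nat) by lia.
rewrite E.
assert (Hs : forall u n m, Csum u (n + m) = (Csum u n + Csum (fun i => u (n + i)%nat) m)%C).
{ intros u n m. induction m; [rewrite Nat.add_0_r; simpl; ring|]. rewrite Nat.add_succ_r. simpl. rewrite IHm. ring. }
rewrite !Hs. rewrite Csum_zero.
2:{ intros i Hi. unfold bump. destruct (Nat.leb_spec (bump_start c) i); [unfold a in Hi; lia|ring]. }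
rewrite (Csum_zero _ (c - b)).
2:{ intros i Hi. unfold bump. fold a. fold b. destruct (Nat.leb_spec a (a + (S (2 * b) + i))); [|lia].
    rewrite bin_gt by lia. rewrite Rmult_0_l. ring. }
assert (E5 : ((/ 2) ^ (2 * b))%C = RtoC ((/ 4) ^ b)).
{ rewrite Cpow_mult_r. rewrite <- RtoC_inv by lra. rewrite <- !RtoC_pow. do 2 f_equal. field. }
unfold bump_gf. fold a b. rewrite Cpow_mult_l, E5, binomial_C, Cplus_0_l, Cplus_0_r.
transitivity ((z ^ a * RtoC ((/ 4) ^ b)) * Csum (fun k => bin (2 * b) k * 1 ^ (2 * b - k) * z ^ k)%C (S (2 * b)))%C; [ring|].
rewrite <- Csum_scal. apply Csum_ext. intros k Hk.
unfold bump. fold a b. destruct (Nat.leb_spec a (a + k)); [|lia].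
replace (a + k - a)%nat with k by lia. rewrite RtoC_mult, Cpow_add_r, Cpow_1_l. ring.
Qed.

Lemma expands_linear_pow f c delta B al be n : expands f c delta B -> 0 <= delta ->
  exists c', expands (fun v => (al + be * v) ^ n * f v)%C c' delta ((Cmod al + Cmod be * delta) ^ n * B).
Proof.
intros Hf Hd. induction n as [|n (c' & IH)].
- exists c. simpl. rewrite Rmult_1_l. eapply expands_ext; [| |apply Hf]; intros; simpl; auto. ring.
- exists (fun k => al * c' k + be * match k with O => RtoC 0 | S k => c' k end)%C.
  assert (A := expands_linear _ _ _ _ al be IH Hd). simpl pow. rewrite Rmult_assoc.
  refine (expands_ext _ _ _ _ _ _ _ _ A); [|reflexivity].
  intros v _. rewrite Cpow_S. ring.
Qed.

Lemma bump_gf_expands c U z0 delta g : Cmod U = 1 -> Cmod z0 = 1 -> 0 <= delta -> Cmod (1 + U * z0)%C <= g ->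
  exists cc, expands (fun v => bump_gf c (U * (z0 + v))) cc delta ((1 + delta) ^ bump_start c * ((g + delta) / 2) ^ (2 * bump_radius c)).
Proof.
intros HU Hz Hd Hg.
destruct (expands_linear_pow _ _ _ _ ((1 + U * z0) * / 2)%C (U * / 2)%C (2 * bump_radius c) (expands_const 1 delta) Hd) as (c1 & H1).
destruct (expands_linear_pow _ _ _ _ (U * z0)%C U (bump_start c) H1 Hd) as (c2 & H2).
exists c2. 
assert (Hh : Cmod (/ 2)%C = / 2) by (rewrite <- RtoC_inv by lra; rewrite Cmod_R, Rabs_pos_eq; lra).
assert (Hg0 := Cmod_ge_0 (1 + U * z0)%C).
apply (expands_le _ _ delta delta _ ((1 + delta) ^ bump_start c * ((g + delta) / 2) ^ (2 * bump_radius c))) in H2; [|lra|].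
- refine (expands_ext _ _ _ _ _ _ _ _ H2); [|reflexivity]. intros w0 _.
  unfold bump_gf. replace (U * (z0 + w0))%C with (U * z0 + U * w0)%C by ring.
  replace ((1 + (U * z0 + U * w0)) * / 2)%C with ((1 + U * z0) * / 2 + U * / 2 * w0)%C by ring. ring.
- rewrite !Cmod_mult, HU, Hz, Hh, Cmod_1, !Rmult_1_r, !Rmult_1_l.
  apply Rmult_le_compat_l; [apply pow_le; lra|]. apply pow_incr. lra.
Qed.

(** The factor [(-1)^m] exchanges the roles of [F] and its complement: the coefficients
    change sign exactly at the places of [F] inside the window. *)
Definition block_coef (F : nat -> Prop) (c h : nat) (tau : R) (m : nat) : R := bump c m * ((-1) ^ m * window_sines F c h m * tau).
Definition block (F : nat -> Prop) (c h : nat) (tau : R) (z : C) : C :=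
  Csum (fun m => RtoC (block_coef F c h tau m) * z ^ m)%C (2 * c + 1).

Lemma block_coef_support F c h tau m : (2 * c + 1 <= m)%nat -> block_coef F c h tau m = 0.
Proof.
intros Hm. unfold block_coef. assert (E : bump c m = 0).
{ apply NNPP. intros h0. apply bump_support in h0. lia. }
rewrite E. ring.
Qed.

Lemma bump_gf_le c rho : 0 <= rho <= 1 -> Rsum (fun m => bump c m * rho ^ m) (2 * c + 1) <= rho ^ bump_start c.
Proof.
intros Hr.
assert (E : RtoC (Rsum (fun m => bump c m * rho ^ m) (2 * c + 1)) = bump_gf c rho).
{ rewrite bump_gf_sum, <- Csum_RtoC. apply Csum_ext. intros m _. rewrite RtoC_mult, RtoC_pow. reflexivity. }
assert (E2 : bump_gf c rho = RtoC (rho ^ bump_start c * ((1 + rho) * / 2) ^ (2 * bump_radius c))).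
{ unfold bump_gf. rewrite <- RtoC_inv, <- RtoC_plus, <- RtoC_mult, <- !RtoC_pow, <- RtoC_mult by lra. reflexivity. }
rewrite E2 in E. apply RtoC_inj in E. rewrite E.
rewrite <- (Rmult_1_r (rho ^ bump_start c)) at 2. apply Rmult_le_compat_l; [apply pow_le; lra|].
apply Rle_trans with (1 ^ (2 * bump_radius c)); [apply pow_incr; lra|rewrite pow1; lra].
Qed.

Lemma block_expands_0 F c h tau rho : 0 <= rho <= 1 ->
  expands (block F c h tau) (fun m => RtoC (block_coef F c h tau m)) rho (Rabs tau * rho ^ bump_start c).
Proof.
intros Hr. split.
- assert (Hpos : forall k, 0 <= Cmod (RtoC (block_coef F c h tau k)) * rho ^ k)
    by (intros; apply Rmult_le_pos; [apply Cmod_ge_0|apply pow_le; lra]).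
  intros n. apply Rle_trans with (Rsum (fun k => Cmod (RtoC (block_coef F c h tau k)) * rho ^ k) (2 * c + 1)).
  + destruct (le_lt_dec n (2 * c + 1)) as [hn|hn]; [apply Rsum_mono; auto|].
    replace n with ((2 * c + 1) + (n - (2 * c + 1)))%nat by lia. rewrite Rsum_split.
    rewrite (Rsum_ext (fun i => Cmod (RtoC (block_coef F c h tau (2 * c + 1 + i))) * rho ^ (2 * c + 1 + i)) (fun _ => 0)).
    * rewrite Rsum_const. lra.
    * intros i _. rewrite block_coef_support by lia. rewrite Cmod_0. ring.
  + eapply Rle_trans; [|apply Rmult_le_compat_l; [apply Rabs_pos|apply (bump_gf_le c rho Hr)]].
    rewrite <- Rsum_scal. apply Rsum_le. intros m _. rewrite Cmod_R. unfold block_coef.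
    rewrite !Rabs_mult, (Rabs_pos_eq (bump c m)) by apply bump_nonneg.
    rewrite <- RPow_abs. replace (Rabs (-1)) with 1 by (rewrite Rabs_left; lra). rewrite pow1, Rmult_1_l.
    assert (A : Rabs (window_sines F c h m) <= 1) by apply sprod_le_1.
    assert (P := Rabs_pos tau). assert (Q := bump_nonneg c m). assert (R1 : 0 <= rho ^ m) by (apply pow_le; lra).
    replace (bump c m * (Rabs (window_sines F c h m) * Rabs tau) * rho ^ m) with (Rabs (window_sines F c h m) * (Rabs tau * (bump c m * rho ^ m))) by ring.
    rewrite <- (Rmult_1_l (Rabs tau * (bump c m * rho ^ m))) at 2. apply Rmult_le_compat_r; [|auto].
    apply Rmult_le_pos; [auto|apply Rmult_le_pos; auto].
- intros z _. apply (Cser_finite (fun m => RtoC (block_coef F c h tau m) * z ^ m)%C (2 * c + 1)).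
  intros m Hm. rewrite block_coef_support by auto. ring.
Qed.

(** Expanding the product of sines in exponentials writes the block as a combination,
    with coefficient norm at most 1, of the polynomials [bump_gf c (U z)] with
    [U = - e^(i phi)], and [|1 + U e^(i th)| = 2 |sin((phi + th) / 2)|] is at most [g] for the
    frequencies that occur. *)
Lemma block_expands_arc F c h tau th delta g : (1 <= h)%nat -> 0 <= delta ->
  (forall phi, Rabs phi <= INR (length (places (fun j => ~ F j) (c + 1 - h) (2 * h))) * PI / INR (2 * h) ->
     2 * Rabs (sin ((phi + th) / 2)) <= g) ->
  exists cc, expands (fun v => block F c h tau (cis th + v)) cc delta
    (Rabs tau * ((1 + delta) ^ bump_start c * ((g + delta) / 2) ^ (2 * bump_radius c))).
Proof.
intros Hh Hd Hg. assert (HL : 0 < INR (2 * h)) by (apply lt_0_INR; lia).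
set (l := zeros (fun j => ~ F j) (c + 1 - h) (2 * h)).
destruct (sprod_spectrum (INR (2 * h)) l HL) as (kap & Hkap & Hspec).
assert (Hlen : length l = length (places (fun j => ~ F j) (c + 1 - h) (2 * h))) by apply zeros_length.
set (phi := fun i => (2 * INR i - INR (length l)) * PI / INR (2 * h)).
set (U := fun i => (- cis (phi i))%C).
set (n := S (length l)) in *.
assert (HB0 : 0 <= (1 + delta) ^ bump_start c * ((g + delta) / 2) ^ (2 * bump_radius c)).
{ apply Rmult_le_pos; [apply pow_le; lra|]. rewrite pow_mult. apply pow_le, pow2_ge_0. }
set (B := (1 + delta) ^ bump_start c * ((g + delta) / 2) ^ (2 * bump_radius c)) in *.
assert (Hb : forall z, block F c h tau z = (tau * Csum (fun i => kap i * bump_gf c (U i * z)) n)%C).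
{ intros z. unfold block.
  rewrite (Csum_ext _ (fun m => Csum (fun i => (tau * kap i) * (bump c m * (U i * z) ^ m)) n)%C).
  - rewrite Csum_swap, <- Csum_scal. apply Csum_ext. intros i _. rewrite Csum_scal, <- bump_gf_sum. ring.
  - intros m _. unfold block_coef. rewrite !RtoC_mult. unfold window_sines. fold l. rewrite Hspec.
    transitivity ((bump c m * RtoC ((-1) ^ m) * tau * z ^ m) * Csum (fun i => kap i * cis ((2 * INR i - INR (length l)) * PI * INR m / INR (2 * h))) n)%C; [ring|].
    rewrite <- Csum_scal. apply Csum_ext. intros i _. rewrite Cpow_mult_l. unfold U.
    replace (- cis (phi i))%C with (RtoC (-1) * cis (phi i))%C by (replace (RtoC (-1)) with (- RtoC 1)%C by (rewrite <- RtoC_opp; reflexivity); ring).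
    rewrite Cpow_mult_l, cis_pow, <- RtoC_pow.
    replace (INR m * phi i) with ((2 * INR i - INR (length l)) * PI * INR m / INR (2 * h)) by (unfold phi; field; lra).
    ring. }
assert (Hsum : forall k, (k <= n)%nat -> exists cc, expands (fun v => Csum (fun i => kap i * bump_gf c (U i * (cis th + v))) k)%C cc delta
   (Rsum (fun i => Cmod (kap i)) k * B)).
{ induction k; intros Hk.
  - eexists. simpl. rewrite Rmult_0_l. assert (Z := expands_const (RtoC 0) delta). rewrite Cmod_0 in Z. exact Z.
  - destruct IHk as (c1 & H1); [lia|].
    destruct (bump_gf_expands c (U k) (cis th) delta g) as (c2 & H2).
    + unfold U. rewrite Cmod_opp. apply Cmod_cis.
    + apply Cmod_cis.
    + auto.
    + unfold U. replace (1 + - cis (phi k) * cis th)%C with (cis 0 - cis (phi k + th))%C by (rewrite cis_plus, cis_0; ring).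
      rewrite Cmod_minus_sym, Cmod_chord, Rminus_0_r. apply Hg.
      assert (Hkl : INR k <= INR (length l)) by (apply le_INR; unfold n in Hk; lia). assert (Hk0 := pos_INR k).
      unfold phi, Rdiv. rewrite !Rabs_mult. assert (HP := PI_RGT_0).
      rewrite (Rabs_pos_eq PI) by lra. rewrite (Rabs_pos_eq (/ INR (2 * h))) by (left; apply Rinv_0_lt_compat; auto).
      rewrite <- Hlen. apply Rmult_le_compat_r; [left; apply Rinv_0_lt_compat; auto|].
      apply Rmult_le_compat_r; [lra|]. apply Rabs_le. lra.
    + eexists. simpl Csum. simpl Rsum. rewrite Rmult_plus_distr_r.
      apply (expands_plus _ _ _ _ _ _ _ H1 (expands_scal _ _ _ _ (kap k) H2) Hd). }
destruct (Hsum n (le_n _)) as (cc & Hcc).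
exists (fun k => (tau * cc k)%C).
assert (A := expands_scal _ _ _ _ (RtoC tau) Hcc). rewrite Cmod_R in A.
apply (expands_le _ _ delta delta _ (Rabs tau * B)) in A.
- eapply expands_ext; [| |apply A]; intros; simpl; auto.
- lra.
- apply Rmult_le_compat_l; [apply Rabs_pos|]. rewrite <- (Rmult_1_l B) at 2. apply Rmult_le_compat_r; auto.
Qed.

(** * A sequence with prescribed signs *)

(** The window of radius [h = c / i] suits the centre [c]: on the integers the
    product of sines varies by a factor less than the decay of the bump at the edge of the window,
    that decay beats a polynomial in [c], and the window holds no more
    places outside [F] than the density predicts, up to [1 / i]. *)
Definition good_width (F : nat -> Prop) (d : R) (i c : nat) : Prop :=
  (2 <= c)%nat /\ (1 <= c / i)%nat /\ INR c <= 2 * INR i * INR (c / i) /\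
  (forall m, Rabs (window_sines F c (c / i) m) <= exp (INR c / (32 * (INR i * INR i))) * Rabs (window_sines F c (c / i) c)) /\
  60 * (INR c * INR c) <= exp (INR c / (16 * (INR i * INR i))) /\
  INR (length (places (fun j => ~ F j) (c + 1 - c / i) (2 * (c / i)))) <= (1 - d + / INR i) * INR (2 * (c / i)).

Lemma good_width_eventually F d i : has_density F d -> (1 <= i)%nat -> exists c0, forall c, (c0 <= c)%nat -> good_width F d i c.
Proof.
intros HF Hi. assert (HiR : 1 <= INR i) by (change 1 with (INR 1); apply le_INR; lia).
assert (Hii : 1 <= INR i * INR i) by nra.
assert (H32 : 0 < / (32 * (INR i * INR i))) by (apply Rinv_0_lt_compat; lra).
assert (H2i : 0 < / (2 * INR i) <= 1).
{ split; [apply Rinv_0_lt_compat; lra|]. rewrite <- Rinv_1. apply Rinv_le_contravar; lra. }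
destruct (window_sines_uniform F d _ _ HF H32 H2i) as [c1 Hc1].
destruct (exp_dominates 8 _ H32) as [c2 Hc2].
destruct (density_window F d HF (/ (4 * (INR i * INR i)))) as (A & HA & Hwin); [apply Rinv_0_lt_compat; lra|].
destruct (INR_unbounded (2 * A * (INR i * INR i) + 2)) as [c3 Hc3].
exists (c1 + c2 + c3 + i + 2)%nat. intros c Hc.
assert (E := Nat.div_mod_eq c i). assert (Hm := Nat.mod_upper_bound c i ltac:(lia)).
set (h := (c / i)%nat) in *.
assert (Hh : (1 <= h)%nat) by (apply Nat.div_le_lower_bound; lia).
assert (HhR : 1 <= INR h) by (change 1 with (INR 1); apply le_INR; lia).
assert (Hch : INR c <= 2 * INR i * INR h).
{ assert (H : (c <= 2 * i * h)%nat) by nia. apply le_INR in H. rewrite !mult_INR in H. exact H. }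
assert (Hhc : INR h <= INR c) by (apply le_INR; nia).
assert (Hc3R : INR c3 <= INR c) by (apply le_INR; lia).
split; [lia|]. split; [auto|]. split; [auto|]. split; [|split].
- intros m. replace (INR c / (32 * (INR i * INR i))) with (/ (32 * (INR i * INR i)) * INR c) by (unfold Rdiv; ring).
  apply (Hc1 c ltac:(lia) h Hh); split; auto.
  apply Rmult_le_reg_l with (2 * INR i); [lra|]. rewrite <- Rmult_assoc, Rinv_r by lra. lra.
- specialize (Hc2 c ltac:(lia)).
  replace (INR c / (16 * (INR i * INR i))) with (/ (32 * (INR i * INR i)) * INR c + / (32 * (INR i * INR i)) * INR c) by (field; lra).
  rewrite exp_plus. assert (Hc0 := pos_INR c).
  apply Rle_trans with ((8 * (INR c + 1)) * (8 * (INR c + 1))); [nra|]. apply Rmult_le_compat; lra.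
- fold h. assert (Hw := Hwin (c + 1 - h)%nat (2 * h)%nat).
  rewrite <- indic_sum_places.
  assert (Eqa : Rsum (fun k => indic (fun j => ~ F j) (c + 1 - h + k)%nat) (2 * h) =
    (1 - d) * INR (2 * h) - Rsum (fun k => indic F (c + 1 - h + k)%nat - d) (2 * h)).
  { rewrite (Rsum_ext _ (fun k => (1 - d) + (-1) * (indic F (c + 1 - h + k)%nat - d))).
    - rewrite Rsum_plus, Rsum_const, Rsum_scal. ring.
    - intros k _. unfold indic, chi.
      destruct (excluded_middle_informative (F (c + 1 - h + k)%nat)); destruct (excluded_middle_informative (~ F (c + 1 - h + k)%nat)); try tauto; ring. }
  rewrite Eqa, Rmult_plus_distr_r.
  assert (Hb : INR (c + 1 - h + 2 * h) <= 2 * INR c + 1).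
  { apply Rle_trans with (INR (2 * c + 1)); [apply le_INR; nia|]. rewrite plus_INR, mult_INR. simpl (INR 2). simpl (INR 1). lra. }
  apply Rabs_le_between in Hw.
  assert (Hii' : 0 < / (INR i * INR i)) by (apply Rinv_0_lt_compat; lra).
  assert (T1 : / (4 * (INR i * INR i)) * INR (c + 1 - h + 2 * h) <= / (4 * (INR i * INR i)) * (2 * INR c + 1)).
  { apply Rmult_le_compat_l; [left; apply Rinv_0_lt_compat; lra|auto]. }
  assert (T2 : / (4 * (INR i * INR i)) * (2 * INR c + 1) + A <= / (INR i * INR i) * INR c).
  { apply Rmult_le_reg_l with (4 * (INR i * INR i)); [lra|].
    rewrite Rmult_plus_distr_l, <- Rmult_assoc, Rinv_r, Rmult_1_l by lra.
    replace (4 * (INR i * INR i) * (/ (INR i * INR i) * INR c)) with (4 * INR c) by (field; lra). lra. }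
  assert (T3 : / (INR i * INR i) * INR c <= / INR i * INR (2 * h)).
  { rewrite mult_INR. simpl (INR 2). apply Rmult_le_reg_l with (INR i * INR i); [lra|].
    rewrite <- Rmult_assoc, Rinv_r, Rmult_1_l by lra.
    replace (INR i * INR i * (/ INR i * ((1 + 1) * INR h))) with (2 * INR i * INR h) by (field; lra). lra. }
  lra.
Qed.

(** The largest [i <= n] with [X i <= c], or 0 when there is none. *)
Fixpoint last_ready (X : nat -> nat) (c n : nat) : nat :=
  match n with O => O | S n' => if (X (S n') <=? c)%nat then S n' else last_ready X c n' end.

Lemma last_ready_ge X c n I : (1 <= I <= n)%nat -> (X I <= c)%nat -> (I <= last_ready X c n)%nat.
Proof.
induction n; intros HI HX; [lia|]. simpl. destruct (Nat.leb_spec (X (S n)) c); [lia|].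
destruct (Nat.eq_dec I (S n)) as [->|]; [lia|]. apply IHn; lia.
Qed.

Lemma last_ready_ok X c n : last_ready X c n = 0%nat \/ (X (last_ready X c n) <= c)%nat.
Proof. induction n; simpl; [auto|]. destruct (Nat.leb_spec (X (S n)) c); auto. Qed.

Definition valid_widths (F : nat -> Prop) (d : R) (hh : nat -> nat) : Prop :=
  forall c, hh c = (c + 1)%nat \/ exists i, (1 <= i)%nat /\ hh c = (c / i)%nat /\ good_width F d i c.

Definition shrinking (F : nat -> Prop) (d : R) (hh : nat -> nat) : Prop :=
  forall I, exists c0, forall c, (c0 <= c)%nat -> exists i, (I <= i)%nat /\ (1 <= i)%nat /\ hh c = (c / i)%nat /\ good_width F d i c.

(** A diagonal choice: [i] grows with [c], slowly enough for [c / i] to be good at [c].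
    For the finitely many [c] at which no [i] is available the window is taken so wide
    that it contains the whole support of the bump. *)
Lemma choose_widths F d : has_density F d -> exists hh : nat -> nat,
  valid_widths F d hh /\ shrinking F d hh.
Proof.
intros HF.
assert (H : forall i, exists c0, (1 <= i)%nat -> forall c, (c0 <= c)%nat -> good_width F d i c).
{ intros i. destruct (le_lt_dec 1 i) as [h|h].
  - destruct (good_width_eventually F d i HF h) as [c0 Hc0]. exists c0. auto.
  - exists 0%nat. lia. }
set (X := fun i => proj1_sig (constructive_indefinite_description _ (H i))).
assert (HX : forall i, (1 <= i)%nat -> forall c, (X i <= c)%nat -> good_width F d i c).
{ intros i. unfold X. apply (proj2_sig (constructive_indefinite_description _ (H i))). }
(* the bound [i <= c] keeps the search finite *)
exists (fun c => match last_ready X c c with O => (c + 1)%nat | S i => (c / S i)%nat end). split.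
- intros c. destruct (last_ready_ok X c c) as [E|E].
  + rewrite E. auto.
  + destruct (last_ready X c c) as [|i] eqn:Eb; [auto|]. right. exists (S i). split; [lia|]. split; [auto|]. apply HX; [lia|auto].
- intros I. exists (X (S I) + S I)%nat. intros c Hc.
  assert (HI := last_ready_ge X c c (S I) ltac:(lia) ltac:(lia)).
  destruct (last_ready_ok X c c) as [E|E]; [lia|].
  exists (last_ready X c c). destruct (last_ready X c c) as [|i]; [lia|]. split; [lia|]. split; [lia|]. split; [auto|]. apply HX; [lia|auto].
Qed.

(** The sign pattern to be realised: it flips exactly at the places of [F]. *)
Definition target_sign (F : nat -> Prop) (m : nat) : R := Rprod (fun j => if chi F j then -1 else 1) (S m).

Lemma target_sign_sq F m : target_sign F m * target_sign F m = 1.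
Proof. unfold target_sign. rewrite <- Rprod_mult. apply Rprod_one. intros i _. destruct (chi F i); ring. Qed.

Definition orientation (F : nat -> Prop) (c h m : nat) : R :=
  (-1) ^ m * psign (fun j => ~ F j) (c + 1 - h) (2 * h) m * target_sign F m.

(** Between [m] and [m + 1] the factor [(-1)^m] always flips, and exactly one of the
    other two does. *)
Lemma orientation_const F c h m : (1 <= h <= c + 1)%nat -> (c + 1 - h <= m < c + 1 - h + 2 * h)%nat ->
  orientation F c h m = orientation F c h (c + 1 - h).
Proof.
intros Hh. set (y := (c + 1 - h)%nat). intros Hm. induction m.
- replace y with 0%nat by lia. reflexivity.
- destruct (Nat.eq_dec (S m) y) as [->|hne]; [reflexivity|].
  rewrite <- IHm by lia. unfold orientation. fold y. rewrite psign_step by lia.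
  change (target_sign F (S m)) with (target_sign F m * (if chi F (S m) then -1 else 1)). simpl pow.
  assert (E : (if chi (fun j => ~ F j) (S m) then -1 else 1) * (if chi F (S m) then -1 else 1) = -1).
  { unfold chi. destruct (excluded_middle_informative (F (S m))); destruct (excluded_middle_informative (~ F (S m))); try tauto; ring. }
  set (u := if chi (fun j => ~ F j) (S m) then -1 else 1) in *. set (v := if chi F (S m) then -1 else 1) in *.
  set (p := psign (fun j => ~ F j) y (2 * h) m).
  transitivity ((-1) ^ m * p * target_sign F m * (-1 * (u * v))); [ring|rewrite E; ring].
Qed.

Lemma orientation_sq F c h m : orientation F c h m * orientation F c h m = 1.
Proof.
unfold orientation. set (p := psign _ _ _ m). assert (Eqa := psign_sq (fun j => ~ F j) (c + 1 - h) (2 * h) m). fold p in Eqa.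
assert (E2 := target_sign_sq F m). assert (E3 : (-1) ^ m * (-1) ^ m = 1).
{ rewrite <- Rpow_mult_distr. replace (-1 * -1) with 1 by ring. apply pow1. }
transitivity (((-1) ^ m * (-1) ^ m) * (p * p) * (target_sign F m * target_sign F m)); [ring|]. rewrite Eqa, E2, E3. ring.
Qed.

Lemma abs_of_sq1 x : x * x = 1 -> Rabs x = 1.
Proof. intros H. unfold Rabs. destruct Rcase_abs; nra. Qed.

(** Normalises the block so that its central coefficient has modulus [bump c c] and the
    target sign. *)
Definition scaling (F : nat -> Prop) (c h : nat) : R := orientation F c h c / Rabs (window_sines F c h c).

Lemma window_sines_lower F c h m : (1 <= h)%nat -> exp (- (16 * INR h)) <= Rabs (window_sines F c h m).
Proof. intros Hh. apply sprod_zeros_lower; auto. Qed.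

Lemma scaling_bound F c h : (1 <= h)%nat -> Rabs (scaling F c h) <= exp (16 * INR h).
Proof.
intros Hh. unfold scaling, Rdiv. rewrite Rabs_mult, (abs_of_sq1 _ (orientation_sq F c h c)), Rmult_1_l.
assert (A := window_sines_lower F c h c Hh). assert (B := exp_pos (- (16 * INR h))).
rewrite Rabs_inv, Rabs_Rabsolu. replace (exp (16 * INR h)) with (/ exp (- (16 * INR h))) by (rewrite exp_Ropp, Rinv_inv; reflexivity).
apply Rinv_le_contravar; auto.
Qed.

Lemma block_coef_in_window F c h m : (1 <= h <= c + 1)%nat -> (c + 1 - h <= m < c + 1 - h + 2 * h)%nat ->
  block_coef F c h (scaling F c h) m * target_sign F m = bump c m * (Rabs (window_sines F c h m) / Rabs (window_sines F c h c)).
Proof.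
intros Hh Hm.
assert (Es : orientation F c h m = orientation F c h c).
{ transitivity (orientation F c h (c + 1 - h)); [|symmetry]; apply orientation_const; lia. }
assert (Hc : 0 < Rabs (window_sines F c h c)) by (eapply Rlt_le_trans; [apply exp_pos|apply window_sines_lower; lia]).
unfold block_coef, scaling. set (p := psign (fun j => ~ F j) (c + 1 - h) (2 * h) m).
assert (Hp : Rabs (window_sines F c h m) = p * window_sines F c h m).
{ assert (A : 0 <= p * window_sines F c h m) by (apply sprod_zeros_sign; lia).
  rewrite <- (Rabs_pos_eq _ A), Rabs_mult. unfold p. rewrite (abs_of_sq1 _ (psign_sq _ _ _ _)). ring. }
assert (Hpp : p * p = 1) by apply psign_sq.
rewrite Hp, <- Es.
assert (Hs := orientation_sq F c h m).
assert (Hsg : orientation F c h m = (-1) ^ m * p * target_sign F m) by reflexivity.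
assert (E3 : (-1) ^ m * target_sign F m * p = orientation F c h m) by (rewrite Hsg; ring).
transitivity (bump c m * (((-1) ^ m * target_sign F m * p) * orientation F c h m) * (p * window_sines F c h m) / Rabs (window_sines F c h c)).
- transitivity (bump c m * (-1) ^ m * target_sign F m * (p * p) * window_sines F c h m * orientation F c h m / Rabs (window_sines F c h c)); [rewrite Hpp; field; lra|field; lra].
- rewrite E3, Hs. field. lra.
Qed.

Lemma target_sign_abs F m : Rabs (target_sign F m) = 1.
Proof. apply abs_of_sq1, target_sign_sq. Qed.

Lemma pow_m1_abs m : Rabs ((-1) ^ m) = 1.
Proof. rewrite <- RPow_abs. replace (Rabs (-1)) with 1 by (rewrite Rabs_left; lra). apply pow1. Qed.

Lemma block_coef_abs F c h m : (1 <= h)%nat ->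
  Rabs (block_coef F c h (scaling F c h) m) = bump c m * (Rabs (window_sines F c h m) / Rabs (window_sines F c h c)).
Proof.
intros Hh. assert (Hc : 0 < Rabs (window_sines F c h c)) by (eapply Rlt_le_trans; [apply exp_pos|apply window_sines_lower; lia]).
unfold block_coef, scaling, Rdiv. rewrite !Rabs_mult, pow_m1_abs, (abs_of_sq1 _ (orientation_sq F c h c)), Rabs_inv, Rabs_Rabsolu.
rewrite (Rabs_pos_eq (bump c m)) by apply bump_nonneg. ring.
Qed.

(** Outside the window the bump is at most [exp(- h^2 / (2 c))], and [h] is close to
    [c / i]; half of the exponent absorbs the variation of the product of sines, the other
    half gives the power of [c]. *)
Lemma block_coef_out_of_window F d c i m : (1 <= i)%nat -> good_width F d i c -> (2 * m <= 3 * c)%nat ->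
  ~ (c + 1 - c / i <= m < c + 1 - c / i + 2 * (c / i))%nat ->
  Rabs (block_coef F c (c / i) (scaling F c (c / i)) m) <= 3 / (20 * ((INR m + 1) * (INR m + 1))).
Proof.
intros Hi (Hc2 & Hh & Hch & Hratio & Hexp & _) Hmc Hout. set (h := (c / i)%nat) in *.
assert (Hc : 0 < Rabs (window_sines F c h c)) by (eapply Rlt_le_trans; [apply exp_pos|apply window_sines_lower; lia]).
assert (HiR : 1 <= INR i) by (change 1 with (INR 1); apply le_INR; lia).
assert (Hii : 1 <= INR i * INR i) by nra.
assert (HcR : 2 <= INR c) by (change 2 with (INR 2); apply le_INR; lia).
assert (HhR : 1 <= INR h) by (change 1 with (INR 1); apply le_INR; lia).
assert (Hhc : (h <= c)%nat) by (apply Nat.Div0.div_le_upper_bound; nia).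
rewrite block_coef_abs by auto.
assert (Hdist : INR h <= Rabs (INR m - INR c)).
{ assert (Hcase : (m + h <= c \/ c + h <= m)%nat) by lia.
  destruct Hcase as [hc|hc]; apply le_INR in hc; rewrite plus_INR in hc.
  - rewrite Rabs_left1; lra.
  - rewrite Rabs_pos_eq; lra. }
assert (Hw := bump_tail c m (INR h) Hc2 ltac:(lra) Hdist).
assert (Hr : Rabs (window_sines F c h m) / Rabs (window_sines F c h c) <= exp (INR c / (32 * (INR i * INR i)))).
{ apply Rle_div_l; [auto|apply Hratio]. }
set (u := INR c / (INR i * INR i)).
assert (Hu : 0 < u) by (apply Rdiv_lt_0_compat; lra).
assert (Hexpo : - (INR h * INR h) / (2 * INR c) + INR c / (32 * (INR i * INR i)) <= - (INR c / (16 * (INR i * INR i)))).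
{ replace (INR c / (32 * (INR i * INR i))) with (u / 32) by (unfold u; field; lra).
  replace (INR c / (16 * (INR i * INR i))) with (u / 16) by (unfold u; field; lra).
  assert (A : u / 8 <= INR h * INR h / (2 * INR c)).
  { apply Rmult_le_reg_r with (8 * INR c * (INR i * INR i)); [apply Rmult_lt_0_compat; lra|].
    replace (u / 8 * (8 * INR c * (INR i * INR i))) with (INR c * INR c) by (unfold u; field; lra).
    replace (INR h * INR h / (2 * INR c) * (8 * INR c * (INR i * INR i))) with ((2 * INR i * INR h) * (2 * INR i * INR h)) by (field; lra).
    apply Rmult_le_compat; lra. }
  unfold Rdiv in *. lra. }
assert (harmonic_prod : bump c m * (Rabs (window_sines F c h m) / Rabs (window_sines F c h c)) <= exp (- (INR c / (16 * (INR i * INR i))))).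
{ apply Rle_trans with (exp (- (INR h * INR h) / (2 * INR c)) * exp (INR c / (32 * (INR i * INR i)))).
  - apply Rmult_le_compat; auto; [apply bump_nonneg|]. apply Rmult_le_pos; [apply Rabs_pos|left; apply Rinv_0_lt_compat; auto].
  - rewrite <- exp_plus. apply exp_le; auto. }
eapply Rle_trans; [apply harmonic_prod|]. rewrite exp_Ropp.
assert (Hm0 := pos_INR m).
assert (Hmc' : INR m + 1 <= 2 * INR c).
{ change 2 with (INR 2). rewrite <- mult_INR, <- S_INR. apply le_INR. lia. }
apply Rle_trans with (/ (60 * (INR c * INR c))); [apply Rinv_le_contravar; [nra|auto]|].
assert (Hmc2 : INR m * 2 <= 3 * INR c).
{ apply le_INR in Hmc. rewrite !mult_INR in Hmc. simpl (INR 2) in Hmc. simpl (INR 3) in Hmc. lra. }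
apply Rmult_le_reg_r with (60 * (INR c * INR c) * (20 * ((INR m + 1) * (INR m + 1)))); [apply Rmult_lt_0_compat; nra|].
replace (/ (60 * (INR c * INR c)) * (60 * (INR c * INR c) * (20 * ((INR m + 1) * (INR m + 1))))) with (20 * ((INR m + 1) * (INR m + 1))) by (field; lra).
replace (3 / (20 * ((INR m + 1) * (INR m + 1))) * (60 * (INR c * INR c) * (20 * ((INR m + 1) * (INR m + 1))))) with (180 * (INR c * INR c)) by (field; lra).
assert ((INR m + 1) * (INR m + 1) <= (2 * INR c) * (2 * INR c)) by (apply Rmult_le_compat; lra). assert (0 <= INR c * INR c) by (apply Rmult_le_pos; lra). lra.
Qed.

(** Coefficient of [z^m] in the sum of the blocks; a block with [c > 2 m] does not
    reach the exponent [m]. *)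
Definition extremal (F : nat -> Prop) (hh : nat -> nat) (m : nat) : R :=
  Rsum (fun c => block_coef F c (hh c) (scaling F c (hh c)) m) (2 * m + 1).

Lemma valid_widths_range F d hh c : valid_widths F d hh -> (1 <= hh c <= c + 1)%nat.
Proof.
intros H. destruct (H c) as [->|(i & Hi & -> & Hg)]; [lia|].
destruct Hg as (_ & Hh & _). split; [auto|]. assert (c / i <= c)%nat by (apply Nat.Div0.div_le_upper_bound; nia). lia.
Qed.

(** The block centred at [m] contributes at least [1 / (m + 1)] with the target sign,
    the other blocks whose window contains [m] contribute with the same sign, and the
    remaining ones, at most [2 m + 1] in number, are bounded by block_coef_out_of_window. *)
Lemma extremal_sign F d hh m : valid_widths F d hh -> / (2 * (INR m + 1)) <= extremal F hh m * target_sign F m.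
Proof.
intros Hv. assert (Hm0 := pos_INR m).
set (e := 3 / (20 * ((INR m + 1) * (INR m + 1)))).
assert (He : 0 < e) by (apply Rdiv_lt_0_compat; nra).
assert (Hterm : forall c, (if Nat.eq_dec c m then / (INR m + 1) else 0) - e <= block_coef F c (hh c) (scaling F c (hh c)) m * target_sign F m).
{ intros c. assert (Hr := valid_widths_range F d hh c Hv).
  assert (Hc : 0 < Rabs (window_sines F c (hh c) c)) by (eapply Rlt_le_trans; [apply exp_pos|apply window_sines_lower; lia]).
  destruct (Nat.eq_dec c m) as [->|hne].
  - rewrite block_coef_in_window by lia. unfold Rdiv. rewrite Rinv_r, Rmult_1_r by lra. assert (A := bump_centre m). lra.
  - destruct (classic (c + 1 - hh c <= m < c + 1 - hh c + 2 * hh c)%nat) as [hin|hout].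
    + rewrite block_coef_in_window by lia.
      assert (0 <= bump c m * (Rabs (window_sines F c (hh c) m) / Rabs (window_sines F c (hh c) c))); [|lra].
      apply Rmult_le_pos; [apply bump_nonneg|]. apply Rmult_le_pos; [apply Rabs_pos|left; apply Rinv_0_lt_compat; auto].
    + destruct (Req_dec (bump c m) 0) as [h0|h0].
      * unfold block_coef. rewrite h0. lra.
      * apply bump_support in h0.
        destruct (Hv c) as [E|(i & Hi & E & Hg)]; [exfalso; lia|].
        rewrite E in *. assert (A := block_coef_out_of_window F d c i m Hi Hg (proj2 h0) hout). fold e in A.
        assert (B : Rabs (block_coef F c (c / i) (scaling F c (c / i)) m * target_sign F m) <= e) by (rewrite Rabs_mult, target_sign_abs; lra).
        apply Rabs_le_between in B. lra. }
unfold extremal. rewrite (Rmult_comm (Rsum _ _)), <- Rsum_scal.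
apply Rle_trans with (Rsum (fun c => (if Nat.eq_dec c m then / (INR m + 1) else 0) + - e) (2 * m + 1)).
- rewrite (Rsum_plus (fun c => if Nat.eq_dec c m then / (INR m + 1) else 0) (fun _ => - e)), Rsum_const.
  assert (A : / (INR m + 1) <= Rsum (fun c => if Nat.eq_dec c m then / (INR m + 1) else 0) (2 * m + 1)).
  { assert (P : 0 < / (INR m + 1)) by (apply Rinv_0_lt_compat; lra).
    eapply Rle_trans; [|apply (Rsum_term_le _ (2 * m + 1) m); [|lia]].
    - cbv beta. destruct (Nat.eq_dec m m); [lra|contradiction].
    - intros j. cbv beta. destruct (Nat.eq_dec j m); lra. }
  rewrite plus_INR, mult_INR. simpl (INR 2). simpl (INR 1).
  assert (B : (2 * INR m + 1) * e <= / (2 * (INR m + 1))).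
  { unfold e. apply Rmult_le_reg_r with (20 * ((INR m + 1) * (INR m + 1))); [nra|].
    replace ((2 * INR m + 1) * (3 / (20 * ((INR m + 1) * (INR m + 1)))) * (20 * ((INR m + 1) * (INR m + 1)))) with (3 * (2 * INR m + 1)) by (field; lra).
    replace (/ (2 * (INR m + 1)) * (20 * ((INR m + 1) * (INR m + 1)))) with (10 * (INR m + 1)) by (field; lra). lra. }
  replace (/ (INR m + 1)) with (2 * / (2 * (INR m + 1))) in A at 1 by (field; lra). lra.
- apply Rsum_le. intros c _. rewrite Rmult_comm. apply Hterm.
Qed.

(** The scaling is at most [exp(16 h)] and [h / c] tends to 0. *)
Lemma scaling_growth F d hh : valid_widths F d hh ->
  shrinking F d hh ->
  forall eps, 0 < eps -> exists K, 0 <= K /\ forall c, Rabs (scaling F c (hh c)) <= K * exp (eps * INR c).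
Proof.
intros Hv Hsm eps He. destruct (INR_unbounded (16 / eps)) as [I HI]. destruct (Hsm I) as [c0 Hc0].
exists (exp (16 * (INR c0 + 1))). split; [left; apply exp_pos|]. intros c.
assert (Hr := valid_widths_range F d hh c Hv). assert (Hc0R := pos_INR c0). assert (HcR := pos_INR c).
eapply Rle_trans; [apply scaling_bound; lia|]. rewrite <- exp_plus. apply exp_le.
destruct (le_lt_dec c0 c) as [h|h].
- destruct (Hc0 c h) as (i & HIi & Hi & E & _). rewrite E.
  assert (A : (i * (c / i) <= c)%nat) by (assert (D := Nat.div_mod_eq c i); lia).
  apply le_INR in A. rewrite mult_INR in A.
  assert (HIiR : INR I <= INR i) by (apply le_INR; auto).
  apply Rlt_div_l in HI; [|auto].
  assert (B : 16 * INR (c / i) <= eps * INR c).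
  { assert (P := pos_INR (c / i)).
    apply Rle_trans with (INR i * eps * INR (c / i)); [apply Rmult_le_compat_r; [auto|]|].
    - assert (INR I * eps <= INR i * eps) by (apply Rmult_le_compat_r; lra). lra.
    - replace (INR i * eps * INR (c / i)) with (eps * (INR i * INR (c / i))) by ring. apply Rmult_le_compat_l; lra. }
  lra.
- assert (INR (hh c) <= INR c0 + 1).
  { rewrite <- S_INR. apply le_INR. lia. }
  assert (0 <= eps * INR c) by (apply Rmult_le_pos; lra). lra.
Qed.

(** * Continuation across the arc *)

Lemma open_disc zeta delta : open (fun z : C => Cmod (z - zeta)%C < delta).
Proof.
intros z Hz. assert (He : 0 < (delta - Cmod (z - zeta)%C) / 2) by lra.
exists (mkposreal _ He). intros y [H1 H2]. simpl in H1, H2.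
change (Rabs (fst y - fst z) < (delta - Cmod (z - zeta)%C) / 2) in H1.
change (Rabs (snd y - snd z) < (delta - Cmod (z - zeta)%C) / 2) in H2.
eapply Rle_lt_trans; [apply (Cmod_dist y z zeta)|].
assert (A : Cmod (y - z)%C <= Rabs (fst y - fst z) + Rabs (snd y - snd z)).
{ replace (y - z)%C with ((RtoC (fst y - fst z)) + Ci * RtoC (snd y - snd z))%C.
  - eapply Rle_trans; [apply Cmod_triangle|]. rewrite Cmod_mult, !Cmod_R, Cmod_Ci. lra.
  - destruct y, z. unfold RtoC, Cplus, Cminus, Copp, Cmult, Ci; simpl. apply injective_projections; simpl; ring. }
lra.
Qed.

(** A geometric majorant from some rank on; the finitely many earlier terms are
    absorbed in the constant. *)
Lemma sums_bounded (B : nat -> R) (K mu : R) (c0 : nat) : 0 < mu -> 0 <= K ->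
  (forall c, (c0 <= c)%nat -> B c <= K * exp (- mu * INR c)) -> exists T, forall n, Rsum B n <= T.
Proof.
intros Hmu HK HB. set (K' := K + Rsum (fun c => Rabs (B c) * exp (mu * INR c)) c0).
assert (HK' : forall c, B c <= K' * exp (- mu) ^ c).
{ intros c. rewrite <- exp_INR. assert (P := exp_pos (- mu * INR c)).
  assert (S0 : 0 <= Rsum (fun c => Rabs (B c) * exp (mu * INR c)) c0).
  { apply Rsum_pos. intros i _. apply Rmult_le_pos; [apply Rabs_pos|left; apply exp_pos]. }
  destruct (le_lt_dec c0 c) as [h|h].
  - eapply Rle_trans; [apply HB; auto|]. apply Rmult_le_compat_r; unfold K'; lra.
  - assert (A : Rabs (B c) * exp (mu * INR c) <= Rsum (fun c => Rabs (B c) * exp (mu * INR c)) c0).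
    { apply (Rsum_term_le (fun c => Rabs (B c) * exp (mu * INR c)) c0 c); auto.
      intros j. apply Rmult_le_pos; [apply Rabs_pos|left; apply exp_pos]. }
    apply Rle_trans with (Rabs (B c) * exp (mu * INR c) * exp (- mu * INR c)).
    + rewrite Rmult_assoc, <- exp_plus. replace (mu * INR c + - mu * INR c) with 0 by ring.
      rewrite exp_0, Rmult_1_r. apply Rle_abs.
    + apply Rmult_le_compat_r; unfold K'; lra. }
assert (Hq : 0 <= exp (- mu) < 1).
{ split; [left; apply exp_pos|]. rewrite <- exp_0. apply exp_increasing. lra. }
exists (K' * / (1 - exp (- mu))). intros n. apply Rle_trans with (Rsum (fun c => K' * exp (- mu) ^ c) n).
- apply Rsum_le. intros; apply HK'.
- rewrite Rsum_scal. apply Rmult_le_compat_l; [|apply Rsum_geom; auto].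
  unfold K'. apply Rplus_le_le_0_compat; auto. apply Rsum_pos. intros i _. apply Rmult_le_pos; [apply Rabs_pos|left; apply exp_pos].
Qed.

(** Total function equal to the sum of the series wherever it converges. *)
Definition series_sum (f : nat -> C -> C) (z : C) : C :=
  epsilon (inhabits (RtoC 0)) (fun l => Cser (fun i => f i z) l).

Lemma series_sum_expands f z0 delta c B T : 0 < delta ->
  (forall i, expands (fun v => f i (z0 + v)%C) (c i) delta (B i)) -> (forall n, Rsum B n <= T) ->
  exists d, (forall k, Cser (fun i => c i k) (d k)) /\ expands (fun v => series_sum f (z0 + v)%C) d delta T.
Proof.
intros Hd Hf HT. destruct (expands_sum_ex _ _ _ _ _ Hd Hf HT) as [Hv Hk].
exists (fun k => epsilon (inhabits (RtoC 0)) (fun l => Cser (fun i => c i k) l)).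
assert (Hk' : forall k, Cser (fun i => c i k) (epsilon (inhabits (RtoC 0)) (fun l => Cser (fun i => c i k) l))).
{ intros k. apply epsilon_spec. apply Hk. }
split; [exact Hk'|]. apply (expands_sum _ _ _ _ _ _ _ Hd Hf HT); auto.
intros v Hvv. unfold series_sum. apply epsilon_spec. apply Hv. auto.
Qed.

(** One function, the pointwise sum of the blocks, serves inside the disc and near
    [zeta]; absolute convergence in both regions gives its expansions there. *)
Lemma continuation_of_blocks (a : nat -> R) (f : nat -> C -> C) (p : nat -> nat -> R) (zeta : C) (delta : R) :
  0 < delta ->
  (forall rho, 0 < rho < 1 -> exists B T,
     (forall c, expands (f c) (fun m => RtoC (p c m)) rho (B c)) /\ forall n, Rsum B n <= T) ->
  (forall m, Cser (fun c => RtoC (p c m)) (RtoC (a m))) ->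
  (exists cc B T, (forall c, expands (fun v => f c (zeta + v)%C) (cc c) delta (B c)) /\ forall n, Rsum B n <= T) ->
  immediate_continuation a zeta.
Proof.
intros Hd Hin Hcol (cc & B & T & Hz & HT).
assert (HG : forall rho, 0 < rho < 1 -> exists T, expands (fun v => series_sum f (RtoC 0 + v)%C) (fun m => RtoC (a m)) rho T).
{ intros rho Hr. destruct (Hin rho Hr) as (B' & T' & HB' & HT').
  destruct (series_sum_expands f (RtoC 0) rho (fun c m => RtoC (p c m)) B' T') as (d & Hdk & He); auto; [lra| |].
  - intros i. refine (expands_ext _ _ _ _ _ _ _ _ (HB' i)); auto. intros. cbv beta. rewrite Cplus_0_l. reflexivity.
  - exists T'. refine (expands_ext _ _ _ _ _ _ _ _ He); auto. intros k. apply (Cser_unique _ _ _ (Hdk k) (Hcol k)). }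
exists (fun z => Cmod (z - zeta)%C < delta), (series_sum f). split; [apply open_disc|]. split; [|split].
- replace (zeta - zeta)%C with (RtoC 0) by ring. rewrite Cmod_0. auto.
- intros z [Hz1|Hz1].
  + assert (P := Cmod_ge_0 z). destruct (HG ((1 + Cmod z) / 2)) as [T' HT']; [lra|].
    assert (A := analytic_of_expands _ _ z _ _ _ HT' ltac:(lra)). rewrite Cplus_0_l in A. exact A.
  + destruct (series_sum_expands f zeta delta cc B T Hd Hz HT) as (d & _ & He).
    assert (A := analytic_of_expands _ _ (z - zeta)%C _ _ _ He Hz1). replace (zeta + (z - zeta))%C with z in A by ring. exact A.
- intros z Hz1. assert (P := Cmod_ge_0 z). destruct (HG ((1 + Cmod z) / 2)) as [T' [_ HT']]; [lra|].
  apply pseries_Cser. specialize (HT' z ltac:(lra)). rewrite Cplus_0_l in HT'. exact HT'.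
Qed.

(** Two-sided control of every coefficient, from which both the radius of convergence and
    the root limit follow. *)
Definition subexponential (a : nat -> R) : Prop :=
  forall eps, 0 < eps -> exists N, forall m, (N <= m)%nat ->
    exp (- eps * INR m) <= Rabs (a m) <= exp (eps * INR m).

Lemma radius_of_subexponential a : subexponential a -> CV_radius a = Finite 1.
Proof.
intros H. assert (E : is_lub_Rbar (fun r => exists M, forall n, Rabs (a n * r ^ n) <= M) (Finite 1)).
{ split.
  - intros r (M & HM). simpl. apply Rnot_lt_le. intros Hr.
    assert (Hl : 0 < ln r) by (rewrite <- ln_1; apply ln_increasing; lra).
    destruct (H (ln r / 2)) as [N HN]; [lra|]. destruct (exp_dominates (M + 1) (ln r / 2)) as [N' HN']; [lra|].
    specialize (HN (N + N')%nat ltac:(lia)). specialize (HN' (N + N')%nat ltac:(lia)). specialize (HM (N + N')%nat).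
    set (n := (N + N')%nat) in *. assert (Hn := pos_INR n).
    assert (M0 : 0 <= M) by (eapply Rle_trans; [apply Rabs_pos|apply HM]).
    rewrite Rabs_mult, (Rabs_pos_eq (r ^ n)) in HM by (apply pow_le; lra).
    assert (Er : r ^ n = exp (ln r * INR n)) by (rewrite exp_INR, exp_ln by lra; reflexivity).
    assert (A : exp (- (ln r / 2) * INR n) * r ^ n <= M).
    { eapply Rle_trans; [|apply HM]. apply Rmult_le_compat_r; [apply pow_le; lra|apply HN]. }
    rewrite Er, <- exp_plus in A. replace (- (ln r / 2) * INR n + ln r * INR n) with (ln r / 2 * INR n) in A by field.
    assert (0 <= M * INR n) by (apply Rmult_le_pos; lra). lra.
  - intros b Hb. apply Rbar_not_lt_le. intros Hlt.
    assert (Hr : exists r, 0 < r < 1 /\ Rbar_lt b (Finite r)).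
    { destruct b as [b| |]; simpl in Hlt; [|contradiction|].
      - exists (Rmax (/ 2) ((1 + b) / 2)). simpl. split; [split|].
        + eapply Rlt_le_trans; [|apply Rmax_l]. lra.
        + apply Rmax_lub_lt; lra.
        + eapply Rlt_le_trans; [|apply Rmax_r]. lra.
      - exists (/ 2). simpl. split; [lra|auto]. }
    destruct Hr as (r & Hr & Hbr). apply (Rbar_lt_not_le _ _ Hbr). apply Hb.
    assert (Hl : ln r < 0) by (rewrite <- ln_1; apply ln_increasing; lra).
    destruct (H (- ln r)) as [N HN]; [lra|].
    exists (1 + Rsum (fun n => Rabs (a n * r ^ n)) N). intros n.
    assert (S0 : 0 <= Rsum (fun n => Rabs (a n * r ^ n)) N) by (apply Rsum_pos; intros; apply Rabs_pos).
    destruct (le_lt_dec N n) as [h|h].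
    + assert (A : Rabs (a n * r ^ n) <= 1); [|lra].
      rewrite Rabs_mult, (Rabs_pos_eq (r ^ n)) by (apply pow_le; lra).
      replace (r ^ n) with (exp (ln r * INR n)) by (rewrite exp_INR, exp_ln by lra; reflexivity).
      apply Rle_trans with (exp (- ln r * INR n) * exp (ln r * INR n)).
      * apply Rmult_le_compat_r; [left; apply exp_pos|apply HN; auto].
      * rewrite <- exp_plus. replace (- ln r * INR n + ln r * INR n) with 0 by ring. rewrite exp_0. lra.
    + assert (A := Rsum_term_le (fun n => Rabs (a n * r ^ n)) N n (fun j => Rabs_pos _) h). cbv beta in A. lra. }
assert (F := CV_radius_bounded a). apply is_lub_Rbar_unique in E. apply is_lub_Rbar_unique in F. congruence.
Qed.

Lemma root_limit_of_subexponential a : subexponential a -> root_limit_one_on_support a.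
Proof.
intros H. unfold root_limit_one_on_support, Rpower.
apply (filterlim_comp _ _ _ (fun m => / INR m * ln (Rabs (a m))) exp _ (locally 0)).
2:{ rewrite <- exp_0. apply continuous_exp. }
apply filterlim_locally. intros eps. assert (He := cond_pos eps).
destruct (H (eps / 2)) as [N HN]; [lra|]. exists (N + 1)%nat. intros m Hm Hne.
specialize (HN m ltac:(lia)). assert (Hm1 : 0 < INR m) by (apply lt_0_INR; lia).
assert (Ha : 0 < Rabs (a m)) by (apply Rabs_pos_lt; auto).
assert (L1 : - (eps / 2) * INR m <= ln (Rabs (a m))).
{ rewrite <- (ln_exp (- (eps / 2) * INR m)). apply ln_le; [apply exp_pos|apply HN]. }
assert (L2 : ln (Rabs (a m)) <= eps / 2 * INR m).
{ rewrite <- (ln_exp (eps / 2 * INR m)). apply ln_le; [auto|apply HN]. }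
change (Rabs (/ INR m * ln (Rabs (a m)) - 0) < eps). rewrite Rminus_0_r.
assert (Hi : 0 < / INR m) by (apply Rinv_0_lt_compat; auto).
assert (E : / INR m * (eps / 2 * INR m) = eps / 2) by (field; lra).
apply Rle_lt_trans with (eps / 2); [|lra]. apply Rabs_le. split.
- apply (Rmult_le_compat_l (/ INR m)) in L1; lra.
- apply (Rmult_le_compat_l (/ INR m)) in L2; lra.
Qed.

Lemma bump_le_1 c m : bump c m <= 1.
Proof.
destruct (le_lt_dec (2 * c + 1) m) as [h|h].
- destruct (Req_dec (bump c m) 0) as [h0|h0]; [lra|]. apply bump_support in h0. lia.
- assert (A := bump_gf_le c 1 ltac:(lra)). rewrite pow1 in A.
  assert (B := Rsum_term_le (fun m => bump c m * 1 ^ m) (2 * c + 1) m). cbv beta in B. rewrite pow1 in B.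
  enough (bump c m * 1 <= 1) by lra. eapply Rle_trans; [apply B; auto|exact A].
  intros j. rewrite pow1. assert (C := bump_nonneg c j). lra.
Qed.

Lemma block_coef_le_tau F c h tau m : Rabs (block_coef F c h tau m) <= Rabs tau.
Proof.
unfold block_coef. rewrite !Rabs_mult, pow_m1_abs, Rmult_1_l, (Rabs_pos_eq (bump c m)) by apply bump_nonneg.
assert (A := bump_nonneg c m). assert (B := bump_le_1 c m). assert (P := Rabs_pos tau).
assert (D : Rabs (window_sines F c h m) <= 1) by apply sprod_le_1. assert (Q := Rabs_pos (window_sines F c h m)).
apply Rle_trans with (1 * (1 * Rabs tau)); [|lra]. apply Rmult_le_compat; auto.
- apply Rmult_le_pos; auto.
- apply Rmult_le_compat_r; auto.
Qed.

Lemma extremal_subexponential F d hh (Hv : valid_widths F d hh) (Hsm : shrinking F d hh) : subexponential (extremal F hh).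
Proof.
intros eps He. destruct (scaling_growth F d hh Hv Hsm (eps / 4)) as (K & HK & Ht); [lra|].
destruct (exp_dominates (2 * K) (eps / 2)) as [N1 HN1]; [lra|].
destruct (exp_dominates 2 eps He) as [N2 HN2].
exists (N1 + N2)%nat. intros m Hm. specialize (HN1 m ltac:(lia)). specialize (HN2 m ltac:(lia)).
assert (Hm0 := pos_INR m). split.
- assert (A := extremal_sign F d hh m Hv). apply Rle_trans with (/ (2 * (INR m + 1))).
  + replace (- eps * INR m) with (- (eps * INR m)) by ring. rewrite exp_Ropp. apply Rinv_le_contravar; lra.
  + replace (Rabs (extremal F hh m)) with (Rabs (extremal F hh m * target_sign F m)) by (rewrite Rabs_mult, target_sign_abs; ring).
    eapply Rle_trans; [exact A|apply Rle_abs].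
- assert (A : Rabs (extremal F hh m) <= Rsum (fun _ => K * exp (eps / 2 * INR m)) (2 * m + 1)).
  { unfold extremal. eapply Rle_trans; [apply Rsum_Rabs|]. apply Rsum_le. intros c Hc.
    eapply Rle_trans; [apply block_coef_le_tau|]. eapply Rle_trans; [apply Ht|].
    apply Rmult_le_compat_l; auto. apply exp_le.
    assert (B : INR c <= 2 * INR m) by (change 2 with (INR 2); rewrite <- mult_INR; apply le_INR; lia).
    replace (eps / 2 * INR m) with (eps / 4 * (2 * INR m)) by field. apply Rmult_le_compat_l; lra. }
  rewrite Rsum_const, plus_INR, mult_INR in A. simpl (INR 2) in A. simpl (INR 1) in A.
  assert (P := exp_pos (eps / 2 * INR m)).
  replace (eps * INR m) with (eps / 2 * INR m + eps / 2 * INR m) by field. rewrite exp_plus.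
  eapply Rle_trans; [exact A|].
  apply Rle_trans with (2 * K * (INR m + 1) * exp (eps / 2 * INR m)).
  + rewrite <- Rmult_assoc. apply Rmult_le_compat_r; [lra|].
    assert (0 <= K * INR m) by (apply Rmult_le_pos; lra). lra.
  + apply Rmult_le_compat_r; lra.
Qed.

Lemma extremal_nonzero F d hh (Hv : valid_widths F d hh) m : extremal F hh m <> 0.
Proof.
intros E. assert (A := extremal_sign F d hh m Hv). rewrite E in A. assert (Hm := pos_INR m).
assert (0 < / (2 * (INR m + 1))) by (apply Rinv_0_lt_compat; lra). lra.
Qed.

(** As no coefficient vanishes, a sign change at [m] compares [m] with [m - 1], between
    which the target sign flips only if [m] is in [F]. *)
Lemma extremal_sign_changes F d hh (Hv : valid_widths F d hh) m : sign_change_at (extremal F hh) m -> F m.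
Proof.
intros (k & Hk & Hneg & Hzero).
assert (E : m = S k).
{ destruct (Nat.eq_dec m (S k)) as [h|h]; [auto|]. exfalso. apply (extremal_nonzero F d hh Hv (S k)). apply Hzero. lia. }
subst m. apply NNPP. intros HF.
assert (Ee : target_sign F (S k) = target_sign F k).
{ change (target_sign F (S k)) with (target_sign F k * (if chi F (S k) then -1 else 1)).
  unfold chi. destruct (excluded_middle_informative (F (S k))); [contradiction|]. ring. }
assert (A := extremal_sign F d hh (S k) Hv). assert (B := extremal_sign F d hh k Hv). rewrite Ee in A.
assert (P1 : 0 < / (2 * (INR (S k) + 1))) by (apply Rinv_0_lt_compat; assert (H := pos_INR (S k)); lra).
assert (P2 : 0 < / (2 * (INR k + 1))) by (apply Rinv_0_lt_compat; assert (H := pos_INR k); lra).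
assert (Q : 0 < (extremal F hh (S k) * target_sign F k) * (extremal F hh k * target_sign F k)) by (apply Rmult_lt_0_compat; lra).
replace (extremal F hh (S k) * target_sign F k * (extremal F hh k * target_sign F k)) with (extremal F hh (S k) * extremal F hh k * (target_sign F k * target_sign F k)) in Q by ring.
rewrite target_sign_sq in Q. lra.
Qed.

Lemma extremal_column F hh m : Cser (fun c => RtoC (block_coef F c (hh c) (scaling F c (hh c)) m)) (RtoC (extremal F hh m)).
Proof.
unfold extremal. rewrite <- Csum_RtoC. apply Cser_finite. intros c Hc. f_equal. unfold block_coef.
destruct (Req_dec (bump c m) 0) as [h0|h0]; [rewrite h0; ring|]. apply bump_support in h0. lia.
Qed.

Lemma blocks_inside F d hh (Hv : valid_widths F d hh) (Hsm : shrinking F d hh) rho : 0 < rho < 1 -> exists B T,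
  (forall c, expands (block F c (hh c) (scaling F c (hh c))) (fun m => RtoC (block_coef F c (hh c) (scaling F c (hh c)) m)) rho (B c)) /\
  forall n, Rsum B n <= T.
Proof.
intros Hr. exists (fun c => Rabs (scaling F c (hh c)) * rho ^ bump_start c).
assert (Hl : ln rho < 0) by (rewrite <- ln_1; apply ln_increasing; lra).
destruct (scaling_growth F d hh Hv Hsm (- ln rho / 4)) as (K & HK & Ht); [lra|].
destruct (sums_bounded (fun c => Rabs (scaling F c (hh c)) * rho ^ bump_start c) K (- ln rho / 4) 0) as [T HT]; [lra|auto| |].
- intros c _. assert (Hka : INR c <= 2 * INR (bump_start c)).
  { change 2 with (INR 2). rewrite <- mult_INR. apply le_INR. assert (A := bump_radius_bounds c). unfold bump_start. lia. }
  replace (rho ^ bump_start c) with (exp (ln rho * INR (bump_start c))) by (rewrite exp_INR, exp_ln by lra; reflexivity).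
  eapply Rle_trans; [apply Rmult_le_compat_r; [left; apply exp_pos|apply Ht]|].
  rewrite Rmult_assoc, <- exp_plus. apply Rmult_le_compat_l; auto. apply exp_le.
  assert (ln rho * (2 * INR (bump_start c)) <= ln rho * INR c) by (apply Rmult_le_compat_neg_l; lra). lra.
- exists T. split; auto. intros c. apply block_expands_0. lra.
Qed.

(** For large [c] the frequencies [phi] of the block satisfy [|phi| <= pi (1 - d + 1/i)] with
    [1/i <= (d - Delta) / 2], hence [|phi + th| / 2 <= be < pi / 2] and the base [sin be] of
    the exponential bound is smaller than 1.  For small [c] any bound does. *)
Lemma blocks_arc F d hh (Hv : valid_widths F d hh) (Hsm : shrinking F d hh) Delta th : 0 <= Delta < d -> d <= 1 -> Rabs th <= PI * Delta ->
  exists delta, 0 < delta /\ exists cc B T,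
  (forall c, expands (fun v => block F c (hh c) (scaling F c (hh c)) (cis th + v)%C) (cc c) delta (B c)) /\
  forall n, Rsum B n <= T.
Proof.
intros HD Hd1 Hth.
assert (Hpi := PI_RGT_0).
set (be := PI * (1 - (d - Delta) / 2) / 2). set (s1 := sin be).
assert (Hbe : 0 < be < PI / 2).
{ unfold be. split.
  - apply Rdiv_lt_0_compat; [|lra]. apply Rmult_lt_0_compat; lra.
  - apply Rmult_lt_compat_r; [lra|]. assert (0 < PI * ((d - Delta) / 2)) by (apply Rmult_lt_0_compat; lra). lra. }
assert (Hs1 : 0 < s1 < 1).
{ split; [apply sin_gt_0; lra|]. rewrite <- sin_PI2. apply sin_increasing_1; lra. }
set (s2 := (1 + s1) / 2). assert (Hs2 : s1 < s2 < 1) by (unfold s2; lra).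
assert (Hinv : 1 < / s2) by (rewrite <- Rinv_1; apply Rinv_lt_contravar; lra).
(* the radius keeps [s1 + delta / 2 <= s2] and [1 + delta <= 1 / s2] *)
set (delta := Rmin (1 - s1) (/ s2 - 1)).
assert (Hdel : 0 < delta) by (apply Rmin_glb_lt; lra).
assert (Hdel1 : delta <= 1 - s1) by apply Rmin_l. assert (Hdel2 : delta <= / s2 - 1) by apply Rmin_r.
set (la := - ln s2). assert (Hla : 0 < la).
{ unfold la. assert (ln s2 < 0) by (rewrite <- ln_1; apply ln_increasing; lra). lra. }
destruct (scaling_growth F d hh Hv Hsm (la / 4)) as (K & HK & Ht); [lra|].
destruct (INR_unbounded (2 / (d - Delta))) as [I HI]. destruct (Hsm (S I)) as [c0 Hc0].
exists delta. split; [auto|].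
assert (Hblock : forall c, exists cc B,
  expands (fun v => block F c (hh c) (scaling F c (hh c)) (cis th + v)%C) cc delta B /\
  ((c0 <= c)%nat -> B <= K * exp (2 * la) * exp (- (la / 4) * INR c))).
{ intros c. assert (Hh := valid_widths_range F d hh c Hv).
  destruct (le_lt_dec c0 c) as [h|h].
  - destruct (Hc0 c h) as (i & HIi & Hi & Ehh & Hg).
    destruct (block_expands_arc F c (hh c) (scaling F c (hh c)) th delta (2 * s1)) as [cc Hcc]; [lia|lra| |].
    + intros phi Hphi.
      assert (Hcount : INR (length (places (fun j => ~ F j) (c + 1 - hh c) (2 * hh c))) * PI / INR (2 * hh c) <= PI * (1 - d + / INR i)).
      { assert (H2h : 0 < INR (2 * hh c)) by (apply lt_0_INR; lia).
        apply (proj2 (Rle_div_l _ _ _ H2h)). destruct Hg as (_ & _ & _ & _ & _ & Hg). rewrite <- Ehh in Hg.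
        apply (Rmult_le_compat_r PI) in Hg; lra. }
      assert (Hi2 : / INR i <= (d - Delta) / 2).
      { assert (A : INR I <= INR i) by (apply le_INR; lia).
        replace ((d - Delta) / 2) with (/ (2 / (d - Delta))) by (field; lra).
        apply Rinv_le_contravar; [apply Rdiv_lt_0_compat; lra|lra]. }
      assert (Hsum : Rabs ((phi + th) / 2) <= be).
      { unfold Rdiv at 1. rewrite Rabs_mult, (Rabs_pos_eq (/ 2)) by lra.
        assert (A := Rabs_triang phi th). unfold be.
        assert (B : PI * / INR i <= PI * ((d - Delta) / 2)) by (apply Rmult_le_compat_l; lra).
        lra. }
      apply Rmult_le_compat_l; [lra|]. unfold s1.
      apply Rabs_le_between in Hsum. apply Rabs_le. split.
      * rewrite <- sin_neg. apply sin_incr_1; lra.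
      * apply sin_incr_1; lra.
    + exists cc. eexists. split; [exact Hcc|]. intros _.
      assert (Hb := bump_radius_bounds c).
      assert (E1 : (1 + delta) ^ bump_start c <= exp (la * INR (bump_start c))).
      { rewrite exp_INR. apply pow_incr. split; [lra|]. unfold la. rewrite exp_Ropp, exp_ln by lra. lra. }
      assert (E2 : ((2 * s1 + delta) / 2) ^ (2 * bump_radius c) <= exp (- la * INR (2 * bump_radius c))).
      { rewrite exp_INR. apply pow_incr. split; [lra|]. unfold la. rewrite Ropp_involutive, exp_ln by lra. unfold s2. lra. }
      apply Rle_trans with ((K * exp (la / 4 * INR c)) * (exp (la * INR (bump_start c)) * exp (- la * INR (2 * bump_radius c)))).
      * apply Rmult_le_compat; [apply Rabs_pos| |apply Ht|].
        -- apply Rmult_le_pos; apply pow_le; lra.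
        -- apply Rmult_le_compat; auto; apply pow_le; lra.
      * rewrite !Rmult_assoc, <- !exp_plus. apply Rmult_le_compat_l; auto. apply exp_le.
        assert (Hka : 2 * INR (bump_start c) <= INR c + 1).
        { change 2 with (INR 2). rewrite <- mult_INR, <- S_INR. apply le_INR. unfold bump_start. lia. }
        assert (Hkb : INR c <= INR (2 * bump_radius c) + 1) by (rewrite <- S_INR; apply le_INR; lia).
        assert (A : la * INR (bump_start c) <= la * ((INR c + 1) / 2)) by (apply Rmult_le_compat_l; lra).
        assert (B : la * (INR c - 1) <= la * INR (2 * bump_radius c)) by (apply Rmult_le_compat_l; lra).
        lra.
  - destruct (block_expands_arc F c (hh c) (scaling F c (hh c)) th delta 2) as [cc Hcc]; [lia|lra| |].
    + intros phi _. assert (A := SIN_bound ((phi + th) / 2)). assert (Rabs (sin ((phi + th) / 2)) <= 1) by (apply Rabs_le; lra). lra.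
    + exists cc. eexists. split; [exact Hcc|]. lia. }
destruct (choice _ Hblock) as [cc Hcc]. destruct (choice _ Hcc) as [B HB].
(* the block decays like [exp(- la c / 2)] and the scaling grows at most like
   [exp(la c / 4)] *)
destruct (sums_bounded B (K * exp (2 * la)) (la / 4) c0) as [T HT]; [lra| | |].
- apply Rmult_le_pos; [auto|left; apply exp_pos].
- intros c Hc. apply HB. auto.
- exists cc, B, T. split; auto. intros c. apply HB.
Qed.

Lemma extremal_continuation F d hh (Hv : valid_widths F d hh) (Hsm : shrinking F d hh) Delta th : 0 <= Delta < d -> d <= 1 -> Rabs th <= PI * Delta ->
  immediate_continuation (extremal F hh) (cis th).
Proof.
intros HD Hd1 Hth. destruct (blocks_arc F d hh Hv Hsm Delta th HD Hd1 Hth) as (delta & Hdelta & Harc).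
apply (continuation_of_blocks _ (fun c => block F c (hh c) (scaling F c (hh c)))
  (fun c m => block_coef F c (hh c) (scaling F c (hh c)) m) _ delta Hdelta (blocks_inside F d hh Hv Hsm) (extremal_column F hh) Harc).
Qed.

Lemma singular_implies_density Delta (hDelta : 0 <= Delta) (Lambda : nat -> Prop) :
  (forall a : nat -> R, CV_radius a = Finite 1 -> root_limit_one_on_support a ->
     (forall m : nat, sign_change_at a m -> Lambda m) -> singular_on a (on_arc Delta)) ->
  forall Lambda' : nat -> Prop, (forall m : nat, Lambda' m -> Lambda m) ->
     forall d : R, has_density Lambda' d -> d <= Delta.
Proof.
intros Ha F HF d Hd. apply Rnot_lt_le. intros Hlt.
destruct (choose_widths F d Hd) as (hh & Hv & Hsm).
assert (Hsub := extremal_subexponential F d hh Hv Hsm).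
destruct (Ha (extremal F hh) (radius_of_subexponential _ Hsub) (root_limit_of_subexponential _ Hsub)) as (zeta & (th & Hth & ->) & Hno).
- intros m Hm. apply HF. apply (extremal_sign_changes F d hh Hv m Hm).
- apply Hno. apply (extremal_continuation F d hh Hv Hsm Delta th); auto. apply (density_between F d Hd).
Qed.

(** * The equivalence *)

Theorem theorem1 (Delta : R) (hDelta : 0 <= Delta <= 1)
    (Lambda : nat -> Prop) (hLambda : forall m : nat, Lambda m -> (0 < m)%nat) :
  (forall a : nat -> R,
     CV_radius a = Finite 1 ->
     root_limit_one_on_support a ->
     (forall m : nat, sign_change_at a m -> Lambda m) ->
     singular_on a (on_arc Delta))
  <->
  (forall Lambda' : nat -> Prop,
     (forall m : nat, Lambda' m -> Lambda m) ->
     forall d : R, has_density Lambda' d -> d <= Delta).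
Proof.
split.
- intros Ha. apply singular_implies_density; [apply hDelta|exact Ha].
- intros Hb a Hrad Hroot Hsign. exact (density_implies_singular Delta hDelta Lambda Hb a Hrad Hroot Hsign).
Qed.
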